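(* Let $\mathbf{K} = \big(B = A^{\mathrm{co}(H)}, \Omega^{\bullet}, \Omega^{(\bullet,\bullet)}, \kappa\big)$ be an irreducible CQH-Kähler space, and let $(\mathcal{E},h_{\mathcal{E}},\overline\partial_{\mathcal{E}})$ be an Hermitian holomorphic relative line module over $\mathbf{K}$. Then: (i) If $H^0_{\partial}(\mathcal{E})$ and $H^0_{\overline\partial}(\mathcal{E})$ are both non-zero, then $\mathcal{E}$ is flat, and $H^0_{\partial}(\mathcal{E}) = H^0_{\overline\partial}(\mathcal{E})$. (ii) If $H^0_{\overline\partial}(\mathcal{E}) \neq 0$ and $H^0_{\overline\partial}(\mathcal{E}) \neq H^0_{\partial}(\mathcal{E})$, then $\mathcal{E}$ is positive and $H^0_{\partial}(\mathcal{E}) = 0$. (iii) If $H^0_{\partial}(\mathcal{E}) \neq 0$ and $H^0_{\overline\partial}(\mathcal{E}) \neq H^0_{\partial}(\mathcal{E})$, then $\mathcal{E}$ is negative and $H^0_{\overline\partial}(\mathcal{E}) = 0$.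
   Context: Conventions. Algebras are unital over $\mathbb{C}$, unadorned tensor products are over $\mathbb{C}$, $\mathbf{i} = \sqrt{-1}$, and Sweedler notation is used. Differential calculi. A differential calculus over an algebra $B$ is a differential graded algebra $(\Omega^\bullet = \bigoplus_{k\ge 0}\Omega^k, \mathrm{d})$ with $\Omega^0 = B$, generated as an algebra by the elements $a, \mathrm{d}b$ for $a,b\in B$. It has total degree $m$ if $\Omega^m \neq 0$ and $\Omega^k=0$ for $k>m$. If $B$ is a $*$-algebra, a differential $*$-calculus is a calculus for which $*$ extends to a conjugate-linear involution of $\Omega^\bullet$ with $\mathrm{d}(\omega^* ) = (\mathrm{d}\omega)^*$ and $(\omega\wedge\nu)^* = (-1)^{kl}\nu^*\wedge\omega^*$ for $\omega\in\Omega^k$, $\nu\in\Omega^l$. A complex structure is a $\mathbb{Z}_{\ge0}^2$-algebra grading $\Omega^\bullet=\bigoplus \Omega^{(a,b)}$ with $\Omega^k=\bigoplus_{a+b=k}\Omega^{(a,b)}$, $(\Omega^{(a,b)})^*=\Omega^{(b,a)}$, $\mathrm{d}\Omega^{(a,b)}\subseteq\Omega^{(a+1,b)}\oplus\Omega^{(a,b+1)}$; write $\mathrm{d}=\partial+\overline\partial$ with $\partial$ of degree $(1,0)$ and $\overline\partial$ of degree $(0,1)$. Hermitian and Kähler structures. For a differential $*$-calculus of even total degree $2n$, an Hermitian structure is a pair $(\Omega^{(\bullet,\bullet)},\sigma)$ of a complex structure and a central real ($\sigma^*=\sigma$) form $\sigma\in\Omega^{(1,1)}$ such that, with $L(\omega)=\sigma\wedge\omega$,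 the maps $L^{n-k}:\Omega^k\to\Omega^{2n-k}$ are isomorphisms for $k=0,\dots,n-1$. It is a Kähler structure if $\mathrm{d}\sigma=0$ (and then $\sigma$ is usually denoted $\kappa$). The primitive forms are $P^{(a,b)}=\{\alpha\in\Omega^{(a,b)}: L^{n-a-b+1}(\alpha)=0\}$ for $a+b\le n$, and $0$ otherwise. The Hodge map $*_\sigma:\Omega^\bullet\to\Omega^\bullet$ is the $B$-bimodule map with $*_\sigma(L^j(\omega))=(-1)^{k(k+1)/2}\mathbf{i}^{a-b}\frac{j!}{(n-j-k)!}L^{n-j-k}(\omega)$ for $\omega\in P^{(a,b)}$, $k=a+b$. The Hermitian metric is $g_\sigma(\omega,\nu)=*_\sigma(\omega\wedge*_\sigma(\nu^* ))$ for $\omega,\nu$ homogeneous of equal degree, and $0$ for homogeneous forms of different degree. Quantum homogeneous spaces. A cosemisimple Hopf algebra $A$ has a unique Haar functional, a linear map $\mathbf{h}:A\to\mathbb{C}$ with $\mathbf{h}(1)=1$ and $(\mathrm{id}\otimes\mathbf{h})\Delta(a)=\mathbf{h}(a)1=(\mathbf{h}\otimes\mathrm{id})\Delta(a)$. A compact quantum group algebra (CQGA) is a cosemisimple Hopf $*$-algebra $A$ whose Haar functional $\mathbf{h}$ satisfies $\mathbf{h}(a^*a)>0$ for $a\ne0$. A CQGA-homogeneous space is $B=A^{\mathrm{co}(H)}=\{a\in A: (\mathrm{id}\otimes\pi)\Delta(a)=a\otimes1\}$ for a surjective Hopf $*$-algebra map $\pi:A\to H$ between CQGAs. Write $B^+=B\cap\ker\varepsilon$.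 The category ${}^A_B\mathrm{mod}_0$ has as objects the $B$-bimodules $\mathcal{F}$, finitely generated as left $B$-modules, with a left $A$-comodule structure $\Delta_L$ satisfying $\Delta_L(bfc)=\Delta(b)\Delta_L(f)\Delta(c)$ and $B^+\mathcal{F}=\mathcal{F}B^+$; morphisms are left $A$-comodule $B$-bimodule maps. Takeuchi's functor $\Phi(\mathcal{F})=\mathcal{F}/B^+\mathcal{F}$, with left $H$-coaction $[f]\mapsto\pi(f_{(-1)})\otimes[f_{(0)}]$, is a monoidal equivalence from ${}^A_B\mathrm{mod}_0$ to finite-dimensional left $H$-comodules. A calculus over $B$ is (left $A$-)covariant if the coaction of $B$ extends to make $\Omega^\bullet$ a left $A$-comodule algebra with $\mathrm{d}$ a comodule map; a complex structure is covariant if each $\Omega^{(a,b)}$ is a subcomodule; an Hermitian structure is covariant if moreover $\Delta_L(\sigma)=1\otimes\sigma$. CQH spaces. A CQH-Hermitian space is a quadruple $(B=A^{\mathrm{co}(H)},\Omega^\bullet,\Omega^{(\bullet,\bullet)},\sigma)$ where $B$ is a CQGA-homogeneous space; $\Omega^\bullet$ is a left $A$-covariant differential $*$-calculus over $B$ that is an object of ${}^A_B\mathrm{mod}_0$, of total degree $2n$ with $n\in\mathbb{Z}_{>0}$; $(\Omega^{(\bullet,\bullet)},\sigma)$ is a covariant Hermitian structure with $\mathbf{h}( *_\sigma(\mathrm{d}\omega))=0$ for all $\omega\in\Omega^{2n-1}$; and $(\Omega^\bullet,g_\sigma)$ is an Hermitian module (in the sense below, i.e. $g_\sigma(\omega,\omega)\in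 B_{>0}$ for all $\omega\ne0$). It is a CQH-Kähler space if the Hermitian structure is Kähler, and irreducible if $\Omega^{(1,0)}$ (equivalently $\Omega^{(0,1)}$) is irreducible in ${}^A_B\mathrm{mod}_0$. Modules. Let $B_{\ge0}=\{\sum_i b_i^*b_i\}$ (finite sums) and $B_{>0}=B_{\ge0}\setminus\{0\}$. For a left $B$-module $\mathcal{F}$, ${}^\vee\mathcal{F}={}_B\mathrm{Hom}(\mathcal{F},B)$ with right action $(\phi b)(f)=\phi(f)b$, and $\overline{\mathcal{F}}$ is the conjugate right module, $\overline{f}b=\overline{b^*f}$. An Hermitian module is a pair $(\mathcal{F},h_{\mathcal{F}})$ with $\mathcal{F}$ a finitely generated projective left $B$-module and $h_{\mathcal{F}}:\overline{\mathcal{F}}\to{}^\vee\mathcal{F}$ a right $B$-module isomorphism such that $h_{\mathcal{F}}(f,k):=h_{\mathcal{F}}(\overline{k})(f)$ satisfies $h_{\mathcal{F}}(f,k)=h_{\mathcal{F}}(k,f)^*$ and $h_{\mathcal{F}}(f,f)\in B_{>0}$ for all non-zero $f,k$. A connection on $\mathcal{F}$ is a linear map $\nabla:\mathcal{F}\to\Omega^1\otimes_B\mathcal{F}$ with $\nabla(bf)=\mathrm{d}b\otimes f+b\nabla f$, extended to $\Omega^\bullet\otimes_B\mathcal{F}$ by $\nabla(\omega\otimes f)=\mathrm{d}\omega\otimes f+(-1)^{|\omega|}\omega\wedge\nabla f$; its curvature is $\nabla^2:\mathcal{F}\to\Omega^2\otimes_B\mathcal{F}$, and it is flat if $\nabla^2=0$.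 A $(0,1)$-connection is a connection with respect to $(\Omega^{(0,\bullet)},\overline\partial)$. A holomorphic module is a finitely generated projective left $B$-module with a flat $(0,1)$-connection $\overline\partial_{\mathcal{F}}$ (a holomorphic structure). For a holomorphic Hermitian module $(\mathcal{F},h_{\mathcal{F}},\overline\partial_{\mathcal{F}})$, the Chern connection is the unique connection $\nabla$ that is Hermitian, i.e. $\mathrm{d}\,h_{\mathcal{F}}(f,g)=\mathfrak{h}(\nabla f,1\otimes g)+\mathfrak{h}(1\otimes f,\nabla g)$ with $\mathfrak{h}(\omega\otimes f,\nu\otimes g)=\omega h_{\mathcal{F}}(f,g)\wedge\nu^*$, and that satisfies $\overline\partial_{\mathcal{F}}=(\mathrm{proj}_{\Omega^{(0,1)}}\otimes\mathrm{id})\circ\nabla$; write $\partial_{\mathcal{F}}=(\mathrm{proj}_{\Omega^{(1,0)}}\otimes\mathrm{id})\circ\nabla$. Relative versions. A holomorphic relative Hopf module is a holomorphic module $(\mathcal{F},\overline\partial_{\mathcal{F}})$ with $\mathcal{F}\in{}^A_B\mathrm{mod}_0$ and $\overline\partial_{\mathcal{F}}$ a left $A$-comodule map. An Hermitian relative Hopf module is an Hermitian module with $\mathcal{F}\in{}^A_B\mathrm{mod}_0$ and $\overline{f}\mapsto h_{\mathcal{F}}(\cdot,f)$ a morphism $\overline{\mathcal{F}}\to{}^\vee\mathcal{F}$ in ${}^A_B\mathrm{mod}_0$, where $\overline{\mathcal{F}}$ has $b\overline{f}c=\overline{c^*fb^*}$, $\Delta_L(\overline{f})=(f_{(-1)})^*\otimes\overline{f_{(0)}}$,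 and ${}^\vee\mathcal{F}$ carries the structure of the right dual (so that evaluation $\mathcal{F}\otimes_B{}^\vee\mathcal{F}\to B$ is a morphism). A relative line module is an object $\mathcal{E}$ of ${}^A_B\mathrm{mod}_0$ with $\dim\Phi(\mathcal{E})=1$; an Hermitian holomorphic relative line module $(\mathcal{E},h_{\mathcal{E}},\overline\partial_{\mathcal{E}})$ is a relative line module that is both an Hermitian and a holomorphic relative Hopf module. Positivity. With $\nabla$ the Chern connection of $\mathcal{E}$: $\mathcal{E}$ is positive if there is $\theta\in\mathbb{R}_{>0}$ with $\nabla^2(e)=-\theta\mathbf{i}\kappa\otimes e$ for all $e\in\mathcal{E}$; negative if there is $\theta\in\mathbb{R}_{>0}$ with $\nabla^2(e)=\theta\mathbf{i}\kappa\otimes e$ for all $e\in\mathcal{E}$; flat if $\nabla^2=0$. Degree zero cohomology. $H^0_{\overline\partial}(\mathcal{E})=\ker(\overline\partial_{\mathcal{E}}:\mathcal{E}\to\Omega^{(0,1)}\otimes_B\mathcal{E})$ and $H^0_{\partial}(\mathcal{E})=\ker(\partial_{\mathcal{E}}:\mathcal{E}\to\Omega^{(1,0)}\otimes_B\mathcal{E})$, both regarded as subspaces of $\mathcal{E}$. *)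

(* Defs.v *)
From HB Require Import structures.
From mathcomp Require Import all_boot all_order all_algebra.
From mathcomp Require Import generic_quotient complex.
From mathcomp Require Import boolp classical_sets functions reals.

Set Implicit Arguments.
Unset Strict Implicit.
Unset Printing Implicit Defensive.

Import Order.TTheory GRing.Theory Num.Theory.

Local Open Scope classical_set_scope.
Local Open Scope ring_scope.
Local Open Scope quotient_scope.

(* Tensor products. [tens r l] is the tensor product over S of V, on which S
   acts on the right through r, and W, on which S acts on the left through l.
   Its elements are finite formal sums of pairs (v, w), two sums being identified
   when no balanced map into an abelian group separates them. The lemmas at the
   end of the section establish the universal property. *)
Section Tensor.
Variables (K : comNzRingType) (V W : lmodType K) (S : Type).
Variables (r : S -> {linear V -> V}) (l : S -> W -> W).

Definition balanced (G : zmodType) (f : V -> W -> G) : Prop :=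
  [/\ forall v v' w, f (v + v') w = f v w + f v' w,
      forall v w w', f v (w + w') = f v w + f v w',
      forall c v w, f (c *: v) w = f v (c *: w) &
      forall s v w, f (r s v) w = f v (l s w)].

Definition psum (G : zmodType) (f : V -> W -> G) (s : seq (V * W)) : G :=
  \sum_(p <- s) f p.1 p.2.

Definition tens_rel : rel (seq (V * W)) := fun s t =>
  `[< forall (G : zmodType) (f : V -> W -> G),
        balanced f -> psum f s = psum f t >].

Lemma tens_rel_refl : reflexive tens_rel.
Proof. by move=> s; apply/asboolP. Qed.

Lemma tens_rel_sym : symmetric tens_rel.
Proof. by move=> s t; apply/asboolP/asboolP => h G f /h. Qed.

Lemma tens_rel_trans : transitive tens_rel.
Proof.
move=> t s u /asboolP st /asboolP tu; apply/asboolP => G f fb.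
by rewrite st ?tu.
Qed.

Canonical tens_equiv :=
  EquivRel tens_rel tens_rel_refl tens_rel_sym tens_rel_trans.

Definition tens := {eq_quot tens_equiv}.
HB.instance Definition _ := Choice.on tens.
HB.instance Definition _ := EqQuotient.on tens.

Definition tpure (v : V) (w : W) : tens := \pi_tens [:: (v, w)].

Definition tlift (G : zmodType) (f : V -> W -> G) (x : tens) : G :=
  psum f (repr x).

Definition tens_zero : tens := \pi_tens [::].
Definition tens_add (x y : tens) : tens := \pi_tens (repr x ++ repr y).
Definition tens_opp (x : tens) : tens := \pi_tens [seq (- p.1, p.2) | p <- repr x].
Definition tens_scale (c : K) (x : tens) : tens :=
  \pi_tens [seq (c *: p.1, p.2) | p <- repr x].

Lemma tlift_pi (G : zmodType) (f : V -> W -> G) s :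
  balanced f -> tlift f (\pi_tens s) = psum f s.
Proof.
move=> fb; rewrite /tlift.
have /eqmodP/asboolP : repr (\pi_tens s) = s %[mod {eq_quot tens_equiv}].
  exact: reprK.
exact.
Qed.

Lemma tens_eqP (x y : tens) :
  (forall (G : zmodType) (f : V -> W -> G), balanced f -> tlift f x = tlift f y) ->
  x = y.
Proof.
move=> h; rewrite -[x]reprK -[y]reprK; apply/eqmodP/asboolP => G f fb.
exact: h.
Qed.

Lemma psum_cat (G : zmodType) (f : V -> W -> G) s t :
  psum f (s ++ t) = psum f s + psum f t.
Proof. exact: big_cat. Qed.

Lemma balancedN (G : zmodType) (f : V -> W -> G) v w :
  balanced f -> f (- v) w = - f v w.
Proof.
case=> fD _ _ _; have f0 : f 0 w = 0.
  by apply: (addrI (f 0 w)); rewrite -fD !addr0.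
by apply/eqP; rewrite -addr_eq0 -fD addNr f0.
Qed.

Lemma balanced_scale (G : zmodType) (f : V -> W -> G) c :
  balanced f -> balanced (fun v w => f (c *: v) w).
Proof.
case=> fD fD' fZ fS; split=> [v v' w|v w w'|d v w|s v w].
- by rewrite scalerDr fD.
- by rewrite fD'.
- by rewrite scalerA mulrC -scalerA fZ.
- by rewrite -linearZ fS.
Qed.

Lemma tlift_zero (G : zmodType) (f : V -> W -> G) :
  balanced f -> tlift f tens_zero = 0.
Proof. by move=> fb; rewrite tlift_pi // /psum big_nil. Qed.

Lemma tlift_add (G : zmodType) (f : V -> W -> G) x y :
  balanced f -> tlift f (tens_add x y) = tlift f x + tlift f y.
Proof. by move=> fb; rewrite tlift_pi // psum_cat. Qed.

Lemma tlift_opp (G : zmodType) (f : V -> W -> G) x :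
  balanced f -> tlift f (tens_opp x) = - tlift f x.
Proof.
move=> fb; rewrite tlift_pi // /tlift /psum big_map -sumrN.
by apply: eq_bigr => p _; rewrite balancedN.
Qed.

Lemma tlift_scale (G : zmodType) (f : V -> W -> G) c x :
  balanced f -> tlift f (tens_scale c x) = tlift (fun v w => f (c *: v) w) x.
Proof. by move=> fb; rewrite tlift_pi // /tlift /psum big_map. Qed.

Lemma tens_addA : associative tens_add.
Proof. by move=> x y z; apply: tens_eqP => G f fb; rewrite !tlift_add ?addrA. Qed.
Lemma tens_addC : commutative tens_add.
Proof. by move=> x y; apply: tens_eqP => G f fb; rewrite !tlift_add // addrC. Qed.
Lemma tens_add0 : left_id tens_zero tens_add.
Proof.
by move=> x; apply: tens_eqP => G f fb; rewrite tlift_add ?tlift_zero ?add0r.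
Qed.
Lemma tens_addN : left_inverse tens_zero tens_opp tens_add.
Proof.
move=> x; apply: tens_eqP => G f fb.
by rewrite tlift_add ?tlift_opp ?tlift_zero ?addNr.
Qed.

HB.instance Definition _ :=
  GRing.isZmodule.Build tens tens_addA tens_addC tens_add0 tens_addN.

Lemma tens_scaleA a b (x : tens) :
  tens_scale a (tens_scale b x) = tens_scale (a * b) x.
Proof.
apply: tens_eqP => G f fb; rewrite !tlift_scale //; last exact: balanced_scale.
by apply: eq_bigr => p _; rewrite scalerA.
Qed.
Lemma tens_scale1 : left_id 1 tens_scale.
Proof.
move=> x; apply: tens_eqP => G f fb; rewrite !tlift_scale //.
by apply: eq_bigr => p _; rewrite scale1r.
Qed.
Lemma tens_scaleDr : right_distributive tens_scale +%R.
Proof.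
move=> a x y; apply: tens_eqP => G f fb.
by rewrite tlift_scale // !tlift_add ?tlift_scale //; apply: balanced_scale.
Qed.
Lemma tens_scaleDl (x : tens) : {morph tens_scale^~ x : a b / a + b}.
Proof.
move=> a b; apply: tens_eqP => G f fb.
rewrite tlift_add // !tlift_scale // /tlift /psum -big_split /=.
by apply: eq_bigr => p _; rewrite scalerDl; case: fb => ->.
Qed.

HB.instance Definition _ := GRing.Zmodule_isLmodule.Build K tens
  tens_scaleA tens_scale1 tens_scaleDr tens_scaleDl.

Lemma tpure_balanced : balanced tpure.
Proof.
split=> [v v' w|v w w'|c v w|s v w]; apply: tens_eqP => G f fb;
  rewrite ?tlift_add // !tlift_pi // /psum !big_seq1 /=; by case: fb.
Qed.

Lemma tpureZ c v w : tpure (c *: v) w = c *: tpure v w.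
Proof.
apply: tens_eqP => G f fb; rewrite tlift_scale // !tlift_pi //.
  by rewrite /psum !big_seq1.
exact: balanced_scale.
Qed.

Lemma tliftD (G : zmodType) (f : V -> W -> G) :
  balanced f -> {morph tlift f : x y / x + y}.
Proof. by move=> fb x y; apply: tlift_add. Qed.

Lemma tlift_pure (G : zmodType) (f : V -> W -> G) v w :
  balanced f -> tlift f (tpure v w) = f v w.
Proof. by move=> fb; rewrite tlift_pi // /psum big_seq1. Qed.

Lemma tens_gen (x : tens) : exists s : seq (V * W),
  x = \sum_(p <- s) tpure p.1 p.2.
Proof.
exists (repr x); rewrite -[LHS]reprK; elim: (repr x) => [|[v w] s IH].
  by rewrite big_nil.
rewrite big_cons /= -IH; apply: tens_eqP => G f fb.
by rewrite tlift_add // !tlift_pi // -psum_cat.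
Qed.

End Tensor.

(* The quotient of V by the subspace spanned by N: two vectors are identified
   when no linear map vanishing on N separates them. *)
Section Quotient.
Variables (K : pzRingType) (V : lmodType K) (N : set V).

Definition quot_rel : rel V := fun v w =>
  `[< forall (U : lmodType K) (f : {linear V -> U}),
        (forall x, N x -> f x = 0) -> f v = f w >].

Lemma quot_rel_refl : reflexive quot_rel.
Proof. by move=> s; apply/asboolP. Qed.

Lemma quot_rel_sym : symmetric quot_rel.
Proof. by move=> s t; apply/asboolP/asboolP => h U f /h. Qed.

Lemma quot_rel_trans : transitive quot_rel.
Proof.
move=> t s u /asboolP st /asboolP tu; apply/asboolP => U f fb.
by rewrite st ?tu.
Qed.

Canonical quot_equiv :=
  EquivRel quot_rel quot_rel_refl quot_rel_sym quot_rel_trans.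

Definition quotm := {eq_quot quot_equiv}.
HB.instance Definition _ := Choice.on quotm.
HB.instance Definition _ := EqQuotient.on quotm.

Lemma quot_eqP (v w : V) : (\pi_quotm v = \pi_quotm w) <->
  (forall (U : lmodType K) (f : {linear V -> U}),
     (forall x, N x -> f x = 0) -> f v = f w).
Proof. by split=> [/eqmodP/asboolP|?]; [|apply/eqmodP/asboolP]. Qed.

Lemma quot_repr (v : V) (U : lmodType K) (f : {linear V -> U}) :
  (forall x, N x -> f x = 0) -> f (repr (\pi_quotm v)) = f v.
Proof. by move=> fN; apply: (quot_eqP _ _).1 => //; rewrite reprK. Qed.

Definition quot_zero : quotm := \pi_quotm 0.
Definition quot_add (x y : quotm) : quotm := \pi_quotm (repr x + repr y).
Definition quot_opp (x : quotm) : quotm := \pi_quotm (- repr x).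
Definition quot_scale (c : K) (x : quotm) : quotm := \pi_quotm (c *: repr x).

Local Ltac quot_tac fN :=
  rewrite !(linearD, linearN, linearZ, quot_repr _ fN, linear0) /=.

Lemma quot_addA : associative quot_add.
Proof. by move=> x y z; apply/quot_eqP => U f fN; quot_tac fN; rewrite addrA. Qed.
Lemma quot_addC : commutative quot_add.
Proof. by move=> x y; apply/quot_eqP => U f fN; quot_tac fN; rewrite addrC. Qed.
Lemma quot_add0 : left_id quot_zero quot_add.
Proof.
by move=> x; rewrite -[RHS]reprK; apply/quot_eqP => U f fN; quot_tac fN; rewrite add0r.
Qed.
Lemma quot_addN : left_inverse quot_zero quot_opp quot_add.
Proof. by move=> x; apply/quot_eqP => U f fN; quot_tac fN; rewrite addNr. Qed.

HB.instance Definition _ :=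
  GRing.isZmodule.Build quotm quot_addA quot_addC quot_add0 quot_addN.

Lemma quot_scaleA a b (x : quotm) :
  quot_scale a (quot_scale b x) = quot_scale (a * b) x.
Proof. by apply/quot_eqP => U f fN; quot_tac fN; rewrite scalerA. Qed.
Lemma quot_scale1 : left_id 1 quot_scale.
Proof. by move=> x; rewrite -[RHS]reprK; apply/quot_eqP => U f fN; quot_tac fN; rewrite scale1r. Qed.
Lemma quot_scaleDr : right_distributive quot_scale +%R.
Proof. by move=> a x y; apply/quot_eqP => U f fN; quot_tac fN; rewrite scalerDr. Qed.
Lemma quot_scaleDl (x : quotm) : {morph quot_scale^~ x : a b / a + b}.
Proof. by move=> a b; apply/quot_eqP => U f fN; quot_tac fN; rewrite scalerDl. Qed.

HB.instance Definition _ := GRing.Zmodule_isLmodule.Build K quotm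
  quot_scaleA quot_scale1 quot_scaleDr quot_scaleDl.

End Quotient.

Section TensorC.
Variable K : comNzRingType.

Definition tensC (V W : lmodType K) : lmodType K :=
  tens (fun c : K => GRing.scale c : {linear V -> V}) (fun c (w : W) => c *: w).

Definition pureC (V W : lmodType K) (v : V) (w : W) : tensC V W := tpure _ _ v w.

Definition liftC (V W : lmodType K) (G : zmodType) (f : V -> W -> G)
  (x : tensC V W) : G := tlift f x.

Definition balancedC (V W : lmodType K) (G : zmodType) (f : V -> W -> G) : Prop :=
  [/\ forall v v' w, f (v + v') w = f v w + f v' w,
      forall v w w', f v (w + w') = f v w + f v w' &
      forall c v w, f (c *: v) w = f v (c *: w)].

Local Notation "v ⊗ w" := (pureC v w) (at level 40, left associativity).

Section LiftC.
Variables (V W : lmodType K) (G : zmodType) (f : V -> W -> G).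
Hypothesis fb : balancedC f.

Lemma liftC_balanced :
  balanced (fun c : K => GRing.scale c : {linear V -> V}) (fun c (w : W) => c *: w) f.
Proof. by case: fb. Qed.

Lemma liftC_pure v w : liftC f (v ⊗ w) = f v w.
Proof. exact: tlift_pure liftC_balanced. Qed.

Lemma liftCD x y : liftC f (x + y) = liftC f x + liftC f y.
Proof. exact: (tliftD liftC_balanced). Qed.

Lemma liftC0 : liftC f 0 = 0.
Proof. by apply: (addrI (liftC f 0)); rewrite -liftCD !addr0. Qed.

Lemma liftC_sum (I : Type) (s : seq I) F :
  liftC f (\sum_(i <- s) F i) = \sum_(i <- s) liftC f (F i).
Proof. by apply: (big_morph _ liftCD liftC0). Qed.
End LiftC.

Lemma pureC_balanced (V W : lmodType K) : balancedC (@pureC V W).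
Proof. by case: (tpure_balanced (fun c : K => GRing.scale c : {linear V -> V}) (fun c (w : W) => c *: w)). Qed.

Lemma pureCZ (V W : lmodType K) c (v : V) (w : W) : (c *: v) ⊗ w = c *: (v ⊗ w).
Proof. exact: tpureZ. Qed.

Lemma tensC_ind (V W : lmodType K) (P : tensC V W -> Prop) :
  (forall v w, P (v ⊗ w)) -> P 0 -> (forall x y, P x -> P y -> P (x + y)) ->
  forall x, P x.
Proof.
move=> Pp P0 PD x; have [s ->] := tens_gen x.
by elim: s => [|p s IH]; rewrite ?big_nil // big_cons; apply: PD => //; apply: Pp.
Qed.

Definition mapC (V V' W W' : lmodType K) (f : V -> V') (g : W -> W') :
  tensC V W -> tensC V' W' := liftC (fun v w => f v ⊗ g w).

Definition map2C (V V' V'' W W' W'' : lmodType K)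
    (f : V -> V' -> V'') (g : W -> W' -> W'') (x : tensC V W) (y : tensC V' W') :
  tensC V'' W'' := liftC (fun v w => liftC (fun v' w' => f v v' ⊗ g w w') y) x.

Definition mulC (A A' : algType K) : tensC A A' -> tensC A A' -> tensC A A' :=
  map2C *%R *%R.

End TensorC.

Notation "v ⊗ w" := (pureC v w) (at level 40, left associativity) : ring_scope.

Section Hopf.
Variable C : numClosedFieldType.

Definition conj_linear (V W : lmodType C) (f : V -> W) : Prop :=
  forall (c : C) v v', f (c *: v + v') = c^* *: f v + f v'.

Definition is_star (A : algType C) (s : A -> A) : Prop :=
  [/\ conj_linear s, involutive s & forall a b, s (a * b) = s b * s a].

Definition is_comodule (A : algType C) (Delta : A -> tensC A A) (eps : A -> C)
    (M : lmodType C) (delta : M -> tensC A M) : Prop :=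
  [/\ linear delta,
      forall m, liftC (fun a n => liftC (fun a1 a2 => a1 ⊗ (a2 ⊗ n)) (Delta a))
                  (delta m)
              = liftC (fun a n => a ⊗ delta n) (delta m)
    & forall m, liftC (fun a n => eps a *: n) (delta m) = m].

Record hopfStar := HopfStar {
  hs_alg :> algType C;
  Delta : hs_alg -> tensC hs_alg hs_alg;
  counit : {lrmorphism hs_alg -> C^o};
  antipode : {linear hs_alg -> hs_alg};
  star : hs_alg -> hs_alg;
  Delta_comodule : is_comodule Delta counit Delta;
  Delta_counitr : forall a, liftC (fun a1 a2 => counit a2 *: a1) (Delta a) = a;
  Delta1 : Delta 1 = 1 ⊗ 1;
  DeltaM : forall a b, Delta (a * b) = mulC (Delta a) (Delta b);
  antipodel : forall a,
    liftC (fun a1 a2 => antipode a1 * a2) (Delta a) = (counit a : C) *: 1;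
  antipoder : forall a,
    liftC (fun a1 a2 => a1 * antipode a2) (Delta a) = (counit a : C) *: 1;
  star_star : is_star star;
  Delta_star : forall a, Delta (star a) = mapC star star (Delta a);
  counit_star : forall a, (counit (star a) : C) = (counit a)^*
}.

Arguments Delta {_} _.
Arguments star {_} _.
Arguments counit {_}.
Arguments antipode {_}.

Definition subspace (V : lmodType C) (N : set V) : Prop :=
  N 0 /\ forall (c : C) v w, N v -> N w -> N (c *: v + w).

Definition subcoalgebra (A : hopfStar) (D : set A) : Prop :=
  subspace D /\ forall a, D a -> exists s : seq (A * A),
    (forall p, p \in s -> D p.1 /\ D p.2) /\ Delta a = \sum_(p <- s) p.1 ⊗ p.2.

Definition simple_coalgebra (A : hopfStar) (D : set A) : Prop :=
  [/\ subcoalgebra D, D <> [set 0] &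
      forall D' : set A, subcoalgebra D' -> D' `<=` D -> D' = [set 0] \/ D' = D].

Definition cosemisimple (A : hopfStar) : Prop :=
  forall a : A, exists s : seq A,
    a = \sum_(x <- s) x /\
    forall x, x \in s -> exists2 D : set A, simple_coalgebra D & D x.

Record cqga := CQGA {
  cqga_hopf :> hopfStar;
  cqga_cosemisimple : cosemisimple cqga_hopf;
  haar : {linear cqga_hopf -> C^o};
  haar1 : haar 1 = 1;
  haar_left : forall a : cqga_hopf,
    liftC (fun a1 a2 => (haar a2 : C) *: a1) (Delta a) = (haar a : C) *: 1;
  haar_right : forall a : cqga_hopf,
    liftC (fun a1 a2 => (haar a1 : C) *: a2) (Delta a) = (haar a : C) *: 1;
  haar_gt0 : forall a : cqga_hopf, a != 0 -> (0 : C) < haar (star a * a)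
}.

Arguments haar {_}.

Definition hopf_star_map (A H : hopfStar) (p : {lrmorphism A -> H}) : Prop :=
  [/\ forall a, Delta (p a) = mapC p p (Delta a),
      forall a, counit (p a) = counit a,
      forall a, antipode (p a) = p (antipode a) &
      forall a, star (p a) = p (star a)].

Record homSpace := HomSpace {
  hsA : cqga;
  hsH : cqga;
  hs_proj : {lrmorphism hsA -> hsH};
  hs_hopf : hopf_star_map hs_proj;
  hs_surj : forall y : hsH, exists x : hsA, hs_proj x = y
}.

Section Coinvariants.
Variable X : homSpace.
Local Notation A := (hsA X).
Local Notation pi := (hs_proj X).

Definition rcoact (a : A) : tensC A (hsH X) := mapC idfun pi (Delta a).

Definition coinvariant : {pred A} := fun a => rcoact a == a ⊗ 1.

Record coinv := Coinv { coinv_val : A; _ : coinv_val \in coinvariant }.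

Lemma balanced_map (V V' W W' : lmodType C) (f : {linear V -> V'})
  (g : {linear W -> W'}) : balancedC (fun v w => f v ⊗ g w).
Proof.
have [pD pD' pZ] := pureC_balanced V' W'.
by split=> [v v' w|v w w'|c v w]; rewrite ?linearD ?linearZ ?pD ?pD' ?pZ.
Qed.

Lemma balanced_star (H : hopfStar) :
  balancedC (fun v w => star (v : A) ⊗ star (w : H)).
Proof.
have [pD pD' pZ] := pureC_balanced A H.
have [sl _ _] := star_star A; have [tl _ _] := star_star H.
have slD (v v' : A) : star (v + v') = star v + star v'.
  by have := sl 1 v v'; rewrite !scale1r conjC1 scale1r.
have tlD (v v' : H) : star (v + v') = star v + star v'.
  by have := tl 1 v v'; rewrite !scale1r conjC1 scale1r.
have s0 : star (0 : A) = 0 by apply: (addrI (star 0)); rewrite -slD !addr0.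
have t0 : star (0 : H) = 0 by apply: (addrI (star 0)); rewrite -tlD !addr0.
split=> [v v' w|v w w'|c v w]; rewrite ?slD ?tlD ?pD ?pD' //.
have := sl c v 0; have := tl c w 0.
by rewrite !addr0 s0 t0 !addr0 => -> ->; rewrite pZ.
Qed.

Lemma balanced_mulr (A1 A2 : algType C) (v : A1) (w : A2) :
  balancedC (fun v' w' => (v * v') ⊗ (w * w')).
Proof.
have [pD pD' pZ] := pureC_balanced A1 A2.
by split=> [v1 v2 w1|v1 w1 w2|c v1 w1];
  rewrite ?mulrDr ?pD ?pD' // -!scalerAr pZ.
Qed.

Lemma mulC_balanced (A1 A2 : algType C) (y : tensC A1 A2) :
  balancedC (fun v w => liftC (fun v' w' => (v * v') ⊗ (w * w')) y).
Proof.
have [pD pD' pZ] := pureC_balanced A1 A2.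
split=> [v v' w|v w w'|c v w].
- elim/tensC_ind: y => [a b||x y IHx IHy].
  + by rewrite !(liftC_pure (balanced_mulr _ _)) mulrDl pD.
  + by rewrite !(liftC0 (balanced_mulr _ _)) addr0.
  + by rewrite !(liftCD (balanced_mulr _ _)) IHx IHy addrACA.
- elim/tensC_ind: y => [a b||x y IHx IHy].
  + by rewrite !(liftC_pure (balanced_mulr _ _)) mulrDl pD'.
  + by rewrite !(liftC0 (balanced_mulr _ _)) addr0.
  + by rewrite !(liftCD (balanced_mulr _ _)) IHx IHy addrACA.
- elim/tensC_ind: y => [a b||x y IHx IHy].
  + by rewrite !(liftC_pure (balanced_mulr _ _)) -!scalerAl pZ.
  + by rewrite !(liftC0 (balanced_mulr _ _)).
  + by rewrite !(liftCD (balanced_mulr _ _)) IHx IHy.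
Qed.

Lemma mulC_pure (A1 A2 : algType C) (v v' : A1) (w w' : A2) :
  mulC (v ⊗ w) (v' ⊗ w') = (v * v') ⊗ (w * w').
Proof.
rewrite /mulC /map2C (liftC_pure (mulC_balanced _)).
by rewrite (liftC_pure (balanced_mulr _ _)).
Qed.

Lemma mulC_addl (A1 A2 : algType C) (x x' y : tensC A1 A2) :
  mulC (x + x') y = mulC x y + mulC x' y.
Proof. exact: (liftCD (mulC_balanced y)). Qed.

Lemma mulC_addr (A1 A2 : algType C) (x y y' : tensC A1 A2) :
  mulC x (y + y') = mulC x y + mulC x y'.
Proof.
elim/tensC_ind: x => [v w||x x' IHx IHx'].
- rewrite /mulC /map2C !(liftC_pure (mulC_balanced _)).
  by rewrite (liftCD (balanced_mulr _ _)).
- by rewrite /mulC /map2C !(liftC0 (mulC_balanced _)) addr0.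
- by rewrite !mulC_addl IHx IHx' addrACA.
Qed.

Lemma mulC0 (A1 A2 : algType C) (x : tensC A1 A2) : mulC x 0 = 0.
Proof. by apply: (addrI (mulC x 0)); rewrite -mulC_addr !addr0. Qed.

Lemma mul0C (A1 A2 : algType C) (x : tensC A1 A2) : mulC 0 x = 0.
Proof. by apply: (addrI (mulC 0 x)); rewrite -mulC_addl !addr0. Qed.

Lemma mapC_mul (A1 A2 A3 A4 : algType C) (f : {lrmorphism A1 -> A3})
    (g : {lrmorphism A2 -> A4}) (x y : tensC A1 A2) :
  mapC f g (mulC x y) = mulC (mapC f g x) (mapC f g y).
Proof.
have fgb := balanced_map f g.
elim/tensC_ind: x => [v w||x x' IHx IHx']; last 2 first.
- by rewrite mul0C /mapC (liftC0 fgb) mul0C.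
- by rewrite mulC_addl /mapC !(liftCD fgb) mulC_addl -!/(mapC _ _ _) IHx IHx'.
elim/tensC_ind: y => [v' w'||y y' IHy IHy'].
- by rewrite mulC_pure /mapC !(liftC_pure fgb) mulC_pure !rmorphM.
- by rewrite mulC0 /mapC (liftC0 fgb) mulC0.
- by rewrite mulC_addr /mapC !(liftCD fgb) mulC_addr -!/(mapC _ _ _) IHy IHy'.
Qed.

Lemma rcoact_star a : rcoact (star a) = mapC star star (rcoact a).
Proof.
have [_ _ _ ps] := hs_hopf X.
have sb (H : hopfStar) := balanced_star H.
have fgb := balanced_map (idfun : {linear A -> A}) pi.
rewrite /rcoact Delta_star; elim/tensC_ind: (Delta a) => [v w||x y IHx IHy].
- by rewrite /mapC !(liftC_pure fgb, liftC_pure (sb _)) /= ps.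
- by rewrite /mapC !(liftC0 fgb, liftC0 (sb _)).
- by rewrite /mapC !(liftCD fgb, liftCD (sb _)) -!/(mapC _ _ _) IHx IHy.
Qed.

Lemma star1 (H : hopfStar) : star (1 : H) = 1.
Proof.
have [_ sK sM] := star_star H.
by rewrite -[RHS]sK -[in RHS](mulr1 (star 1)) sM sK mulr1.
Qed.

Lemma coinvariant_star a : a \in coinvariant -> star a \in coinvariant.
Proof.
rewrite !unfold_in => /eqP aB; apply/eqP; rewrite rcoact_star aB.
by rewrite /mapC (liftC_pure (balanced_star _)) star1.
Qed.

Lemma coinvariant_subalg : subalg_closed coinvariant.
Proof.
have [pD _ _] := pureC_balanced A (hsH X).
have fgb := balanced_map (idfun : {linear A -> A}) pi.
have rD a b c : rcoact (c *: a + b) = c *: rcoact a + rcoact b.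
  have [Dl _ _] := Delta_comodule A; rewrite /rcoact Dl /mapC (liftCD fgb).
  congr (_ + _); elim/tensC_ind: (Delta a) => [v w||x y IHx IHy].
  - by rewrite -pureCZ !(liftC_pure fgb) -pureCZ.
  - by rewrite scaler0 (liftC0 fgb) scaler0.
  - by rewrite scalerDr !(liftCD fgb) IHx IHy scalerDr.
split=> [|c a b /eqP aB /eqP bB|a b /eqP aB /eqP bB]; apply/eqP.
- by rewrite /rcoact Delta1 /mapC (liftC_pure fgb) /= rmorph1.
- by rewrite rD aB bB -pureCZ -pD.
- rewrite /rcoact DeltaM.
  by rewrite (mapC_mul idfun) -!/(rcoact _) aB bB mulC_pure mulr1.
Qed.

HB.instance Definition _ := [isSub for coinv_val].
HB.instance Definition _ := [Choice of coinv by <:].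
HB.instance Definition _ := GRing.SubChoice_isSubAlgebra.Build C A _ coinv
  (GRing.subalg_closed_semi coinvariant_subalg).

Lemma coinv_star_subproof (b : coinv) : star (val b) \in coinvariant.
Proof. exact/coinvariant_star/valP. Qed.

Definition bstar (b : coinv) : coinv := Coinv (coinv_star_subproof b).

End Coinvariants.
Arguments coinv_val {X} _.
Arguments bstar {X} _.

(* The conjugate vector space; a bimodule structure on V induces the reversed
   one on it, see [conj_l] and [conj_r]. *)
Definition conjmod (V : lmodType C) : Type := V.
HB.instance Definition _ (V : lmodType C) := GRing.Zmodule.on (conjmod V).

Section ConjMod.
Variable V : lmodType C.
Definition bar (v : V) : conjmod V := v.
Definition conj_scale (c : C) (v : conjmod V) : conjmod V := c^* *: (v : V).
Lemma conj_scaleA a b v : conj_scale a (conj_scale b v) = conj_scale (a * b) v.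
Proof. by rewrite /conj_scale scalerA rmorphM. Qed.
Lemma conj_scale1 : left_id 1 conj_scale.
Proof. by move=> v; rewrite /conj_scale rmorph1 scale1r. Qed.
Lemma conj_scaleDr : right_distributive conj_scale +%R.
Proof. by move=> a u v; rewrite /conj_scale; exact: scalerDr. Qed.
Lemma conj_scaleDl (v : conjmod V) : {morph conj_scale^~ v : a b / a + b}.
Proof. by move=> a b; rewrite /conj_scale rmorphD; exact: scalerDl. Qed.
HB.instance Definition _ := GRing.Zmodule_isLmodule.Build C (conjmod V)
  conj_scaleA conj_scale1 conj_scaleDr conj_scaleDl.
End ConjMod.

Section RelativeModules.
Variable X : homSpace.
Local Notation A := (hsA X).
Local Notation B := (coinv X).

(* The coaction B -> A ⊗ B obtained by restricting the coproduct of A: since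
   A ⊗ B -> A ⊗ A is injective with image containing Delta(B), by coassociativity,
   exactly one y qualifies. *)
Definition coB (b : B) : tensC A B :=
  xget 0 [set y | mapC idfun coinv_val y = Delta (val b)].

Definition Bplus (b : B) : Prop := (counit (val b) : C) = 0.

Definition Bge0 : set B :=
  [set b | exists s : seq B, b = \sum_(x <- s) bstar x * x].
Definition Bgt0 : set B := Bge0 `\ 0.

Definition is_lmodule (F : lmodType C) (l : B -> F -> F) : Prop :=
  [/\ forall b f g, l b (f + g) = l b f + l b g,
      forall a b f, l (a + b) f = l a f + l b f,
      forall c b f, l (c *: b) f = c *: l b f,
      forall f, l 1 f = f &
      forall a b f, l (a * b) f = l a (l b f)].

Definition is_rmodule (F : lmodType C) (r : F -> B -> F) : Prop :=
  [/\ forall b f g, r (f + g) b = r f b + r g b,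
      forall a b f, r f (a + b) = r f a + r f b,
      forall c b f, r f (c *: b) = c *: r f b,
      forall f, r f 1 = f &
      forall a b f, r f (a * b) = r (r f a) b].

Definition is_bimodule (F : lmodType C) (l : B -> F -> F) (r : F -> B -> F) : Prop :=
  [/\ is_lmodule l, is_rmodule r & forall a f b, r (l a f) b = l a (r f b)].

Definition fg_on (F : lmodType C) (l : B -> F -> F) (N : set F) : Prop :=
  exists m (g : 'I_m -> F), (forall i, N (g i)) /\
    forall f, N f -> exists c : 'I_m -> B, f = \sum_i l (c i) (g i).

Definition fg_projective (F : lmodType C) (l : B -> F -> F) : Prop :=
  is_lmodule l /\
  exists m (i : {additive F -> 'rV[B]_m}) (p : {additive 'rV[B]_m -> F}),
    [/\ forall b f, i (l b f) = b *: i f,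
        forall b v, p (b *: v) = l b (p v) &
        cancel i p].

Definition BplusL (F : lmodType C) (l : B -> F -> F) (N : set F) : set F :=
  [set f | exists s : seq (B * F),
     (forall p, p \in s -> Bplus p.1 /\ N p.2) /\ f = \sum_(p <- s) l p.1 p.2].

Definition BplusR (F : lmodType C) (r : F -> B -> F) (N : set F) : set F :=
  [set f | exists s : seq (F * B),
     (forall p, p \in s -> N p.1 /\ Bplus p.2) /\ f = \sum_(p <- s) r p.1 p.2].

(* Objects and morphisms of the category of relative Hopf modules; [delta] is
   the left A-coaction. *)
Definition is_relmod (F : lmodType C) (l : B -> F -> F) (r : F -> B -> F)
    (delta : F -> tensC A F) : Prop :=
  [/\ is_bimodule l r, fg_on l setT, is_comodule Delta counit delta,
      forall b f c, delta (r (l b f) c) =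
        map2C *%R r (map2C *%R l (coB b) (delta f)) (coB c) &
      BplusL l setT = BplusR r setT].

Definition relmod_morphism (F G : lmodType C)
    (lF : B -> F -> F) (rF : F -> B -> F) (dF : F -> tensC A F)
    (lG : B -> G -> G) (rG : G -> B -> G) (dG : G -> tensC A G) (u : F -> G) : Prop :=
  [/\ linear u, forall b f, u (lF b f) = lG b (u f),
      forall f b, u (rF f b) = rG (u f) b &
      forall f, dG (u f) = mapC idfun u (dF f)].

Definition subcomodule (F : lmodType C) (delta : F -> tensC A F) (N : set F) : Prop :=
  subspace N /\ forall f, N f -> exists s : seq (A * F),
    (forall p, p \in s -> N p.2) /\ delta f = \sum_(p <- s) p.1 ⊗ p.2.

Definition is_subobject (F : lmodType C) (l : B -> F -> F) (r : F -> B -> F)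
    (delta : F -> tensC A F) (N : set F) : Prop :=
  [/\ subcomodule delta N, forall b f, N f -> N (l b f) /\ N (r f b),
      fg_on l N & BplusL l N = BplusR r N].

Definition irreducible_object (F : lmodType C) (l : B -> F -> F) (r : F -> B -> F)
    (delta : F -> tensC A F) (M : set F) : Prop :=
  [/\ is_subobject l r delta M, M <> [set 0] &
      forall N, is_subobject l r delta N -> N `<=` M -> N = [set 0] \/ N = M].

(* The vector space underlying Takeuchi's functor. *)
Definition takeuchi (F : lmodType C) (l : B -> F -> F) : lmodType C :=
  quotm (BplusL l setT).

Definition dim1 (V : lmodType C) : Prop :=
  exists2 e : V, e != 0 & forall v, exists c : C, v = c *: e.

Section Dual.
Variables (F : lmodType C) (l : B -> F -> F) (r : F -> B -> F).

Definition left_linear : {pred F -> B} := fun phi =>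
  `[< (forall f g, phi (f + g) = phi f + phi g) /\
      forall b f, phi (l b f) = b * phi f >].

Record ldual := LDual { ldual_fun :> F -> B; _ : ldual_fun \in left_linear }.

Lemma left_linear_closed : submod_closed left_linear.
Proof.
split=> [|c u v /asboolP[uD uZ] /asboolP[vD vZ]]; apply/asboolP.
  by split=> [f g|b f] /=; rewrite ?addr0 ?mulr0.
have E x : (c *: u + v) x = c *: u x + v x by [].
by split=> [f g|b f]; rewrite !E ?uD ?vD ?uZ ?vZ ?scalerDr 1?addrACA // mulrDr scalerAr.
Qed.

HB.instance Definition _ := [isSub for ldual_fun].
HB.instance Definition _ := [Choice of ldual by <:].
HB.instance Definition _ := GRing.SubChoice_isSubLmodule.Build C (F -> B) _ ldual
  left_linear_closed.

(* [as_dual phi] is phi itself when phi is left linear. *)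
Definition as_dual (phi : F -> B) : ldual := insubd 0 phi.

Definition dual_l (b : B) (phi : ldual) : ldual := as_dual (fun f => phi (r f b)).
Definition dual_r (phi : ldual) (b : B) : ldual := as_dual (fun f => phi f * b).

Definition conj_l (b : B) (f : conjmod F) : conjmod F := bar (r f (bstar b)).
Definition conj_r (f : conjmod F) (b : B) : conjmod F := bar (l (bstar b) f).
Definition conj_coact (delta : F -> tensC A F) (f : conjmod F) : tensC A (conjmod F) :=
  liftC (fun a g => star a ⊗ bar g) (delta f).

(* The right dual: evaluation F ⊗_B ldual -> B is a comodule map. *)
Definition is_right_dual (delta : F -> tensC A F) (delta' : ldual -> tensC A ldual) :=
  is_relmod dual_l dual_r delta' /\
  forall f (phi : ldual), coB (phi f) =
    map2C *%R (fun g (psi : ldual) => psi g) (delta f) (delta' phi).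

Definition form_map (h : F -> F -> B) : conjmod F -> ldual :=
  fun k => as_dual (h^~ k).

Record hermitian_module (h : F -> F -> B) : Prop := {
  hm_proj : fg_projective l;
  hm_dual : forall k, h^~ k \in left_linear;
  hm_add : {morph form_map h : f k / f + k};
  hm_right : forall f b, form_map h (conj_r f b) = dual_r (form_map h f) b;
  hm_bij : bijective (form_map h);
  hm_sym : forall f k, h f k = bstar (h k f);
  hm_pos : forall f, f != 0 -> Bgt0 (h f f) }.

Definition hermitian_relmod (delta : F -> tensC A F) (h : F -> F -> B) : Prop :=
  [/\ is_relmod l r delta, hermitian_module h &
      exists2 delta', is_right_dual delta delta' &
        relmod_morphism conj_l conj_r (conj_coact delta) dual_l dual_r delta'
          (form_map h)].

End Dual.
End RelativeModules.

Section Calculus.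
Variable X : homSpace.
Local Notation A := (hsA X).
Local Notation B := (coinv X).

(* A left A-covariant differential *-calculus over B of total degree [cdim].
   The isomorphism of B with the degree zero part is [inB], and [deg k] is the
   projection onto the part of degree k. *)
Record calculus := Calculus {
  Om :> algType C;
  cdim : nat;
  inB : {lrmorphism B -> Om};
  deg : nat -> {linear Om -> Om};
  d : {linear Om -> Om};
  ostar : Om -> Om;
  dL : Om -> tensC A Om;
  deg_proj : forall j k w, deg j (deg k w) = if j == k then deg k w else 0;
  deg_sum : forall w, w = \sum_(k < cdim.+1) deg k w;
  deg_top : exists w, deg cdim w != 0;
  deg_mul : forall j k w v,
    deg j w = w -> deg k v = v -> deg (j + k) (w * v) = w * v;
  inB_inj : injective inB;
  inB_deg0 : forall w, deg 0 w = w <-> exists b, w = inB b;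
  d_deg : forall k w, deg k w = w -> deg k.+1 (d w) = d w;
  d_d : forall w, d (d w) = 0;
  d_leibniz : forall k w v, deg k w = w ->
    d (w * v) = d w * v + (-1) ^+ k * (w * d v);
  calc_gen : forall S : set Om,
    subspace S -> (forall w v, S w -> S v -> S (w * v)) ->
    (forall b, S (inB b)) -> (forall b, S (d (inB b))) -> S = setT;
  ostar_conj : conj_linear ostar;
  ostarK : involutive ostar;
  ostar_inB : forall b, ostar (inB b) = inB (bstar b);
  ostar_d : forall w, ostar (d w) = d (ostar w);
  ostar_mul : forall j k w v, deg j w = w -> deg k v = v ->
    ostar (w * v) = (-1) ^+ (j * k) * (ostar v * ostar w);
  dL_comodule : is_comodule Delta counit dL;
  dL1 : dL 1 = 1 ⊗ 1;
  dL_mul : forall w v, dL (w * v) = mulC (dL w) (dL v);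
  dL_inB : forall b, dL (inB b) = mapC idfun inB (coB b);
  dL_d : forall w, dL (d w) = mapC idfun d (dL w)
}.

Arguments inB {_}.
Arguments deg {_} _.
Arguments d {_}.
Arguments ostar {_} _.
Arguments dL {_} _.

Variable Y : calculus.
Definition Omk (k : nat) : set Y := [set w | deg k w = w].

Definition Om_l (b : B) (w : Y) : Y := inB b * w.
Definition Om_r (w : Y) (b : B) : Y := w * inB b.

(* The inverse of [inB] on the degree zero part. *)
Definition toB (w : Y) : B := xget 0 [set b | inB b = w].

Section Bigrading.
(* [bd a b] is the projection onto the part of bidegree (a, b). *)
Variable bd : nat -> nat -> {linear Y -> Y}.

Definition Omab (a b : nat) : set Y := [set w | bd a b w = w].

Record complex_structure : Prop := {
  bd_proj : forall a b a' b' w, bd a b (bd a' b' w) =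
    if (a == a') && (b == b') then bd a' b' w else 0;
  bd_sum : forall k w, deg k w = \sum_(a < k.+1) bd a (k - a) w;
  bd_mul : forall a b a' b' w v,
    Omab a b w -> Omab a' b' v -> Omab (a + a') (b + b') (w * v);
  bd_star : forall a b w, Omab a b w -> Omab b a (ostar w);
  bd_d : forall a b w, Omab a b w -> d w = bd a.+1 b (d w) + bd a b.+1 (d w)
}.

Definition covariant_complex_structure : Prop :=
  complex_structure /\ forall a b, subcomodule dL (Omab a b).

Definition del (w : Y) : Y :=
  \sum_(a < (cdim Y).+1) \sum_(b < (cdim Y).+1) bd a.+1 b (d (bd a b w)).
Definition delbar (w : Y) : Y :=
  \sum_(a < (cdim Y).+1) \sum_(b < (cdim Y).+1) bd a b.+1 (d (bd a b w)).

Section Hermitian.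
Variables (n : nat) (sigma : Y).

Definition lefschetz (w : Y) : Y := sigma * w.

Record hermitian_structure : Prop := {
  hs_dim : cdim Y = n.*2;
  hs_complex : complex_structure;
  hs_central : forall w, sigma * w = w * sigma;
  hs_real : ostar sigma = sigma;
  hs_bidegree : Omab 1 1 sigma;
  hs_lefschetz : forall k, (k < n)%N ->
    set_bij (Omk k) (Omk (n.*2 - k)) (iter (n - k) lefschetz)
}.

Definition primitive (a b : nat) : set Y := [set w |
  if (a + b <= n)%N then Omab a b w /\ iter (n - (a + b)).+1 lefschetz w = 0
  else w = 0].

Definition is_hodge (s : Y -> Y) : Prop :=
  [/\ forall w v, s (w + v) = s w + s v,
      forall b w, s (inB b * w) = inB b * s w,
      forall b w, s (w * inB b) = s w * inB b &
      forall a b j w, (j + (a + b) <= n)%N -> primitive a b w ->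
        let k := (a + b)%N in
        s (iter j lefschetz w) =
          ((-1) ^+ (k * k.+1)./2 * 'i ^ (a%:Z - b%:Z)
             * (j`!%:R / (n - j - k)`!%:R) : C)
          *: iter (n - j - k) lefschetz w].

(* For a Hermitian structure the Lefschetz decomposition of Om gives existence
   and uniqueness. *)
Definition hodge : Y -> Y := xget (fun=> 0) [set s | is_hodge s].

(* Forms of different degrees are orthogonal. *)
Definition metric (w v : Y) : B :=
  toB (\sum_(k < (cdim Y).+1) hodge (deg k w * hodge (ostar (deg k v)))).

End Hermitian.
End Bigrading.

Section Connections.
Variables (F : lmodType C) (l : B -> F -> F).

Definition Om_rlin (b : B) : {linear Y -> Y} := inB b \o* idfun.

(* Om ⊗_B F *)
Definition tensB : lmodType C := tens Om_rlin l.
Definition pureB (w : Y) (f : F) : tensB := tpure Om_rlin l w f.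
Definition liftB (G : zmodType) (u : Y -> F -> G) (x : tensB) : G := tlift u x.
Definition mapB (p : Y -> Y) : tensB -> tensB := liftB (fun w f => pureB (p w) f).

(* w |-> (-1)^|w| w, extended additively *)
Definition gsign (w : Y) : Y := \sum_(k < (cdim Y).+1) (-1) ^+ k * deg k w.

(* Connections with respect to the differential [dd], with values in the image
   of [p], the projection of Om onto the space of one-forms under
   consideration. *)
Definition is_connection (p dd : Y -> Y) (nabla : F -> tensB) : Prop :=
  [/\ linear nabla, forall f, mapB p (nabla f) = nabla f &
      forall b f, nabla (l b f) =
        pureB (dd (inB b)) f + mapB (fun w => inB b * w) (nabla f)].

Definition curvature (dd : Y -> Y) (nabla : F -> tensB) (f : F) : tensB :=
  liftB (fun w g => pureB (dd w) g + mapB (fun v => gsign w * v) (nabla g))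
    (nabla f).

Variable bd : nat -> nat -> {linear Y -> Y}.

Definition holomorphic_structure (db : F -> tensB) : Prop :=
  is_connection (bd 0 1) (delbar bd) db /\
  forall f, curvature (delbar bd) db f = 0.

Definition holomorphic_module (db : F -> tensB) : Prop :=
  fg_projective l /\ holomorphic_structure db.

Definition form_ext (h : F -> F -> B) (x y : tensB) : Y :=
  liftB (fun w f => liftB (fun v g => w * inB (h f g) * ostar v) y) x.

Definition is_chern (h : F -> F -> B) (db nabla : F -> tensB) : Prop :=
  [/\ is_connection (deg 1) d nabla,
      forall f g, d (inB (h f g)) =
        form_ext h (nabla f) (pureB 1 g) + form_ext h (pureB 1 f) (nabla g) &
      forall f, db f = mapB (bd 0 1) (nabla f)].

(* Existence and uniqueness hold for a Hermitian module (F, h). *)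
Definition chern (h : F -> F -> B) (db : F -> tensB) : F -> tensB :=
  xget (fun=> 0) [set nabla | is_chern h db nabla].

Definition tensB_coact (delta : F -> tensC A F) : tensB -> tensC A tensB :=
  liftB (fun w f => map2C *%R pureB (dL w) (delta f)).

Definition holomorphic_relmod (r : F -> B -> F) (delta : F -> tensC A F)
    (db : F -> tensB) : Prop :=
  [/\ is_relmod l r delta, holomorphic_module db &
      forall f, tensB_coact delta (db f) = mapC idfun db (delta f)].

End Connections.
End Calculus.
Arguments inB {_ _}.
Arguments deg {_ _} _.
Arguments d {_ _}.
Arguments ostar {_ _} _.
Arguments dL {_ _} _.

(* CQH-Hermitian spaces; [half_dim] is half of the total degree. *)
Record CQHHermitian := {
  cqh_space : homSpace;
  cqh_calc : calculus cqh_space;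
  cqh_bd : nat -> nat -> {linear cqh_calc -> cqh_calc};
  half_dim : nat;
  kappa : cqh_calc;
  half_dim_gt0 : (0 < half_dim)%N;
  cqh_relmod : is_relmod (@Om_l _ cqh_calc) (@Om_r _ cqh_calc) (@dL _ cqh_calc);
  cqh_complex : covariant_complex_structure cqh_bd;
  cqh_hermitian : hermitian_structure cqh_bd half_dim kappa;
  cqh_coinvariant : dL kappa = 1 ⊗ kappa;
  cqh_closed : forall w : cqh_calc, Omk (half_dim.*2.-1) w ->
    (haar (val (toB (hodge cqh_bd half_dim kappa (d w)))) : C) = 0;
  cqh_metric :
    hermitian_module (@Om_l _ cqh_calc) (metric cqh_bd half_dim kappa)
}.

Definition is_kahler (K : CQHHermitian) : Prop := d (kappa K) = 0.

Definition is_irreducible (K : CQHHermitian) : Prop :=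
  irreducible_object (@Om_l _ (cqh_calc K)) (@Om_r _ (cqh_calc K))
    (@dL _ (cqh_calc K)) (Omab (cqh_bd K) 1 0).

Section LineModules.
Variable K : CQHHermitian.
Local Notation B := (coinv (cqh_space K)).
Local Notation Om := (cqh_calc K).

(* Hermitian holomorphic relative line modules *)
Record lineModule := {
  lm :> lmodType C;
  lm_l : B -> lm -> lm;
  lm_r : lm -> B -> lm;
  lm_coact : lm -> tensC (hsA (cqh_space K)) lm;
  lm_form : lm -> lm -> B;
  lm_delbar : lm -> tensB Om lm_l;
  lm_line : dim1 (takeuchi lm_l);
  lm_hermitian : hermitian_relmod lm_l lm_r lm_coact lm_form;
  lm_holomorphic : holomorphic_relmod (cqh_bd K) lm_r lm_coact lm_delbar
}.

Variable E : lineModule.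

Definition lm_chern : E -> tensB Om (@lm_l E) :=
  chern (cqh_bd K) (@lm_form E) (@lm_delbar E).

Definition lm_del (e : E) : tensB Om (@lm_l E) :=
  mapB (cqh_bd K 1 0) (lm_chern e).

Definition lm_curvature : E -> tensB Om (@lm_l E) :=
  curvature (@d _ Om) lm_chern.

Definition lm_positive : Prop := exists2 theta : C, 0 < theta &
  forall e : E, lm_curvature e = - (theta * 'i) *: pureB (@lm_l E) (kappa K) e.
Definition lm_negative : Prop := exists2 theta : C, 0 < theta &
  forall e : E, lm_curvature e = (theta * 'i) *: pureB (@lm_l E) (kappa K) e.
Definition lm_flat : Prop := forall e : E, lm_curvature e = 0.

Definition H0_delbar : set E := [set e | lm_delbar e = 0].
Definition H0_del : set E := [set e | lm_del e = 0].

End LineModules.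
End Hopf.

Arguments H0_delbar {C K} E _.
Arguments H0_del {C K} E _.

(* Main.v *)
Require Import Defs.
From HB Require Import structures.
From mathcomp Require Import all_boot all_order all_algebra.
From mathcomp Require Import generic_quotient complex boolp classical_sets functions reals.
From mathcomp Require Import ring zify.

Set Implicit Arguments.
Unset Strict Implicit.
Unset Printing Implicit Defensive.

Import Order.TTheory GRing.Theory Num.Theory.

Local Open Scope classical_set_scope.
Local Open Scope ring_scope.

(* For a frame (u_i) of E with sum_i h(e, u_i) u_i = e, which exists because
   finite-dimensional comodules of a compact quantum group algebra are
   unitarizable, everything is expressed through the one-forms
   gamma(e, g) = h(nabla e, g) and the two-forms R(e, g) = h(nabla^2 e, g).
   R is equivariant and E has a one-dimensional fibre, so R(e, g) = h(e, g) rho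
   for a left coinvariant form rho of bidegree (1,1). Coinvariant two-forms are
   central: rho and d rho commute with B, hence rho commutes with dB. By the
   Lefschetz isomorphism, w |-> w rho kappa^(n-2) defines an endomorphism T of the
   irreducible object Om^(1,0), which is a scalar c since some T - c is not onto.
   Then rho - c kappa times kappa^(n-2) annihilates Om^(1,1), so rho = c kappa.
   Finally, integrating d (gamma(e, e) kappa^(n-1)) gives
   n i c |e|^2 = |del e|^2 when delbar e = 0 and - n i c |e|^2 = |delbar e|^2
   when del e = 0, and the three cases follow from the sign of i c. *)

(** * Sums of pure tensors *)

(** Takeuchi's equivalence enters only as a faithfulness principle for elements: a vector vanishes
    once the second legs of its coaction are zero modulo B^+. Modulo B^+ the algebra B acts on both
    sides of a form by the counit, since B^+ Om = Om B^+, so identities between equivariant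
    expressions reduce to identities between scalars. This is what replaces commutativity, both for
    centrality and for R(e, g) = h(e, g) rho. The frame is also made unitary, with coefficient
    matrix t^* t = 1, because the curvature contains the contraction sum_i gamma(e, u_i) gamma(g,
    u_i)^*, whose equivariance comes from this cancellation. The Chern connection, the Hodge map and
    the coaction on B are chosen with a default value, so each needs an existence proof: the frame
    gives the first, positivity of the metric excludes the default for the second, and averaging
    with the Haar functional of H gives the third. The power kappa^(n-2) requires n >= 2; for n = 1
    two-forms are top forms and the fibre alone decides. *)

Section TensorSums.
Variable C : comNzRingType.
Implicit Types U V W G : lmodType C.

(** Sweedler sums run over the chosen representative [repr x]. The right-hand side is by definition
    [liftC] of [pureC], which is additive and fixes pure tensors. *)
Lemma tensCE V W (x : tensC V W) : x = \sum_(p <- repr x) p.1 ⊗ p.2.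
Proof.
change (x = liftC (@pureC C V W) x).
have b := pureC_balanced V W.
elim/tensC_ind: x => [v w||x y {1}-> {1}->].
- by rewrite liftC_pure.
- by rewrite liftC0.
- by rewrite liftCD.
Qed.

Lemma liftC_eq V W (G : zmodType) (f : V -> W -> G) s :
  balancedC f -> liftC f (\sum_(p <- s) p.1 ⊗ p.2) = \sum_(p <- s) f p.1 p.2.
Proof.
by move=> fb; rewrite liftC_sum //; apply: eq_bigr => p _; rewrite liftC_pure.
Qed.

(** A [balancedC] map takes values in an abelian group and has an additive lift; bilinearity is what
    makes [liftC] linear. *)
Definition bilin V W G (f : V -> W -> G) : Prop :=
  (forall w, linear (f^~ w)) /\ (forall v, linear (f v)).

Definition trilin U V W G (f : U -> V -> W -> G) : Prop :=
  [/\ forall v w, linear (fun u => f u v w), forall u w, linear (fun v => f u v w)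
    & forall u v, linear (fun w => f u v w)].

Section Lin.
Variables (V W : lmodType C) (f : V -> W).
Hypothesis fl : linear f.
Lemma linD : {morph f : x y / x + y}.
Proof. by move=> x y; have := fl 1 x y; rewrite !scale1r. Qed.
Lemma lin0 : f 0 = 0.
Proof. by apply: (addrI (f 0)); rewrite -linD !addr0. Qed.
Lemma linZ c x : f (c *: x) = c *: f x.
Proof. by have := fl c x 0; rewrite lin0 !addr0. Qed.
Lemma linN x : f (- x) = - f x.
Proof. by rewrite -scaleN1r linZ scaleN1r. Qed.
Lemma linB : {morph f : x y / x - y}.
Proof. by move=> x y; rewrite linD linN. Qed.
Lemma lin_sum (I : Type) (s : seq I) (P : pred I) F :
  f (\sum_(i <- s | P i) F i) = \sum_(i <- s | P i) f (F i).
Proof. exact: (big_morph f linD lin0). Qed.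
End Lin.

Lemma linear_fun V W (f : {linear V -> W}) : linear f.
Proof. by move=> c x y; rewrite linearP. Qed.

Lemma sum_linear V W (I : Type) (s : seq I) (F : I -> V -> W) :
  (forall i, linear (F i)) -> linear (fun x => \sum_(i <- s) F i x).
Proof.
move=> Fl c x y; rewrite scaler_sumr -big_split /=.
by apply: eq_bigr => i _; rewrite Fl.
Qed.

Lemma bilin_balanced V W G (f : V -> W -> G) : bilin f -> balancedC f.
Proof.
case=> fl fr; split=> [v v' w|v w w'|c v w].
- exact: (linD (fl w)).
- exact: (linD (fr v)).
- by rewrite (linZ (fl w)) (linZ (fr v)).
Qed.

Lemma pureC_bilin V W : bilin (@pureC C V W).
Proof.
have [pD pD' pZ] := pureC_balanced V W.
by split=> [w c v v'|v c w w']; rewrite ?pD ?pD' -?pZ pureCZ.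
Qed.

Lemma comp_bilin V V' W W' G (h : V' -> W' -> G) (f : V -> V') (g : W -> W') :
  bilin h -> linear f -> linear g -> bilin (fun v w => h (f v) (g w)).
Proof.
by case=> hl hr fl gl; split=> [w c x y|v c x y]; rewrite ?fl ?gl ?hl ?hr.
Qed.

Lemma liftC_linear V W G (f : V -> W -> G) : bilin f -> linear (liftC f).
Proof.
move=> /[dup] fbl /bilin_balanced fb c x y; rewrite liftCD //; congr (_ + _).
rewrite [x]tensCE scaler_sumr.
under eq_bigr do rewrite -pureCZ.
rewrite !liftC_sum // scaler_sumr; apply: eq_bigr => p _.
by rewrite !liftC_pure // (linZ (fbl.1 _)).
Qed.

Lemma mapC_linear V V' W W' (f : V -> V') (g : W -> W') :
  linear f -> linear g -> linear (mapC f g).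
Proof. by move=> fl gl; apply/liftC_linear/comp_bilin => //; apply: pureC_bilin. Qed.

Lemma mapC_pure V V' W W' (f : V -> V') (g : W -> W') v w :
  linear f -> linear g -> mapC f g (v ⊗ w) = f v ⊗ g w.
Proof.
move=> fl gl; rewrite /mapC liftC_pure //.
by apply/bilin_balanced/comp_bilin => //; apply: pureC_bilin.
Qed.

Lemma mapC_eq V V' W W' (f : V -> V') (g : W -> W') s :
  linear f -> linear g ->
  mapC f g (\sum_(p <- s) p.1 ⊗ p.2) = \sum_(p <- s) f p.1 ⊗ g p.2.
Proof.
move=> fl gl; rewrite (lin_sum (mapC_linear fl gl)).
by apply: eq_bigr => p _; rewrite mapC_pure.
Qed.

Lemma liftC_mapC V V' W W' G (f : V -> V') (g : W -> W') (u : V' -> W' -> G) x :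
  linear f -> linear g -> bilin u ->
  liftC u (mapC f g x) = liftC (fun v w => u (f v) (g w)) x.
Proof.
move=> fl gl ub; have b := bilin_balanced ub.
rewrite {1}[x]tensCE mapC_eq // liftC_sum //.
by apply: eq_bigr => p _; rewrite liftC_pure.
Qed.

Lemma map2C_eq V V' V'' W W' W'' (f : V -> V' -> V'') (g : W -> W' -> W'') s t :
  bilin f -> bilin g ->
  map2C f g (\sum_(p <- s) p.1 ⊗ p.2) (\sum_(q <- t) q.1 ⊗ q.2) =
  \sum_(p <- s) \sum_(q <- t) f p.1 q.1 ⊗ g p.2 q.2.
Proof.
move=> fb gb.
have inner v w : bilin (fun v' w' => f v v' ⊗ g w w').
  by apply: comp_bilin; [exact: pureC_bilin|exact: fb.2|exact: gb.2].
have E p : liftC (fun v' w' => f p.1 v' ⊗ g p.2 w') (\sum_(q <- t) q.1 ⊗ q.2) =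
    \sum_(q <- t) f p.1 q.1 ⊗ g p.2 q.2.
  by rewrite liftC_eq //; apply/bilin_balanced/inner.
rewrite /map2C liftC_eq; first by apply: eq_bigr => p _; exact: E.
have [pl pr] := pureC_bilin V'' W''.
apply: bilin_balanced; split=> [w c x y|v c x y]; rewrite !(E (_, _)) /=
  scaler_sumr -big_split; apply: eq_bigr => q _ /=.
  by rewrite (fb.1 _) pl.
by rewrite (gb.1 _) pr.
Qed.

Lemma mulC_eq (A1 A2 : algType C) (s t : seq (A1 * A2)) :
  @Defs.mulC C A1 A2 (\sum_(p <- s) p.1 ⊗ p.2) (\sum_(q <- t) q.1 ⊗ q.2) =
  \sum_(p <- s) \sum_(q <- t) (p.1 * q.1) ⊗ (p.2 * q.2).
Proof.
apply: map2C_eq; split=> [w c x y|v c x y];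
 by rewrite ?mulrDl ?mulrDr -?scalerAl -?scalerAr.
Qed.

Lemma mul_bilin (A : algType C) : bilin (@GRing.mul A).
Proof. by split=> [w c x y|v c x y]; rewrite ?mulrDl ?mulrDr -?scalerAl -?scalerAr. Qed.

End TensorSums.

Arguments counit {C h}.
Arguments antipode {C h}.
Arguments haar {C c}.
Arguments inB {C X c}.
Arguments deg {C X c}.
Arguments d {C X c}.
Arguments coinv_val {C X} _.
Arguments star {C h} _.
Arguments Delta {C h} _.
Arguments bstar {C X} _.
Arguments ostar {C X c} _.
Arguments dL {C X c} _.

(** * Gram-Schmidt for positive forms *)

Section GramSchmidt.
Variables (C : numClosedFieldType) (V : lmodType C).

Record pos_form (f : V -> V -> C) : Prop := {
  pf_lin : forall z c x y, f (c *: x + y) z = c * f x z + f y z;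
  pf_conj : forall z c x y, f z (c *: x + y) = c^* * f z x + f z y;
  pf_gt0 : forall x, x != 0 -> 0 < f x x }.

Variable f : V -> V -> C.
Hypothesis fP : pos_form f.

Let flin z : linear (f^~ z : V -> C^o).
Proof. by move=> c x y; exact: pf_lin. Qed.

Let fD z x y : f z (x + y) = f z x + f z y.
Proof. by have := pf_conj fP z 1 x y; rewrite scale1r conjC1 mul1r. Qed.

Let f0 z : f z 0 = 0.
Proof. by apply: (addrI (f z 0)); rewrite -fD !addr0. Qed.

Let fZ z c x : f z (c *: x) = c^* * f z x.
Proof. by have := pf_conj fP z c x 0; rewrite !addr0 f0 addr0. Qed.

Let fZl z c x : f (c *: x) z = c * f x z.
Proof. exact: (linZ (flin z)). Qed.

Lemma pos_form_ge0 x : 0 <= f x x.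
Proof.
case: (eqVneq x 0) => [->|/(pf_gt0 fP)/ltW //]; by rewrite f0.
Qed.

(* Polarisation: f (x + y) (x + y) and f (x + iy) (x + iy) are real. *)
Lemma pos_form_sym x y : f y x = (f x y)^*.
Proof.
have re z : (f z z)^* = f z z by apply/conj_Creal/ger0_real/pos_form_ge0.
have := re (x + y); rewrite !fD !(linD (flin _)) !rmorphD /= !re => e1.
have := re (x + 'i *: y); rewrite !fD !(linD (flin _)) !fZ !fZl.
rewrite !rmorphD /= !rmorphM /= !re conjCK !conjCi => e2.
move: e1 e2; move: (f x y)^* (f y x)^* (f x x) (f y y) => a b p q e1 e2.
have {}e2 : 'i * (a - b - f y x + f x y) = 0.
  have -> : 'i * (a - b - f y x + f x y) =
    (p + - 'i * b + ('i * a + 'i * (- 'i * q))) -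
    (p + 'i * f y x + (- 'i * f x y + - 'i * ('i * q))) by ring.
  by rewrite e2 subrr.
have {}e2 : a - b - f y x + f x y = 0.
  by move/eqP: e2; rewrite mulf_eq0 (negPf (neq0Ci C)) => /eqP.
have : a *+ 2 = f y x *+ 2.
  apply/eqP; rewrite -subr_eq0.
  have -> : a *+ 2 - f y x *+ 2 = (a - b - f y x + f x y) +
    ((p + b + (a + q)) - (p + f y x + (f x y + q))) by ring.
  by rewrite e2 e1 subrr addr0.
by rewrite -mulr_natr -[RHS]mulr_natr => /(mulIf (negbT (pnatr_eq0 C 2))) ->.
Qed.

Lemma gram_schmidt (s : seq V) : exists m (u : 'I_m -> V),
  [/\ forall i j, f (u i) (u j) = (i == j)%:R,
      forall v, v \in s -> v = \sum_j f v (u j) *: u j &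
      forall S : set V, subspace S -> (forall v, v \in s -> S v) ->
        forall j, S (u j)].
Proof.
elim: s => [|v s [m [u [uo us uS]]]].
  by exists 0%N, (fun i => 0); split=> // [[]|? ? ? []].
pose v' := v - \sum_j f v (u j) *: u j.
have v'u j : f v' (u j) = 0.
  rewrite (linB (flin _)) (lin_sum (flin _)) (bigD1 j) //= fZl uo eqxx mulr1.
  by rewrite big1 ?addr0 ?subrr // => i ij; rewrite fZl uo (negPf ij) mulr0.
have [v0|v0] := eqVneq v' 0.
  exists m, u; split=> // [w|S S0 Sv j].
    by rewrite inE => /predU1P[->|/us //]; apply/eqP; rewrite -subr_eq0 -/v' v0.
  by apply: uS => // w ws; apply: Sv; rewrite inE ws orbT.
pose c := (sqrtC (f v' v'))^-1; pose u0 := c *: v'.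
have fv0 := pf_gt0 fP v0.
have cr : c^* = c by rewrite conj_Creal // realV ger0_real // sqrtC_ge0 ltW.
have cc : c * c * f v' v' = 1.
  by rewrite -expr2 exprVn sqrtCK mulVf // gt_eqF.
have c0 : c != 0 by rewrite invr_eq0 sqrtC_eq0 gt_eqF.
have uu0 j : f u0 (u j) = 0 by rewrite fZl v'u mulr0.
have u0u j : f (u j) u0 = 0 by rewrite pos_form_sym uu0 conjC0.
exists m.+1, (fun i => if unlift ord0 i is Some j then u j else u0); split.
- move=> i j; case: unliftP => [i'|] ->; case: unliftP => [j'|] -> //.
  by rewrite fZ cr fZl mulrA cc.
- move=> w; rewrite inE big_ord_recl unlift_none.
  under eq_bigr do rewrite liftK.
  case/predU1P => [->|ws].
    rewrite -[LHS](subrK (\sum_j f v (u j) *: u j)) -/v'; congr (_ + _).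
    rewrite -[v in f v _](subrK (\sum_j f v (u j) *: u j)) -/v'.
    rewrite (linD (flin _)) (lin_sum (flin _)) big1 ?addr0; last first.
      by move=> i _; rewrite fZl u0u mulr0.
    by rewrite /u0 fZ cr scalerA mulrAC cc scale1r.
  rewrite [in f w u0](us _ ws) (lin_sum (flin _)) big1 ?scale0r ?add0r; last first.
    by move=> i _; rewrite fZl u0u mulr0.
  exact: us.
- move=> S SS Sv j.
  have Su i : S (u i) by apply: uS => // w ws; apply: Sv; rewrite inE ws orbT.
  have [S0 SZ] := SS.
  case: unliftP => [i|] _ //; rewrite -[u0]addr0; apply: (SZ c) => //.
  have Ss : S (\sum_j f v (u j) *: u j).
    elim/big_ind: _ => // [x y Sx Sy|i' _]; last by rewrite -[_ *: _]addr0; apply: (SZ _).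
    by have := SZ 1 _ _ Sx Sy; rewrite scale1r.
  by have := SZ (-1) _ _ Ss (Sv _ (mem_head _ _)); rewrite scaleN1r addrC.
Qed.

End GramSchmidt.

(** * Coassociativity in Sweedler form *)

Section Hopf1.
Variable C : numClosedFieldType.

(** The trilinear map u induces a linear map on A ⊗ (A ⊗ M), which is applied to both sides of the
    coassociativity axiom. *)
Lemma coassoc (A : hopfStar C) (M : lmodType C) (delta : M -> tensC A M)
    (G : lmodType C) (u : A -> A -> M -> G) m :
  is_comodule (@Delta C A) counit delta -> trilin u ->
  \sum_(p <- repr (delta m)) \sum_(q <- repr (Delta p.1)) u q.1 q.2 p.2 =
  \sum_(p <- repr (delta m)) \sum_(q <- repr (delta p.2)) u p.1 q.1 q.2.
Proof.
case=> dl dA _ [u1 u2 u3].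
pose U : tensC A (tensC A M) -> G := liftC (fun a y => liftC (u a) y).
have ub a : bilin (u a) by split=> [?|?]; [exact: u2|exact: u3].
have Ub : bilin (fun a y => liftC (u a) y).
  split=> [y c a b|a]; last exact: liftC_linear.
  by rewrite /liftC/tlift/psum scaler_sumr -big_split; apply: eq_bigr => p _; exact: u1.
have Ul : linear U := liftC_linear Ub.
have := congr1 U (dA m).
rewrite {1 3}/liftC /tlift /psum !(lin_sum Ul) => E.
transitivity (\sum_(p <- repr (delta m))
   U (liftC (fun a1 a2 => a1 ⊗ (a2 ⊗ p.2)) (Delta p.1))).
  apply: eq_bigr => p _; rewrite /liftC /tlift /psum (lin_sum Ul).
  apply: eq_bigr => q _; rewrite /U liftC_pure; last exact: bilin_balanced.
  by rewrite liftC_pure //; exact: bilin_balanced.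
rewrite E; apply: eq_bigr => p _.
by rewrite /U liftC_pure //; exact: bilin_balanced.
Qed.

End Hopf1.

(** * Hopf star-algebras and the Haar form *)

Section HopfStar.
Variables (C : numClosedFieldType).

Section Antipode.
Variable A : hopfStar C.
Implicit Types a b : A.

Lemma counitE (a : A) : \sum_(p <- repr (Delta a)) (counit p.1 : C) *: p.2 = a.
Proof. by have [_ _] := Delta_comodule A; apply. Qed.

Lemma counitrE (a : A) : \sum_(p <- repr (Delta a)) (counit p.2 : C) *: p.1 = a.
Proof. exact: Delta_counitr. Qed.

Lemma mulS_bilin (M N : lmodType C) (f : M -> A) (g : N -> A) :
  linear f -> linear g -> bilin (fun x y => f x * g y).
Proof. by move=> fl gl; apply: (comp_bilin (@mul_bilin _ A)). Qed.

Lemma Delta_mul_sum a b (M : lmodType C) (f : A -> A -> M) : bilin f ->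
  liftC f (Delta (b * a)) =
  \sum_(p <- repr (Delta b)) \sum_(q <- repr (Delta a)) f (p.1 * q.1) (p.2 * q.2).
Proof.
move=> /bilin_balanced fb; rewrite DeltaM {1}[Delta b]tensCE {1}[Delta a]tensCE mulC_eq.
rewrite liftC_sum //; apply: eq_bigr => p _; rewrite liftC_sum //.
by apply: eq_bigr => q _; rewrite liftC_pure.
Qed.

(* Insert a_(2) S(a_(3)) after b_(2). *)
Lemma antipode_cancel a b :
  \sum_(p <- repr (Delta b)) antipode (p.1 * a) * p.2 = (counit b : C) *: antipode a.
Proof.
pose u a1 a2 a3 := \sum_(p <- repr (Delta b)) (antipode (p.1 * a1) * (p.2 * a2)) * antipode a3.
have ut : trilin u.
  split=> [a2 a3|a1 a3|a1 a2]; apply: sum_linear => p c x y /=.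
  - by rewrite mulrDr -scalerAr linearP !mulrDl -!scalerAl.
  - by rewrite mulrDr -scalerAr mulrDr mulrDl -!scalerAr -scalerAl.
  - by rewrite linearP mulrDr scalerAr.
(* Contracting the first two legs uses the antipode identity for b a_(1) and leaves eps(b) S(a);
   contracting the last two turns a_(2) S(a_(3)) into a counit. *)
have := coassoc a (Delta_comodule A) ut.
rewrite (eq_bigr (fun x => (counit (b * x.1) : C) *: antipode x.2)); last first.
  move=> x _; rewrite exchange_big /=; under eq_bigr do rewrite -mulr_suml.
  have E := @Delta_mul_sum x.1 b A (fun a1 a2 => antipode a1 * a2).
  rewrite -mulr_suml -E ?antipodel -?scalerAl ?mul1r //.
  by apply: (mulS_bilin (f := antipode) (g := idfun)) => //; exact: linear_fun.
rewrite (eq_bigr (fun x => (counit b : C) *: antipode ((counit x.1 : C) *: x.2))); last first.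
  by move=> x _; rewrite rmorphM /= [in RHS]linearZ scalerA.
rewrite -scaler_sumr -linear_sum /= counitE => ->; symmetry.
transitivity (\sum_(x <- repr (Delta a)) (\sum_(p <- repr (Delta b)) antipode (p.1 * x.1) * p.2) *
   (counit x.2 : C)%:A).
  apply: eq_bigr => x _; rewrite -antipoder /liftC /tlift /psum mulr_sumr.
  apply: eq_bigr => q _; rewrite mulr_suml; apply: eq_bigr => p _.
  by rewrite !mulrA.
rewrite (eq_bigr (fun x => \sum_(p <- repr (Delta b))
    (counit x.2 : C) *: (antipode (p.1 * x.1) * p.2))); last first.
  by move=> x _; rewrite mulr_algr scaler_sumr.
rewrite exchange_big; apply: eq_bigr => p _ /=.
rewrite (eq_bigr (fun x => antipode (p.1 * ((counit x.2 : C) *: x.1)) * p.2)).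
  by rewrite -mulr_suml -linear_sum -mulr_sumr counitrE.
by move=> x _; rewrite -[in RHS]scalerAr [in RHS]linearZ scalerAl.
Qed.

End Antipode.

Section HaarForm.
Variable A : cqga C.

Lemma star_lin (c : C) (x y : A) : star (c *: x + y) = c^* *: star x + star y.
Proof. by have [sl _ _] := star_star A; apply: sl. Qed.

Lemma starK : involutive (@star C A).
Proof. by have [] := star_star A. Qed.

Lemma starM (x y : A) : star (x * y) = star y * star x.
Proof. by have [] := star_star A. Qed.

Lemma star0 : star (0 : A) = 0.
Proof.
by apply: (addrI (star 0)); have := star_lin 1 0 0; rewrite conjC1 !scale1r !addr0.
Qed.

Lemma starD (x y : A) : star (x + y) = star x + star y.
Proof. by have := star_lin 1 x y; rewrite !scale1r conjC1 scale1r. Qed.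

Lemma starZ (c : C) (x : A) : star (c *: x) = c^* *: star x.
Proof. by have := star_lin c x 0; rewrite !addr0 star0 addr0. Qed.

Definition haar_form (a b : A) : C := haar (a * star b).

Lemma haar_pos : pos_form haar_form.
Proof.
split=> [z c x y|z c x y|x x0]; rewrite /haar_form.
- by rewrite mulrDl -scalerAl linearP.
- by rewrite star_lin mulrDr -scalerAr linearP.
- rewrite -{1}(starK x) haar_gt0 //; apply: contra_neq x0 => x0.
  by rewrite -(starK x) x0 star0.
Qed.

End HaarForm.
End HopfStar.

(** * The conditional expectation onto B and the faithfulness of Takeuchi's functor *)

Section Expectation.
Variables (C : numClosedFieldType) (X : homSpace C).
Local Notation A := (hsA X).
Local Notation B := (coinv X).
Local Notation pi := (hs_proj X).

Lemma val_lin : linear (@coinv_val C X).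
Proof. exact: (linear_fun (val : {linear B -> A})). Qed.

Lemma idfun_lin (V : lmodType C) : linear (@idfun V).
Proof. by []. Qed.

Lemma pi_lin : linear pi. Proof. exact: linear_fun. Qed.

Lemma Delta_lin (H : hopfStar C) : linear (@Delta C H).
Proof. by have [] := Delta_comodule H. Qed.

(** Averaging over the quantum subgroup, (id ⊗ haar) applied to the right H-coaction. It gives the
    retraction of A onto B through which identities in A descend to B. *)
Definition expect0 (a : A) : A := liftC (fun x y => (haar y : C) *: x) (rcoact a).

Lemma haar_bilin (H : cqga C) (M : lmodType C) :
  bilin (fun (x : M) (y : H) => (haar y : C) *: x).
Proof.
split=> [w c x y|v c x y]; first by rewrite scalerDr !scalerA [c * _]GRing.mulrC.
by rewrite linearP /= scalerDl scalerA.
Qed.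

Lemma expect0E a : expect0 a = \sum_(p <- repr (Delta a)) (haar (pi p.2) : C) *: p.1.
Proof.
rewrite /expect0 /rcoact liftC_mapC //; first exact: pi_lin.
exact: haar_bilin.
Qed.

Lemma rcoact_lin : linear (@rcoact C X).
Proof.
move=> c x y; rewrite /rcoact Delta_lin; apply: mapC_linear => //; exact: pi_lin.
Qed.

Lemma expect0_lin : linear expect0.
Proof. by move=> c x y; rewrite /expect0 rcoact_lin (liftC_linear (haar_bilin _ _)). Qed.

(** By coassociativity the coaction of the average is a_(1) ⊗ pi(a_(2)) haar(pi(a_(3))), and
    invariance of the Haar functional of H collapses the last two legs to the unit. *)
Lemma expect_subproof a : expect0 a \in @coinvariant C X.
Proof.
rewrite unfold_in; apply/eqP.
pose u (a1 a2 a3 : A) : tensC A (hsH X) := (haar (pi a3) : C) *: (a1 ⊗ pi a2).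
have [pl pr] := pureC_bilin A (hsH X).
have ut : trilin u.
  rewrite /u; split=> [a2 a3|a1 a3|a1 a2] c x y /=.
  - by rewrite pl scalerDr !scalerA [c * _]GRing.mulrC.
  - by rewrite linearP pr scalerDr !scalerA [c * _]GRing.mulrC.
  - by rewrite 2!linearP /= scalerDl scalerA.
have := coassoc a (Delta_comodule A) ut.
have -> : rcoact (expect0 a) = \sum_(p <- repr (Delta a)) \sum_(q <- repr (Delta p.1)) u q.1 q.2 p.2.
  rewrite expect0E (lin_sum rcoact_lin); apply: eq_bigr => p _.
  by rewrite (linZ rcoact_lin) /rcoact {1}/mapC /liftC /tlift /psum scaler_sumr.
move=> ->; rewrite expect0E (lin_sum (pl _)); apply: eq_bigr => p _.
have [piD _ _ _] := hs_hopf X.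
have := haar_left (pi p.2).
rewrite piD liftC_mapC; [|exact: pi_lin|exact: pi_lin|exact: haar_bilin].
move=> E; rewrite (linZ (pl _)) -(linZ (pr _)) -E.
rewrite /liftC /tlift /psum (lin_sum (pr _)); apply: eq_bigr => q _.
by rewrite /u (linZ (pr _)).
Qed.

Definition expect (a : A) : B := Coinv (expect_subproof a).

Lemma expect_lin : linear expect.
Proof. by move=> c x y; apply: val_inj; rewrite linearP /= expect0_lin. Qed.

Lemma expectK : cancel coinv_val expect.
Proof.
move=> b; apply: val_inj => /=; rewrite /expect0.
have /eqP -> : rcoact (coinv_val b) == coinv_val b ⊗ 1 := valP b.
by rewrite liftC_pure ?haar1 ?scale1r //; exact/bilin_balanced/haar_bilin.
Qed.

Lemma expectM a b : expect (a * coinv_val b) = expect a * b.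
Proof.
apply: val_inj; rewrite rmorphM /= /expect0 /rcoact DeltaM.
rewrite (mapC_mul idfun) -!/(rcoact _).
have /eqP -> : rcoact (coinv_val b) == coinv_val b ⊗ 1 := valP b.
have hb := bilin_balanced (haar_bilin (hsH X) A).
rewrite [rcoact a]tensCE; have := mulC_eq (repr (rcoact a)) [:: (coinv_val b, 1)].
rewrite big_seq1 /= => ->; under eq_bigr do rewrite big_seq1.
rewrite !liftC_sum // mulr_suml; apply: eq_bigr => p _.
by rewrite !liftC_pure //= mulr1 scalerAl.
Qed.

(** [coB] is a choice, so a witness is required: (id ⊗ [expect]) Delta(b). By coassociativity its
    image in A ⊗ A is Delta([expect0] b), and averaging fixes b. *)
Lemma coBP (b : B) : mapC idfun coinv_val (coB b) = Delta (val b).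
Proof.
rewrite /coB; set Q := [set y | _]; suff : Q (mapC idfun expect (Delta (val b))).
  by move=> Qy; apply: (xgetPex 0 (P := Q)); exists (mapC idfun expect (Delta (val b))).
rewrite /Q /= {2}/mapC /liftC /tlift /psum (lin_sum (mapC_linear (@idfun_lin _) val_lin)).
transitivity (Delta (expect0 (val b))); last by congr Delta; exact: (congr1 val (expectK b)).
have [pl pr] := pureC_bilin A A.
pose u (a1 a2 a3 : A) := (haar (pi a3) : C) *: (a1 ⊗ a2).
have ut : trilin u.
  rewrite /u; split=> [a2 a3|a1 a3|a1 a2] c x y /=.
  - by rewrite pl scalerDr !scalerA [c * _]GRing.mulrC.
  - by rewrite pr scalerDr !scalerA [c * _]GRing.mulrC.
  - by rewrite 2!linearP /= scalerDl scalerA.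
have := coassoc (val b) (Delta_comodule A) ut.
rewrite expect0E (lin_sum (@Delta_lin _)) => E.
rewrite [RHS](eq_bigr (fun p => \sum_(q <- repr (Delta p.1)) u q.1 q.2 p.2)); last first.
  by move=> p _; rewrite (linZ (@Delta_lin _)) {1}[Delta p.1]tensCE scaler_sumr.
rewrite E; apply: eq_bigr => p _.
rewrite mapC_pure //=.
rewrite expect0E (lin_sum (pr _)); apply: eq_bigr => q _.
by rewrite (linZ (pr _)).
Qed.

Lemma coB_sum (M : lmodType C) (u : A -> A -> M) (b : B) : bilin u ->
  \sum_(p <- repr (coB b)) u p.1 (coinv_val p.2) =
  \sum_(p <- repr (Delta (coinv_val b))) u p.1 p.2.
Proof.
move=> ub; have := liftC_mapC (coB b) (@idfun_lin A) val_lin ub.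
by rewrite coBP => E; symmetry; exact: E.
Qed.

(** The retraction [expect] makes A ⊗ B -> A ⊗ A injective. *)
Lemma coB_uniq (b : B) y : mapC idfun coinv_val y = Delta (coinv_val b) -> coB b = y.
Proof.
have K (z : tensC A B) : mapC idfun expect (mapC idfun coinv_val z) = z.
  rewrite {1}/mapC liftC_mapC //; first last.
    by apply: (comp_bilin (@pureC_bilin _ _ _)) => //; exact: expect_lin.
  by rewrite /liftC /tlift /psum [RHS]tensCE; apply: eq_bigr => p _; rewrite expectK.
by move=> E; rewrite -[y]K -[LHS]K E coBP.
Qed.

Lemma coB1 : coB 1 = 1 ⊗ 1 :> tensC A B.
Proof. by apply: coB_uniq; rewrite mapC_pure ?Delta1 //; exact: val_lin. Qed.

End Expectation.

(** * Relative Hopf modules and their fibres *)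

Section Takeuchi.
Variables (C : numClosedFieldType) (X : homSpace C).
Local Notation A := (hsA X).
Local Notation B := (coinv X).
Variables (F : lmodType C) (l : B -> F -> F) (r : F -> B -> F)
  (delta : F -> tensC A F).
Hypothesis Frel : is_relmod l r delta.

Lemma relmod_lmod : is_lmodule l. Proof. by case: Frel => -[]. Qed.

Lemma lmod_lin b : linear (l b).
Proof.
have [lD _ lZ l1 lM] := relmod_lmod.
have E c f : c *: f = l c%:A f by rewrite lZ l1.
move=> c x y; rewrite lD !E; congr (_ + _).
by rewrite -!lM -scalerAr -scalerAl mul1r mulr1.
Qed.

Lemma lmod_bilin : bilin l.
Proof.
have [lD lD' lZ l1 lM] := relmod_lmod.
split=> [f c a b|]; last exact: lmod_lin.
by rewrite lD' lZ.
Qed.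

Lemma rmod_bilin : bilin r.
Proof.
have [[_ [rD rD' rZ r1 rM] _] _ _ _ _] := Frel.
have E c f : c *: f = r f c%:A by rewrite rZ r1.
split=> [b c f g|f c a b]; last by rewrite rD' rZ.
rewrite rD !E; congr (_ + _).
by rewrite -!rM -scalerAr -scalerAl mul1r mulr1.
Qed.

Lemma coact_lin : linear delta.
Proof. by case: Frel => _ _ []. Qed.

Lemma counit_coact f : \sum_(p <- repr (delta f)) (counit p.1 : C) *: p.2 = f.
Proof. by case: Frel => _ _ [_ _ E] _ _; apply: E. Qed.

(** The compatibility axiom treats both actions at once; acting by 1 on the right isolates the left
    action. *)
Lemma coact_l b f s t :
    coB b = \sum_(p <- s) p.1 ⊗ p.2 -> delta f = \sum_(q <- t) q.1 ⊗ q.2 ->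
  delta (l b f) = \sum_(p <- s) \sum_(q <- t) (p.1 * q.1) ⊗ l p.2 q.2.
Proof.
have [[_ [_ _ _ r1 _] _] _ _ dM _] := Frel => Es Et.
have mb := @mul_bilin C A.
have := dM b f 1; rewrite r1 => ->; rewrite coB1 Es Et map2C_eq //; last exact: lmod_bilin.
set S := \sum_(p <- s) _.
have <- : \sum_(z <- [seq (p.1 * q.1, l p.2 q.2) | p <- s, q <- t]) z.1 ⊗ z.2 = S.
  by rewrite big_allpairs_dep.
have := map2C_eq [seq (p.1 * q.1, l p.2 q.2) | p <- s, q <- t] [:: (1, 1)] mb rmod_bilin.
rewrite big_seq1 /= => ->; apply: eq_bigr => p _.
by rewrite big_seq1 /= mulr1 r1.
Qed.

(** Vanishing in F / B^+ F, tested by linear maps in the same way as [quotm] identifies vectors, so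
    that no quotient has to be handled. *)
Definition fibre_null (x : F) : Prop := forall (U : lmodType C) (f : F -> U),
  linear f -> (forall y, BplusL l setT y -> f y = 0) -> f x = 0.

(* The identity f = P (f_(-2) S(f_(-1))) f_(0), whose right-hand side depends
   only on the class of the last leg modulo B^+ F. *)
Lemma takeuchi_faithful f s :
  delta f = \sum_(p <- s) p.1 ⊗ p.2 ->
  (forall p, p \in s -> fibre_null p.2) -> f = 0.
Proof.
move=> Es sB; have [lb1 lb2] := lmod_bilin.
have [_ _ _ l1 lM] := relmod_lmod.
pose u a a' x := l (expect (a * antipode a')) x.
have ut : trilin u.
  rewrite /u; split=> [a' x|a x|a a'] c y z /=.
  - by rewrite mulrDl -scalerAl expect_lin lb1.
  - by rewrite linearP mulrDr -scalerAr expect_lin lb1.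
  - by rewrite lb2.
pose Psi a x := \sum_(q <- repr (delta x)) u a q.1 q.2.
have [u1 u2 u3] := ut.
have ub a : bilin (u a) by split.
have Psib : bilin Psi.
  split=> [x|a]; first by apply: sum_linear => q c a a'; rewrite u1.
  by move=> c x y; rewrite /Psi coact_lin; exact: (liftC_linear (ub a)).
have E1 := coassoc f (let: And5 _ _ h _ _ := Frel in h) ut.
have {}E1 : f = liftC Psi (delta f).
  rewrite -[LHS]counit_coact [RHS]/liftC /tlift /psum -E1; apply: eq_bigr => p _.
  rewrite /u -[LHS]l1 (linZ (lb2 _)) -(linZ (lb1 _)).
  transitivity (l (expect (\sum_(q <- repr (Delta p.1)) q.1 * antipode q.2)) p.2).
    have := antipoder p.1; rewrite /liftC /tlift /psum => ->.
    rewrite (linZ (@expect_lin _ _)); congr (l (_ *: _) _).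
    by rewrite -(expectK 1); congr expect; rewrite rmorph1.
  rewrite (lin_sum (@expect_lin _ _)) (lin_sum (lb1 _)) //.
(* Moving b_(2) inside the expectation produces S(b_(1) x_(-1)) b_(2), which [antipode_cancel] turns
   into a multiple of eps(b) = 0. *)
have Psi0 a b x : Bplus b -> Psi a (l b x) = 0.
  move=> b0; rewrite /Psi.
  have := coact_l (tensCE (coB b)) (tensCE (delta x)).
  have /bilin_balanced ubb := ub a.
  rewrite -/(psum (u a) (repr _)) -/(tlift (u a) _) -/(liftC (u a) _) => ->.
  rewrite liftC_sum //; under eq_bigr do rewrite liftC_sum //.
  rewrite exchange_big big1 // => q _ /=.
  under eq_bigr => p _.
    rewrite liftC_pure // /u -lM -expectM -mulrA.
    over.
  rewrite -(lin_sum (lb1 _)) -(lin_sum (@expect_lin _ _)) -mulr_sumr.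
  have := @coB_sum _ _ A (fun a1 a2 => antipode (a1 * q.1) * a2) b.
  rewrite antipode_cancel b0 => ->.
    by rewrite scale0r mulr0 (lin0 (@expect_lin _ _)) (lin0 (lb1 _)).
  apply: (mulS_bilin (f := fun a1 => antipode (a1 * q.1)) (g := idfun)) => //.
  by move=> c y z; rewrite mulrDl -scalerAl linearP.
rewrite E1 Es liftC_eq; last exact: bilin_balanced.
rewrite big_seq big1 // => p /sB /(_ _ _ (Psib.2 p.1)); apply => y [t [tB ->]].
rewrite (lin_sum (Psib.2 _)) big_seq big1 // => z zt.
by apply: Psi0; case: (tB z zt).
Qed.

End Takeuchi.

(** * Hermitian relative line modules *)

Section LineFibre.
Variables (C : numClosedFieldType) (V : lmodType C) (N : set V).

Let pi (v : V) : quotm N := \pi_(quotm N)%qT v.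

Lemma quotm_pi_lin : linear pi.
Proof.
move=> c x y; apply/quot_eqP => U f fN; symmetry.
by rewrite linearD (quot_repr _ fN) /= (quot_repr _ fN) linearZ /= (quot_repr _ fN) -linearP.
Qed.

(** phi is the coordinate of a class with respect to a generator, and e0 represents that generator.
    The last clause is the form in which one-dimensionality is used: a linear map that kills N is
    determined by its value at e0. *)
Lemma quotm_dim1 : dim1 (quotm N) -> exists (phi : V -> C) e0,
  [/\ linear (phi : V -> C^o), phi e0 = 1, forall x, N x -> phi x = 0 &
      forall (U : lmodType C) (f : V -> U), linear f ->
        (forall x, N x -> f x = 0) -> forall x, f x = phi x *: f e0].
Proof.
case=> e e_n0 eG.
have [phi phiP] := choice (fun x => eG (pi x)).
have inj : injective (fun c : C => c *: e).
  move=> c c' /eqP; rewrite -subr_eq0 -scalerBl scaler_eq0 (negPf e_n0) orbF subr_eq0.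
  by move/eqP.
have pir : pi (repr e) = e by rewrite /pi reprK.
exists phi, (repr e); split.
- move=> c x y; apply: inj; rewrite /= scalerDl -scalerA -!phiP.
  exact: quotm_pi_lin.
- by apply: inj; rewrite /= -phiP pir scale1r.
- move=> x Nx; apply: inj; rewrite /= -phiP scale0r -(lin0 quotm_pi_lin).
  by apply/quot_eqP => U f fN; rewrite fN ?linear0.
- move=> U f fl fN x.
  pose fL : {linear V -> U} := HB.pack f (GRing.isLinear.Build _ _ _ _ f fl).
  have : pi x = pi (phi x *: repr e) by rewrite (linZ quotm_pi_lin) pir -phiP.
  by move/quot_eqP => /(_ U fL fN) /= ->; rewrite (linZ fl).
Qed.

End LineFibre.

(** * Invariant inner products and unitary matrix coefficients *)

Section HermitianLine.
Variables (C : numClosedFieldType) (X : homSpace C).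
Local Notation A := (hsA X).
Local Notation B := (coinv X).
Variables (F : lmodType C) (l : B -> F -> F) (r : F -> B -> F)
  (delta : F -> tensC A F) (h : F -> F -> B).
Hypothesis Fh : hermitian_relmod l r delta h.

Let Frel : is_relmod l r delta. Proof. by case: Fh. Qed.
Let Fhm : hermitian_module l h. Proof. by case: Fh. Qed.

Lemma counit_bstar (b : B) : (counit (coinv_val (bstar b)) : C) = (counit (coinv_val b))^*.
Proof. exact: counit_star. Qed.

Lemma bstarK : involutive (@bstar C X).
Proof. by move=> b; apply: val_inj; rewrite /= starK. Qed.

Lemma bstarM (a b : B) : bstar (a * b) = bstar b * bstar a.
Proof. by apply: val_inj; rewrite /= starM. Qed.

Lemma bstar_lin (c : C) (a b : B) : bstar (c *: a + b) = c^* *: bstar a + bstar b.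
Proof. by apply: val_inj; rewrite /= star_lin. Qed.

(** A non-zero sum of terms x^* x has a non-zero x, and the Haar functional is faithful on that term
    and non-negative on the others. *)
Lemma Bgt0_haar (b : B) : Bgt0 b -> (0 : C) < haar (coinv_val b).
Proof.
case=> [[s ->] /eqP nz].
have lv := @val_lin C X.
rewrite (lin_sum lv) linear_sum /=.
have pos (x : B) : (0 : C) <= haar (coinv_val (bstar x * x)).
  have [->|x0] := eqVneq x 0; first by rewrite mulr0 (lin0 lv) linear0.
  by apply/ltW/(@haar_gt0 _ A); apply: contra_neq x0 => x0; apply: val_inj.
rewrite lt_def sumr_ge0 ?andbT; last by move=> y _; exact: pos.
apply: contraNneq (nz) => s0; rewrite big_seq big1 // => x xs.
move/eqP: s0; rewrite psumr_eq0; first move=> /allP/(_ x xs) /= /eqP x0.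
have [->|] := eqVneq x 0; first by rewrite mulr0.
move=> xn0; have : (0 : C) < haar (star (coinv_val x) * coinv_val x).
  by apply: (@haar_gt0 _ A); apply: contra_neq xn0 => e; apply: val_inj.
by rewrite x0 ltxx.
by move=> y _; exact: pos.
Qed.

Lemma form_linl k : linear (h^~ k).
Proof.
have /asboolP[hD hl] := hm_dual Fhm k; have [lb1 lb2] := lmod_bilin Frel.
move=> c x y; rewrite hD; congr (_ + _).
have [_ _ lZ l1 _] := relmod_lmod Frel.
by rewrite -[in LHS](l1 x) -lZ hl -scalerAl mul1r.
Qed.

Lemma form_l b x y : h (l b x) y = b * h x y.
Proof. by have /asboolP[_ ->] := hm_dual Fhm y. Qed.

Lemma form_sym x y : h x y = bstar (h y x). Proof. exact: (hm_sym Fhm). Qed.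

Lemma form_conj z c x y : h z (c *: x + y) = c^* *: h z x + h z y.
Proof. by rewrite form_sym form_linl bstar_lin -!form_sym. Qed.

Lemma form_r b x y : h x (l b y) = h x y * bstar b.
Proof. by rewrite form_sym form_l bstarM -form_sym. Qed.

(** Two facts combine: evaluation against the right dual is a comodule map, and so is the map from
    the conjugate module defined by h. The star on the second coefficient is the coaction of the
    conjugate module. *)
Lemma form_coact x y s t :
    delta x = \sum_(p <- s) p.1 ⊗ p.2 -> delta y = \sum_(q <- t) q.1 ⊗ q.2 ->
  coB (h x y) = \sum_(p <- s) \sum_(q <- t) (p.1 * star q.1) ⊗ h p.2 q.2.
Proof.
move=> Es Et; have [_ _ [delta' [_ ev] [hl _ _ hd]]] := Fh.
have hE k f : form_map l h k f = h f k.
  by rewrite /form_map /as_dual insubdK //; exact: (hm_dual Fhm).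
have cb : balancedC (fun a g => star a ⊗ bar g : tensC A (conjmod F)).
  have [pD pD' pZ] := pureC_balanced A (conjmod F).
  split=> [v v' w|v w w'|c v w]; first by rewrite starD pD.
    exact: pD'.
  rewrite starZ pZ; congr (_ ⊗ _); rewrite /bar.
  by rewrite {1}/GRing.scale /= /conj_scale conjCK.
rewrite -hE ev hd /conj_coact Et (liftC_eq _ cb).
have := mapC_eq [seq (star q.1, bar q.2) | q <- t] (@idfun_lin _ A) hl.
rewrite !big_map /= => ->.
have eb : bilin (fun g (psi : ldual l) => psi g).
  split=> [psi c x' y'|g c psi psi' //].
  case: psi => psi /= /[dup] /asboolP[pD pl] _; rewrite pD; congr (_ + _).
  have [_ _ lZ l1 _] := relmod_lmod Frel.
  by rewrite -[in LHS](l1 x') -lZ pl -scalerAl mul1r.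
have := map2C_eq s [seq (star q.1, form_map l h (bar q.2)) | q <- t] (@mul_bilin C A) eb.
rewrite big_map /= Es => ->; apply: eq_bigr => p _; rewrite big_map.
by apply: eq_bigr => q _ /=; rewrite hE.
Qed.

Definition line_inner x y : C := haar (coinv_val (h x y)).

Lemma line_inner_pos : pos_form line_inner.
Proof.
split=> [z c x y|z c x y|x x0]; rewrite /line_inner.
- by rewrite form_linl val_lin linearP.
- by rewrite form_conj val_lin linearP.
- exact/Bgt0_haar/(hm_pos Fhm).
Qed.

Lemma form_eq0 x : (forall y, h x y = 0) -> x = 0.
Proof.
move=> x0; apply: contrapT => /eqP /(hm_pos Fhm); rewrite x0.
by case=> _; apply.
Qed.

Lemma coassoc_rep (G : lmodType C) (u : A -> A -> F -> G) x s :
    trilin u -> delta x = \sum_(p <- s) p.1 ⊗ p.2 ->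
  \sum_(p <- repr (delta x)) \sum_(q <- repr (Delta p.1)) u q.1 q.2 p.2 =
  \sum_(p <- s) liftC (u p.1) (delta p.2).
Proof.
move=> ut Es; rewrite coassoc //; last by case: Frel.
have [u1 u2 u3] := ut.
have ub a : bilin (u a) by split.
have Gb : bilin (fun a y => liftC (u a) (delta y)).
  split=> [y|a]; first by apply: sum_linear => q c a a'; rewrite u1.
  by move=> c y z; rewrite (coact_lin Frel) (liftC_linear (ub a)).
have := liftC_eq s (bilin_balanced Gb).
by rewrite -Es => <-.
Qed.

Lemma bilin_scale (M N : lmodType C) (f : M -> C) (g : N -> A) :
  linear (f : M -> C^o) -> linear g -> bilin (fun (a : N) (x : M) => f x *: g a).
Proof.
move=> fl gl; split=> [x c a b|a c x y].
  by rewrite gl scalerDr !scalerA [c * _]GRing.mulrC.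
by rewrite fl scalerDl scalerA.
Qed.

Lemma coB_counit (b : B) (s : seq (A * B)) : coB b = \sum_(p <- s) p.1 ⊗ p.2 ->
  coinv_val b = \sum_(p <- s) (counit (coinv_val p.2) : C) *: p.1.
Proof.
move=> Es.
have cl : linear (fun x : B => counit (coinv_val x) : C^o).
  by move=> c x y; rewrite val_lin linearP.
have cl' : linear (fun x : A => counit x : C^o) by move=> c x y; rewrite linearP.
have := liftC_eq s (bilin_balanced (bilin_scale cl (@idfun_lin _ A))).
rewrite -Es => <-; rewrite -[LHS]counitrE.
by have := coB_sum b (bilin_scale cl' (@idfun_lin _ A)) => <-.
Qed.

(** Together with [form_coact] this is the A-invariance of [line_inner], from which the unitarity of
    matrix coefficients is obtained. *)
Lemma coB_haar (b : B) (s : seq (A * B)) : coB b = \sum_(p <- s) p.1 ⊗ p.2 ->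
  (haar (coinv_val b) : C) *: 1 = \sum_(p <- s) (haar (coinv_val p.2) : C) *: p.1.
Proof.
move=> Es.
have cl : linear (fun x : B => haar (coinv_val x) : C^o).
  by move=> c x y; rewrite val_lin linearP.
have cl' : linear (fun x : A => haar x : C^o) by move=> c x y; rewrite linearP.
have := liftC_eq s (bilin_balanced (bilin_scale cl (@idfun_lin _ A))).
rewrite -Es => <-; rewrite -haar_left.
by have E := coB_sum b (bilin_scale cl' (@idfun_lin _ A)); symmetry; exact: E.
Qed.

(** Unitarizability of the finite-dimensional subcomodule generated by x0. Invariance of the inner
    product yields only t t^* = 1, and over a noncommutative A the other order is not automatic. The
    antipode supplies S(t) t = 1; a left and a right inverse coincide, so t^* = S(t) and t^* t =
    1. *)
Lemma unitary_span (x0 : F) : exists N (u : 'I_N -> F) (t : 'I_N -> 'I_N -> A)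
    (c : 'I_N -> C),
  [/\ x0 = \sum_i c i *: u i, forall i, delta (u i) = \sum_k t i k ⊗ u k &
      forall k m, \sum_i star (t i k) * t i m = (k == m)%:R].
Proof.
have [pl pr] := pureC_bilin A F.
have dl := coact_lin Frel.
have [m [al [alo als _]]] := gram_schmidt (haar_pos A) [seq p.1 | p <- repr (delta x0)].
pose ip := @haar_form C A.
have ipl z : linear (ip^~ z : A -> C^o) by move=> c x y; exact: (pf_lin (haar_pos A)).
(* The first legs are expanded in elements orthonormal for the Haar form, so that w_j is a
   coefficient functional applied to the coaction of x0. Coassociativity then shows that the w_j
   span a subcomodule. *)
pose w j := \sum_(p <- repr (delta x0)) ip p.1 (al j) *: p.2.
have alE p : p \in repr (delta x0) -> p.1 = \sum_j ip p.1 (al j) *: al j.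
  by move=> px; apply: als; apply: map_f.
have rew (M : lmodType C) (f : A -> F -> M) : bilin f ->
    \sum_(p <- repr (delta x0)) f p.1 p.2 = \sum_j f (al j) (w j).
  case=> fl fr; rewrite /w; under [RHS]eq_bigr do rewrite (lin_sum (fr _)).
  rewrite exchange_big /= big_seq [RHS]big_seq; apply: eq_bigr => p px.
  rewrite [in LHS](alE p px) (lin_sum (fl _)); apply: eq_bigr => j _.
  by rewrite (linZ (fl _)) (linZ (fr _)).
pose tau i a := \sum_(q <- repr (Delta a)) ip q.1 (al i) *: q.2.
have taul i : linear (tau i).
  have lb : bilin (fun (x : A) (y : A) => ip x (al i) *: y).
    split=> [y c x x'|x c y y']; first by rewrite ipl scalerDl scalerA.
    by rewrite scalerDr !scalerA [c * _]GRing.mulrC.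
  by move=> c x y; rewrite /tau Delta_lin; exact: (liftC_linear lb).
have dw i : delta (w i) = \sum_j tau i (al j) ⊗ w j.
  pose u a a' x : tensC A F := ip a (al i) *: (a' ⊗ x).
  have ut : trilin u.
    split=> [a' x|a x|a a'] c y z; rewrite /u ?ipl ?pl ?pr ?scalerDl ?scalerA //.
      by rewrite scalerDr !scalerA [c * _]GRing.mulrC.
    by rewrite scalerDr !scalerA [c * _]GRing.mulrC.
  have := coassoc_rep ut (tensCE (delta x0)).
  have -> : \sum_(p <- repr (delta x0)) liftC (u p.1) (delta p.2) = delta (w i).
    rewrite (lin_sum dl); apply: eq_bigr => p _; rewrite (linZ dl).
    by rewrite [delta p.2 in RHS]tensCE scaler_sumr.
  move=> <-; rewrite -(rew _ (fun a x => tau i a ⊗ x)); last first.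
    by apply: (comp_bilin (@pureC_bilin _ _ _)).
  apply: eq_bigr => p _; rewrite (lin_sum (pl _)); apply: eq_bigr => q _.
  by rewrite /u (linZ (pl _)).
have Fpos := line_inner_pos; have [N [u [uo us uS]]] := gram_schmidt Fpos (codom w).
have fl z : linear (line_inner^~ z : F -> C^o) by move=> c x y; exact: (pf_lin Fpos).
pose S x := exists y : 'I_N -> A, delta x = \sum_k y k ⊗ u k.
have wE i : w i = \sum_k line_inner (w i) (u k) *: u k by apply/us/codom_f.
have SS : subspace (S : set F).
  split; first by exists (fun=> 0); rewrite (lin0 dl) big1 // => k _; rewrite (lin0 (pl _)).
  move=> c x y [sx Ex] [sy Ey]; exists (fun k => c *: sx k + sy k).
  rewrite dl Ex Ey scaler_sumr -big_split; apply: eq_bigr => k _ /=.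
  by rewrite pl.
have /choice[t tE] : forall i, S (u i).
  apply: uS => // _ /codomP[i ->]; exists (fun k => \sum_j line_inner (w j) (u k) *: tau i (al j)).
  rewrite dw; under [RHS]eq_bigr do rewrite (lin_sum (pl _)).
  rewrite exchange_big; apply: eq_bigr => j _ /=.
  rewrite [in LHS](wE j) (lin_sum (pr _)); apply: eq_bigr => k _.
  by rewrite (linZ (pr _)) (linZ (pl _)).
have rep i : delta (u i) = \sum_(p <- [seq (t i k, u k) | k <- index_enum 'I_N]) p.1 ⊗ p.2.
  by rewrite big_map.
have tt i j : \sum_k t i k * star (t j k) = (i == j)%:R.
  have := form_coact (rep i) (rep j); rewrite -big_allpairs_dep => E.
  have := coB_haar (b := h (u i) (u j)) (s := [seq (p.1 * star q.1, h p.2 q.2) |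
    p <- [seq (t i k, u k) | k <- index_enum 'I_N],
    q <- [seq (t j k, u k) | k <- index_enum 'I_N]]).
  rewrite E !big_allpairs_dep => /(_ erefl); rewrite big_map.
  have := uo i j; rewrite /line_inner => ->; rewrite scaler_nat => ->.
  apply: eq_bigr => k _; rewrite big_map (bigD1 k) //= big1 ?addr0 => [|k' k'k].
    by have := uo k k; rewrite /line_inner eqxx => ->; rewrite scale1r.
  by have := uo k k'; rewrite /line_inner eq_sym (negPf k'k) => ->; rewrite scale0r.
have St i m' : \sum_k antipode (t i k) * t k m' = (i == m')%:R.
  pose v a a' x : A := line_inner x (u m') *: (antipode a * a').
  have vt : trilin v.
    rewrite /v; split=> [a' x|a x|a a'] c y z /=.
    - by rewrite linearP mulrDl -scalerAl scalerDr !scalerA [c * _]GRing.mulrC.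
    - by rewrite mulrDr -scalerAr scalerDr !scalerA [c * _]GRing.mulrC.
    - by rewrite fl scalerDl scalerA.
  have := coassoc_rep vt (rep i); rewrite big_map /=.
  have -> : \sum_k liftC (v (t i k)) (delta (u k)) = \sum_k antipode (t i k) * t k m'.
    apply: eq_bigr => k _; have [v1 v2 v3] := vt.
    have vb : bilin (v (t i k)) by split.
    rewrite tE liftC_sum; last exact: bilin_balanced.
    rewrite (bigD1 m') //= liftC_pure; last exact: bilin_balanced.
    rewrite big1 ?addr0 => [|j jm]; first by rewrite /v uo eqxx scale1r.
    by rewrite liftC_pure; [rewrite /v uo (negPf jm) scale0r|exact: bilin_balanced].
  move=> <-; rewrite -[RHS]scaler_nat -uo -[u i in RHS](counit_coact Frel).
  rewrite (lin_sum (fl _)) scaler_suml; apply: eq_bigr => p _.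
  rewrite (linZ (fl _)) -scaler_sumr.
  have := antipodel p.1; rewrite /liftC /tlift /psum => ->.
  by rewrite scalerA GRing.mulrC.
have Sstar k j : star (t j k) = antipode (t k j).
  transitivity (\sum_m' (\sum_i antipode (t k i) * t i m') * star (t j m')).
    rewrite (bigD1 k) //= St eqxx mul1r big1 ?addr0 // => m' m'k.
    by rewrite St eq_sym (negPf m'k) mul0r.
  under eq_bigr do rewrite mulr_suml; rewrite exchange_big /=.
  rewrite (bigD1 j) //= [X in _ + X]big1 ?addr0 => [|i ij].
    under eq_bigr do rewrite -mulrA.
    by rewrite -mulr_sumr tt eqxx mulr1.
  under eq_bigr do rewrite -mulrA.
  by rewrite -mulr_sumr tt (negPf ij) mulr0.
exists N, u, t, (fun k => \sum_j (counit (al j) : C) * line_inner (w j) (u k)); split=> //.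
- have cl : linear (fun x : A => counit x : C^o) by move=> c x y; rewrite linearP.
  have cb : bilin (fun (a : A) (x : F) => (counit a : C) *: x).
    split=> [x c a a'|a c x y]; first by rewrite linearP scalerDl scalerA.
    by rewrite scalerDr !scalerA [c * _]GRing.mulrC.
  rewrite -[LHS](counit_coact Frel) (rew _ _ cb).
  under eq_bigr => j _ do rewrite [w j]wE scaler_sumr.
  rewrite exchange_big; apply: eq_bigr => k _ /=.
  by rewrite scaler_suml; apply: eq_bigr => j _; rewrite scalerA.
- by move=> k j; under eq_bigr do rewrite Sstar; exact: St.
Qed.

End HermitianLine.

(** * Frames and fullness of the form when the fibre is one-dimensional *)

Section LineFrame.
Variables (C : numClosedFieldType) (X : homSpace C).
Local Notation A := (hsA X).
Local Notation B := (coinv X).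
Variables (F : lmodType C) (l : B -> F -> F) (r : F -> B -> F)
  (delta : F -> tensC A F) (h : F -> F -> B).
Hypothesis Fh : hermitian_relmod l r delta h.
Variables (phi : F -> C) (e0 : F).
Hypothesis phil : linear (phi : F -> C^o).
Hypothesis phi1 : phi e0 = 1.
Hypothesis phi0 : forall x, BplusL l setT x -> phi x = 0.
Hypothesis phiU : forall (U : lmodType C) (f : F -> U), linear f ->
  (forall x, BplusL l setT x -> f x = 0) -> forall x, f x = phi x *: f e0.

Let Frel : is_relmod l r delta. Proof. by case: Fh. Qed.
Let Fhm : hermitian_module l h. Proof. by case: Fh. Qed.

Definition epsB (b : B) : C := counit (coinv_val b).
Local Notation eps := epsB.

Lemma eps_lin : linear (eps : B -> C^o).
Proof. by move=> c x y; rewrite /epsB val_lin linearP. Qed.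

Lemma valM (a b : B) : coinv_val (a * b) = coinv_val a * coinv_val b.
Proof. by []. Qed.

Lemma epsM (a b : B) : eps (a * b) = eps a * eps b.
Proof. by rewrite /epsB valM rmorphM. Qed.

Let lam : C := eps (h e0 e0).

(** With the second argument fixed, the counit of h kills B^+ F in the first and hence factors
    through phi; Hermitian symmetry handles the other argument. *)
Lemma eps_form x y : eps (h x y) = lam * phi x * (phi y)^*.
Proof.
have E z w : eps (h z w) = phi z * eps (h e0 w).
  apply: (@phiU C^o (fun z => eps (h z w))) => [c a b|_ [s [sB ->]]].
    by rewrite (form_linl Fh) eps_lin.
  rewrite (lin_sum (form_linl Fh w)) (lin_sum eps_lin) big_seq big1 // => p ps.
  have [p0 _] := sB p ps; have {}p0 : eps p.1 = 0 by [].
  by rewrite (form_l Fh) epsM p0 mul0r.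
have S z w : eps (h z w) = (eps (h w z))^*.
  by rewrite (form_sym Fh) /epsB counit_bstar.
rewrite E (S e0 y) E rmorphM /= -(S e0 e0) -/lam; ring.
Qed.

(** The map (id ⊗ phi) delta from the line module to A. By [form_coord] it turns h into a multiple
    of the standard form a b^* on A. *)
Definition line_coord x : A := \sum_(p <- repr (delta x)) phi p.2 *: p.1.

Lemma line_coord_rep x s : delta x = \sum_(p <- s) p.1 ⊗ p.2 ->
  line_coord x = \sum_(p <- s) phi p.2 *: p.1.
Proof.
move=> Es; have := liftC_eq s (bilin_balanced (bilin_scale phil (@idfun_lin _ A))).
by rewrite -Es => <-.
Qed.

Lemma form_coord x y : coinv_val (h x y) = lam *: (line_coord x * star (line_coord y)).
Proof.
have sl (c : C) (a b : A) : star (c *: a + b) = c^* *: star a + star b := star_lin c a b.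
have sS (s : seq (A * F)) : star (\sum_(q <- s) phi q.2 *: q.1) =
    \sum_(q <- s) (phi q.2)^* *: star q.1.
  elim: s => [|q s IH]; first by rewrite !big_nil star0.
  by rewrite !big_cons sl IH.
have := form_coact Fh (tensCE (delta x)) (tensCE (delta y)).
rewrite -big_allpairs_dep => E.
have := coB_counit (b := h x y) (s := [seq (p.1 * star q.1, h p.2 q.2) |
    p <- repr (delta x), q <- repr (delta y)]).
rewrite E !big_allpairs_dep => /(_ erefl) ->.
rewrite /line_coord sS mulr_suml scaler_sumr; apply: eq_bigr => p _.
rewrite mulr_sumr scaler_sumr; apply: eq_bigr => q _ /=.
by rewrite -/(epsB _) eps_form -scalerAl -scalerAr !scalerA.
Qed.

(** The counit is a *-character, hence non-negative on sums of x^* x. If lam were zero, [form_coord]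
    would make h(e0, e0) vanish. *)
Lemma lam_gt0 : 0 < lam.
Proof.
have e00 : e0 != 0.
  by apply: contra_eq_neq phi1 => ->; rewrite (lin0 phil) eq_sym oner_neq0.
have [[s Es] nz] := hm_pos Fhm e00.
rewrite lt_def; apply/andP; split.
  apply/eqP => l0; apply: nz; apply: (can_inj (@expectK _ X)).
  by rewrite form_coord l0 scale0r (lin0 (@val_lin _ X)).
rewrite /lam Es (lin_sum eps_lin) sumr_ge0 // => x _.
by rewrite epsM {1}/epsB counit_bstar GRing.mulrC mul_conjC_ge0.
Qed.

(** Take the unitary family whose span contains e0. In A its coordinates satisfy sum_i x_i^* x_i =
    sg by unitarity of t, so sum_i h(e, u_i) u_i equals lam sg e, and it remains to rescale. *)
Theorem line_frame : exists N (u : 'I_N -> F) (t : 'I_N -> 'I_N -> A),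
  [/\ forall i, delta (u i) = \sum_k t i k ⊗ u k,
      forall k m, \sum_i star (t i k) * t i m = (k == m)%:R &
      forall e, \sum_i l (h e (u i)) (u i) = e].
Proof.
have [N [u [t [c [e0E ut tu]]]]] := unitary_span Fh e0.
have rep i : delta (u i) = \sum_(p <- [seq (t i k, u k) | k <- index_enum 'I_N]) p.1 ⊗ p.2.
  by rewrite big_map.
have cu i : line_coord (u i) = \sum_k phi (u k) *: t i k.
  by rewrite (line_coord_rep (rep i)) big_map.
pose sg := \sum_k (phi (u k))^* * phi (u k).
have sl (s : C) (a b : A) : star (s *: a + b) = s^* *: star a + star b := star_lin s a b.
have scu i : star (line_coord (u i)) = \sum_k (phi (u k))^* *: star (t i k).
  rewrite cu; elim: (index_enum _) => [|k s IH]; first by rewrite !big_nil star0.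
  by rewrite !big_cons sl IH.
have sgE : \sum_i star (line_coord (u i)) * line_coord (u i) = sg%:A.
  transitivity (\sum_k \sum_m ((phi (u k))^* * phi (u m)) *: \sum_i star (t i k) * t i m).
    rewrite [RHS](eq_bigr (fun k => \sum_i \sum_m ((phi (u k))^* *: star (t i k)) * (phi (u m) *: t i m))).
      rewrite exchange_big; apply: eq_bigr => i _ /=.
      by rewrite scu cu mulr_suml; apply: eq_bigr => k _; rewrite mulr_sumr.
    move=> k _; rewrite exchange_big; apply: eq_bigr => m _ /=.
    by rewrite scaler_sumr; apply: eq_bigr => i _; rewrite -scalerAl -scalerAr scalerA.
  rewrite /sg scaler_suml; apply: eq_bigr => k _.
  rewrite (bigD1 k) //= tu eqxx big1 ?addr0 // => m mk.
  by rewrite tu eq_sym (negPf mk) scaler0.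
(* sg is zero only if phi kills every u_k, and then also e0, against phi(e0) = 1. *)
have sg0 : 0 < sg.
  have ge0 k : true -> 0 <= (phi (u k))^* * phi (u k) by rewrite GRing.mulrC mul_conjC_ge0.
  rewrite lt_def sumr_ge0 ?andbT //; apply/eqP => /(psumr_eq0P ge0) u0.
  have /eqP : phi e0 = 0.
    rewrite e0E (lin_sum phil) big1 // => k _; rewrite (linZ phil).
    have /eqP := u0 k isT; rewrite mulf_eq0 conjC_eq0 orbb => /eqP ->.
    exact: mulr0.
  by rewrite phi1 oner_eq0.
pose mu := lam * sg; have mu0 : 0 < mu by rewrite mulr_gt0 ?lam_gt0.
have pars e : \sum_i l (h e (u i)) (u i) = mu *: e.
  apply/eqP; rewrite -subr_eq0; apply/eqP/(form_eq0 Fh) => y; apply: (can_inj (@expectK _ X)).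
  have hl := form_linl Fh y.
  rewrite (linB hl) (linZ hl) (linB (@val_lin _ X)) (linZ (@val_lin _ X)) (lin_sum hl).
  rewrite (lin_sum (@val_lin _ X)) (lin0 (@val_lin _ X)).
  apply/eqP; rewrite subr_eq0; apply/eqP.
  transitivity (\sum_i (lam * lam) *: (line_coord e * (star (line_coord (u i)) *
      line_coord (u i)) * star (line_coord y))).
    apply: eq_bigr => i _; rewrite (form_l Fh) valM !form_coord.
    by rewrite -scalerAl -scalerAr scalerA !mulrA.
  rewrite -scaler_sumr -mulr_suml -mulr_sumr sgE form_coord.
  by rewrite -scalerAr mulr1 -scalerAl !scalerA /mu; congr (_ *: _); ring.
(* Scaling all u_i by the same scalar leaves the coefficient matrix t unchanged; k is real, so it
   contributes k^2 = 1/mu to the frame sum. *)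
pose k := (sqrtC mu)^-1.
have kk : k * k * mu = 1 by rewrite -expr2 exprVn sqrtCK mulVf // gt_eqF.
have kr : k^* = k by rewrite conj_Creal // realV ger0_real // sqrtC_ge0 ltW.
have dl := coact_lin Frel.
have [pl pr] := pureC_bilin A F.
exists N, (fun i => k *: u i), t; split=> // [i|e].
  rewrite (linZ dl) ut scaler_sumr; apply: eq_bigr => j _.
  by rewrite (linZ (pr _)).
have lb := lmod_bilin Frel.
rewrite (eq_bigr (fun i => (k * k) *: l (h e (u i)) (u i))).
  by rewrite -scaler_sumr pars scalerA kk scale1r.
move=> i _; rewrite (linZ (lb.2 _)).
have := form_conj Fh e k (u i) 0; rewrite !addr0 => ->.
have -> : h e 0 = 0.
  by rewrite (form_sym Fh) (lin0 (form_linl Fh _)); apply: (can_inj (@expectK _ X)); rewrite /= star0.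
by rewrite addr0 kr (linZ (lb.1 _)) scalerA.
Qed.

(* The conditional expectation carries S(b_(1)) b_(2) = eps(b), b = h e0 e0,
   into the ideal generated by the values of h. *)
Theorem form_full : exists s : seq (F * F), \sum_(p <- s) h p.1 p.2 = 1.
Proof.
pose s := [seq (p, q) | p <- repr (delta e0), q <- repr (delta e0)].
pose x (z : (A * F) * (A * F)) : F :=
  lam^-1 *: l (expect (antipode (z.1.1 * star z.2.1))) z.1.2.
exists [seq (x z, z.2.2) | z <- s]; rewrite big_map /=.
have hl y := form_linl Fh y.
pose t := [seq (z.1.1 * star z.2.1, h z.1.2 z.2.2) | z <- s].
have E : coB (h e0 e0) = \sum_(z <- t) z.1 ⊗ z.2.
  rewrite (form_coact Fh (tensCE (delta e0)) (tensCE (delta e0))).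
  by rewrite big_map big_allpairs_dep.
have bl : bilin (fun a1 a2 : A => antipode a1 * a2).
  by apply: (mulS_bilin (f := antipode) (g := idfun)) => //; exact: linear_fun.
have Ean : \sum_(p <- repr (coB (h e0 e0))) antipode p.1 * coinv_val p.2 = lam%:A.
  rewrite (coB_sum _ bl); exact: antipodel.
have bl' : bilin (fun (a1 : A) (a2 : B) => antipode a1 * coinv_val a2).
  by apply: (comp_bilin bl); [|exact: val_lin].
have {}Ean : \sum_(z <- s) antipode (z.1.1 * star z.2.1) * coinv_val (h z.1.2 z.2.2) = lam%:A.
  by rewrite -Ean; have := liftC_eq t (bilin_balanced bl'); rewrite -E big_map => <-.
have := congr1 (@expect _ X) Ean.
have el := @expect_lin _ X.
rewrite (lin_sum el) (linZ el) => E1.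
rewrite (eq_bigr (fun z => lam^-1 *: expect (antipode (z.1.1 * star z.2.1) * coinv_val (h z.1.2 z.2.2)))).
  rewrite -scaler_sumr E1 scalerA mulVf ?gt_eqF ?lam_gt0 // scale1r.
  by rewrite -(expectK 1); congr expect; rewrite rmorph1.
by move=> z _; rewrite expectM /x (linZ (hl _)) (form_l Fh).
Qed.

End LineFrame.

(** * Bigraded covariant calculi *)

Section Calculus.
Variables (C : numClosedFieldType) (K : CQHHermitian C).
Local Notation X := (cqh_space K).
Local Notation A := (hsA X).
Local Notation B := (coinv X).
Local Notation Y := (cqh_calc K).
Local Notation bd := (cqh_bd K).
Local Notation n := (half_dim K).
Local Notation kap := (kappa K).
Implicit Types w v x y : Y.

Lemma cqh_cplx : complex_structure bd. Proof. by case: (cqh_complex K). Qed.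

Lemma cqh_dim : cdim Y = n.*2. Proof. exact: (hs_dim (cqh_hermitian K)). Qed.

Lemma bdK a b w : bd a b (bd a b w) = bd a b w.
Proof. by rewrite (bd_proj cqh_cplx) !eqxx. Qed.

Lemma bd_Omab a b a' b' w : Omab bd a b w ->
  bd a' b' w = if (a' == a) && (b' == b) then w else 0.
Proof. by move=> <-; rewrite (bd_proj cqh_cplx). Qed.

Lemma Omab_bd a b w : Omab bd a b (bd a b w). Proof. exact: bdK. Qed.

Lemma bd_total w : w = \sum_(k < (cdim Y).+1) \sum_(a < k.+1) bd a (k - a) w.
Proof. by rewrite [LHS]deg_sum; apply: eq_bigr => k _; exact: (bd_sum cqh_cplx). Qed.

Lemma bd_ind (P : Y -> Prop) : P 0 -> (forall x y, P x -> P y -> P (x + y)) ->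
  (forall a b w, Omab bd a b w -> P w) -> forall w, P w.
Proof.
move=> P0 PD Ph w; rewrite [w]bd_total.
by elim/big_ind: _ => // k _; elim/big_ind: _ => // a _; apply: Ph (Omab_bd _ _ _).
Qed.

Lemma deg_bd k a b w : deg k (bd a b w) = if (a + b == k)%N then bd a b w else 0.
Proof.
rewrite (bd_sum cqh_cplx); have [<-|abk] := eqVneq.
  have la : (a < (a + b).+1)%N by rewrite ltnS leq_addr.
  rewrite (bigD1 (Ordinal la)) //= addKn bdK big1 ?addr0 // => i ia.
  rewrite (bd_proj cqh_cplx) ifF //; apply/negbTE.
  by rewrite negb_and -(inj_eq val_inj) in ia *; rewrite ia.
rewrite big1 // => i _; rewrite (bd_proj cqh_cplx) ifF //; apply/negP => /andP[/eqP ia /eqP ib].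
by case/eqP: abk; rewrite -ia -ib subnKC // -ltnS.
Qed.

Lemma Omab_deg a b w : Omab bd a b w -> deg (a + b) w = w.
Proof. by move=> <-; rewrite deg_bd eqxx. Qed.

Lemma deg_gt k w : (cdim Y < k)%N -> deg k w = 0.
Proof.
move=> lk; rewrite [w]deg_sum linear_sum big1 // => j _ /=.
by rewrite deg_proj ifF //; apply/negbTE; rewrite gtn_eqF // (leq_trans (ltn_ord j)).
Qed.

Lemma bd_gt a b w : (cdim Y < a + b)%N -> bd a b w = 0.
Proof. by move=> ab; rewrite -(Omab_deg (Omab_bd a b w)) deg_gt. Qed.

Lemma Omab0 a b : Omab bd a b 0. Proof. exact: linear0. Qed.

Lemma OmabP a b (c : C) w v : Omab bd a b w -> Omab bd a b v -> Omab bd a b (c *: w + v).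
Proof. by rewrite /Omab /= linearP => -> ->. Qed.

Lemma OmabZ a b (c : C) w : Omab bd a b w -> Omab bd a b (c *: w).
Proof. by rewrite /Omab /= linearZ => ->. Qed.

(** The bounds in the test exclude the values at which subtraction truncates. *)
Lemma bd_mull a b x p q w : Omab bd a b x ->
  bd p q (x * w) = if (a <= p)%N && (b <= q)%N then x * bd (p - a) (q - b) w else 0.
Proof.
move=> xab; elim/bd_ind: w => [|w v Ew Ev|a' b' w wab].
- by rewrite !linear0 mulr0 linear0 if_same.
- rewrite mulrDr !linearD Ew Ev; case: ifP => _; rewrite ?addr0 //.
  by rewrite mulrDr.
- rewrite (bd_Omab _ _ (bd_mul cqh_cplx xab wab)) (bd_Omab _ _ wab).
  case: (ltnP p a) => /= [pa|ap]; first by rewrite ifF // ltn_eqF ?ltn_addr.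
  case: (ltnP q b) => /= [qb|bq]; first by rewrite ifF // andbC ltn_eqF ?ltn_addr.
  have -> : (p == a + a')%N = (p - a == a')%N by rewrite -{1}(subnKC ap) eqn_add2l.
  have -> : (q == b + b')%N = (q - b == b')%N by rewrite -{1}(subnKC bq) eqn_add2l.
  by case: ifP; rewrite ?mulr0.
Qed.

Lemma bd_mulr a b x p q w : Omab bd a b x ->
  bd p q (w * x) = if (a <= p)%N && (b <= q)%N then bd (p - a) (q - b) w * x else 0.
Proof.
move=> xab; elim/bd_ind: w => [|w v Ew Ev|a' b' w wab].
- by rewrite !linear0 mul0r linear0 if_same.
- rewrite mulrDl !linearD Ew Ev; case: ifP => _; rewrite ?addr0 //.
  by rewrite mulrDl.
- rewrite (bd_Omab _ _ (bd_mul cqh_cplx wab xab)) (bd_Omab _ _ wab).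
  case: (ltnP p a) => /= [pa|ap]; first by rewrite ifF // ltn_eqF ?ltn_addl.
  case: (ltnP q b) => /= [qb|bq]; first by rewrite ifF // andbC ltn_eqF ?ltn_addl.
  have -> : (p == a' + a)%N = (p - a == a')%N by rewrite -{1}(subnK ap) eqn_add2r.
  have -> : (q == b' + b)%N = (q - b == b')%N by rewrite -{1}(subnK bq) eqn_add2r.
  by case: ifP; rewrite ?mul0r.
Qed.

Lemma Omab_inB b : Omab bd 0 0 (inB b).
Proof.
have E : deg 0 (inB b : Y) = inB b by apply/inB_deg0; exists b.
by move: (E); rewrite (bd_sum cqh_cplx) big_ord1.
Qed.

Lemma bd_inBl b p q w : bd p q (inB b * w) = inB b * bd p q w.
Proof. by rewrite (bd_mull _ _ _ (Omab_inB b)) !subn0. Qed.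

Lemma bd_inBr b p q w : bd p q (w * inB b) = bd p q w * inB b.
Proof. by rewrite (bd_mulr _ _ _ (Omab_inB b)) !subn0. Qed.

Lemma deg_inBl b k w : deg k (inB b * w) = inB b * deg k w.
Proof.
rewrite !(bd_sum cqh_cplx) mulr_sumr; apply: eq_bigr => i _; exact: bd_inBl.
Qed.

Lemma deg_inBr b k w : deg k (w * inB b) = deg k w * inB b.
Proof.
rewrite !(bd_sum cqh_cplx) mulr_suml; apply: eq_bigr => i _; exact: bd_inBr.
Qed.

Lemma ostar_lin (c : C) w v : ostar (c *: w + v) = c^* *: ostar w + ostar v.
Proof. exact: ostar_conj. Qed.

Lemma ostarD w v : ostar (w + v) = ostar w + ostar v.
Proof. by have := ostar_lin 1 w v; rewrite conjC1 !scale1r. Qed.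

Lemma ostar0 : ostar (0 : Y) = 0.
Proof. by apply: (addrI (ostar 0)); rewrite -ostarD !addr0. Qed.

Lemma ostarZ (c : C) w : ostar (c *: w) = c^* *: ostar w.
Proof. by have := ostar_lin c w 0; rewrite ostar0 !addr0. Qed.

Lemma ostarN w : ostar (- w) = - ostar w.
Proof. by rewrite -scaleN1r ostarZ rmorphN /= conjC1 scaleN1r. Qed.

Lemma ostar_sum (I : Type) (s : seq I) (P : pred I) (F : I -> Y) :
  ostar (\sum_(i <- s | P i) F i) = \sum_(i <- s | P i) ostar (F i).
Proof. exact: (big_morph _ ostarD ostar0). Qed.

Lemma bd_ostar a b w : bd a b (ostar w) = ostar (bd b a w).
Proof.
elim/bd_ind: w => [|x y Ex Ey|a' b' w wab]; first by rewrite linear0 ostar0 linear0.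
  by rewrite ostarD !linearD Ex Ey /= ostarD.
rewrite (bd_Omab _ _ (bd_star cqh_cplx wab)) (bd_Omab _ _ wab) andbC.
by case: ifP; rewrite ?ostar0.
Qed.

Lemma deg_ostar k w : deg k (ostar w) = ostar (deg k w).
Proof.
elim/bd_ind: w => [|x y Ex Ey|a b w wab]; first by rewrite linear0 ostar0 linear0.
  by rewrite ostarD !linearD Ex Ey /= ostarD.
rewrite -(bd_star cqh_cplx wab) -{2}wab !deg_bd addnC.
by case: ifP => _; rewrite ?ostar0 // (bd_star cqh_cplx wab) wab.
Qed.

Lemma ostar_inBl b w : ostar (inB b * w) = ostar w * inB (bstar b).
Proof.
elim/bd_ind: w => [|x y Ex Ey|a' b' w wab]; first by rewrite mulr0 ostar0 mul0r.
  by rewrite mulrDr !ostarD Ex Ey mulrDl.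
rewrite (ostar_mul (Omab_deg (Omab_inB b)) (Omab_deg wab)) mul0n expr0 mul1r.
by rewrite ostar_inB.
Qed.

Lemma ostar_inBr b w : ostar (w * inB b) = inB (bstar b) * ostar w.
Proof.
elim/bd_ind: w => [|x y Ex Ey|a' b' w wab]; first by rewrite mul0r ostar0 mulr0.
  by rewrite mulrDl !ostarD Ex Ey mulrDr.
rewrite (ostar_mul (Omab_deg wab) (Omab_deg (Omab_inB b))) muln0 expr0 mul1r.
by rewrite ostar_inB.
Qed.

Lemma d_bd p q a b w : Omab bd a b w -> bd p q (d w) =
  (if (p == a.+1) && (q == b) then bd p q (d w) else 0) +
  (if (p == a) && (q == b.+1) then bd p q (d w) else 0).
Proof.
move=> wab; rewrite {1}(bd_d cqh_cplx wab) linearD /= !(bd_proj cqh_cplx).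
by congr (_ + _); case: ifP => // /andP[/eqP -> /eqP ->].
Qed.

Lemma delbarE a b w : Omab bd a b w -> delbar bd w = bd a b.+1 (d w).
Proof.
move=> wab; rewrite /delbar; case: (leqP (a + b) (cdim Y)) => [ab|ab]; last first.
  have -> : w = 0 by rewrite -wab bd_gt.
  by rewrite !linear0 big1 // => i _; rewrite big1 // => j _; rewrite !linear0.
have la : (a < (cdim Y).+1)%N by rewrite ltnS (leq_trans _ ab) ?leq_addr.
have lb : (b < (cdim Y).+1)%N by rewrite ltnS (leq_trans _ ab) ?leq_addl.
rewrite (bigD1 (Ordinal la)) //= (bigD1 (Ordinal lb)) //= wab.
rewrite big1 ?addr0 => [|j jb]; last first.
  rewrite (bd_Omab _ _ wab) eqxx /= ifF ?linear0 //.
  by apply/negbTE; rewrite -(inj_eq val_inj) in jb.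
rewrite big1 ?addr0 // => i ia; rewrite big1 // => j _.
rewrite (bd_Omab _ _ wab) ifF ?linear0 //.
by rewrite -(inj_eq val_inj) in ia; rewrite (negbTE ia).
Qed.

Lemma d_inB b : d (inB b : Y) = bd 1 0 (d (inB b)) + bd 0 1 (d (inB b)).
Proof. exact: (bd_d cqh_cplx (Omab_inB b)). Qed.

Lemma gsignE k w : deg k w = w -> gsign w = (-1) ^+ k * w.
Proof.
move=> wk; rewrite /gsign; case: (leqP k (cdim Y)) => [lk|lk]; last first.
  have -> : w = 0 by rewrite -wk deg_gt.
  by rewrite mulr0 big1 // => i _; rewrite linear0 mulr0.
have lk' : (k < (cdim Y).+1)%N by [].
rewrite (bigD1 (Ordinal lk')) //= wk big1 ?addr0 // => i ik.
rewrite -wk deg_proj ifF ?mulr0 //.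
by apply/negbTE; rewrite -(inj_eq val_inj) in ik.
Qed.

Lemma gsign_lin : linear (@gsign _ _ Y).
Proof.
apply: sum_linear => k c x y.
by rewrite linearP mulrDr -scalerAr.
Qed.

Lemma d_mul w v : d (w * v) = d w * v + gsign w * d v.
Proof.
elim/bd_ind: w => [|x y Ex Ey|a b w wab].
- by rewrite mul0r !linear0 mul0r (lin0 gsign_lin) mul0r addr0.
- by rewrite mulrDl !linearD Ex Ey (linD gsign_lin) /= !mulrDl addrACA.
- by rewrite (d_leibniz _ (Omab_deg wab)) (gsignE (Omab_deg wab)) mulrA.
Qed.

Lemma dL_lin : linear (@dL _ _ Y). Proof. by have [] := dL_comodule Y. Qed.

Lemma mapC_bd a b : linear (mapC (@idfun A) (bd a b)).
Proof. by apply: mapC_linear => //; exact: linear_fun. Qed.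

Lemma dL_bd a b w : dL (bd a b w) = mapC idfun (bd a b) (dL w).
Proof.
have ml := mapC_bd a b.
elim/bd_ind: w => [|x y Ex Ey|a' b' w wab].
- by rewrite linear0 !(lin0 dL_lin) (lin0 ml).
- by rewrite linearD !(linD dL_lin) Ex Ey (linD ml).
have [_ sub] := cqh_complex K; have [_ /(_ w wab)[s [sP Ew]]] := sub a' b'.
rewrite (bd_Omab _ _ wab) Ew mapC_eq //; last exact: linear_fun.
have [pl pr] := pureC_bilin A Y.
case: ifP => e; rewrite ?Ew ?(lin0 dL_lin) [RHS]big_seq.
  by rewrite big_seq; apply: eq_bigr => p ps; rewrite (bd_Omab _ _ (sP p ps)) e.
by rewrite big1 // => p ps; rewrite (bd_Omab _ _ (sP p ps)) e (lin0 (pr _)).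
Qed.

Lemma dL_rep_Omab a b w : Omab bd a b w -> exists2 s : seq (A * Y),
  dL w = \sum_(p <- s) p.1 ⊗ p.2 & forall p, p \in s -> Omab bd a b p.2.
Proof.
move=> wab; exists [seq (p.1, bd a b p.2) | p <- repr (dL w)].
  by rewrite big_map -{1}wab dL_bd.
by move=> _ /mapP[p _ ->]; exact: Omab_bd.
Qed.

Lemma dL_mul_rep w v s t : dL w = \sum_(p <- s) p.1 ⊗ p.2 -> dL v = \sum_(q <- t) q.1 ⊗ q.2 ->
  dL (w * v) = \sum_(p <- s) \sum_(q <- t) (p.1 * q.1) ⊗ (p.2 * q.2).
Proof. by move=> Ew Ev; rewrite dL_mul Ew Ev mulC_eq. Qed.

Lemma dL_d_rep w s : dL w = \sum_(p <- s) p.1 ⊗ p.2 ->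
  dL (d w) = \sum_(p <- s) p.1 ⊗ d p.2.
Proof. by move=> Ew; rewrite dL_d Ew mapC_eq //; exact: linear_fun. Qed.

Lemma dL_bd_rep a b w s : dL w = \sum_(p <- s) p.1 ⊗ p.2 ->
  dL (bd a b w) = \sum_(p <- s) p.1 ⊗ bd a b p.2.
Proof. by move=> Ew; rewrite dL_bd Ew mapC_eq //; exact: linear_fun. Qed.

Lemma dL_inB_rep (b : B) s : coB b = \sum_(p <- s) p.1 ⊗ p.2 ->
  dL (inB b : Y) = \sum_(p <- s) p.1 ⊗ inB p.2.
Proof. by move=> Eb; rewrite dL_inB Eb mapC_eq //; exact: linear_fun. Qed.

Lemma star_ostar_balanced : balancedC (fun (a : A) (w : Y) => star a ⊗ ostar w).
Proof.
have [pD pD' pZ] := pureC_balanced A Y.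
by split=> [v v' w|v w w'|c v w]; rewrite ?starD ?ostarD ?pD ?pD' // starZ ostarZ pZ.
Qed.

Lemma dL_deg k w : dL (deg k w) = mapC idfun (deg k) (dL w).
Proof.
rewrite (bd_sum cqh_cplx) (lin_sum dL_lin) [dL w]tensCE mapC_eq //; last exact: linear_fun.
have [pl pr] := pureC_bilin A Y.
under eq_bigr do rewrite (dL_bd_rep _ _ (tensCE (dL w))).
rewrite exchange_big; apply: eq_bigr => p _ /=.
by rewrite (bd_sum cqh_cplx) (lin_sum (pr _)).
Qed.

Lemma dL_rep_deg k w : deg k w = w -> exists2 s : seq (A * Y),
  dL w = \sum_(p <- s) p.1 ⊗ p.2 & forall p, p \in s -> deg k p.2 = p.2.
Proof.
move=> wk; exists [seq (p.1, deg k p.2) | p <- repr (dL w)].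
  by rewrite big_map -{1}wk dL_deg.
by move=> _ /mapP[p _ ->] /=; rewrite deg_proj eqxx.
Qed.

Lemma signZ k w : (-1) ^+ k * w = ((-1) ^+ k : C) *: w.
Proof.
rewrite -signr_odd -[in RHS]signr_odd; case: (odd k) => /=.
  by rewrite !expr1 mulN1r scaleN1r.
by rewrite !expr0 mul1r scale1r.
Qed.

Lemma coB_bstar_rep (b : B) s : coB b = \sum_(p <- s) p.1 ⊗ p.2 ->
  coB (bstar b) = \sum_(p <- s) star p.1 ⊗ bstar p.2.
Proof.
move=> Eb; apply: coB_uniq.
have := mapC_eq [seq (star p.1, bstar p.2) | p <- s] (@idfun_lin _ A) (@val_lin _ X).
rewrite !big_map => ->; rewrite [RHS]Delta_star -coBP Eb mapC_eq //.
have sb := balanced_star X A.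
by rewrite /mapC (liftC_sum sb); apply: eq_bigr => p _; rewrite (liftC_pure sb).
Qed.

Definition star_compat w := dL (ostar w) = mapC star ostar (dL w).

Lemma star_compatE w s : star_compat w -> dL w = \sum_(p <- s) p.1 ⊗ p.2 ->
  dL (ostar w) = \sum_(p <- s) star p.1 ⊗ ostar p.2.
Proof. by move=> -> ->; exact: (liftC_eq _ star_ostar_balanced). Qed.

Lemma star_compatP w s : dL w = \sum_(p <- s) p.1 ⊗ p.2 ->
  dL (ostar w) = \sum_(p <- s) star p.1 ⊗ ostar p.2 -> star_compat w.
Proof.
by rewrite /star_compat => -> ->; rewrite /mapC (liftC_eq _ star_ostar_balanced).
Qed.

Lemma star_compat0 : star_compat 0.
Proof.
by rewrite /star_compat ostar0 (lin0 dL_lin) /mapC (liftC0 star_ostar_balanced).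
Qed.

Lemma star_compatD x y : star_compat x -> star_compat y -> star_compat (x + y).
Proof.
rewrite /star_compat => Ex Ey.
by rewrite ostarD !(linD dL_lin) Ex Ey /mapC (liftCD star_ostar_balanced).
Qed.

Lemma star_compatZ (c : C) x : star_compat x -> star_compat (c *: x).
Proof.
move=> Ex; apply: (@star_compatP _ [seq (c *: p.1, p.2) | p <- repr (dL x)]).
  rewrite (linZ dL_lin) {1}[dL x]tensCE scaler_sumr big_map.
  by apply: eq_bigr => p _; rewrite pureCZ.
rewrite ostarZ (linZ dL_lin) (star_compatE Ex (tensCE (dL x))) scaler_sumr big_map.
apply: eq_bigr => p _; rewrite -pureCZ; congr (_ ⊗ _); by rewrite starZ.
Qed.

Lemma star_compatM i j u v : deg i u = u -> deg j v = v ->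
  star_compat u -> star_compat v -> star_compat (u * v).
Proof.
move=> ui vj Su Sv; have [pl pr] := pureC_bilin A Y.
have [s Es sP] := dL_rep_deg ui; have [t Et tP] := dL_rep_deg vj.
apply: (@star_compatP _ [seq (p.1 * q.1, p.2 * q.2) | p <- s, q <- t]).
  by rewrite (dL_mul_rep Es Et) big_allpairs_dep.
rewrite (ostar_mul ui vj) signZ (linZ dL_lin).
have := dL_mul_rep (s := [seq (star q.1, ostar q.2) | q <- t]) (t := [seq (star q.1, ostar q.2) | q <- s]).
rewrite !big_map => -> //; [|exact: star_compatE|exact: star_compatE].
rewrite big_allpairs_dep /= exchange_big scaler_sumr big_map big_seq [RHS]big_seq.
apply: eq_bigr => p ps; rewrite scaler_sumr big_seq [RHS]big_seq; apply: eq_bigr => q qt /=.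
rewrite (ostar_mul (sP p ps) (tP q qt)) signZ (linZ (pr _)); congr (_ *: (_ ⊗ _)).
by rewrite starM.
Qed.

(** The forms with all homogeneous components compatible are a subalgebra containing B and dB, hence
    everything. Components are needed because the star of a product carries a sign depending on
    degrees. *)
Lemma dL_ostar w : star_compat w.
Proof.
pose S : set Y := [set w | forall k, star_compat (deg k w)].
suff ST : S = setT.
  rewrite [w]deg_sum; elim/big_ind: _ => [||k _]; [exact: star_compat0|exact: star_compatD|].
  by have : S w by rewrite ST.
have SB b k : star_compat (deg k (inB b : Y)).
  rewrite -(Omab_deg (Omab_inB b)) deg_proj; case: eqP => _; last exact: star_compat0.
  rewrite (Omab_deg (Omab_inB b)).
  apply: (@star_compatP _ [seq (p.1, inB p.2 : Y) | p <- repr (coB b)]); rewrite big_map.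
    by rewrite (dL_inB_rep (tensCE (coB b))).
  rewrite ostar_inB.
  have := dL_inB_rep (b := bstar b) (s := [seq (star p.1, bstar p.2) | p <- repr (coB b)]).
  rewrite !big_map (coB_bstar_rep (tensCE (coB b))) => -> //.
  by apply: eq_bigr => p _ /=; rewrite ostar_inB.
apply: calc_gen => //.
- split=> [k|c v u Sv Su k]; first by rewrite linear0; exact: star_compat0.
  by rewrite linearP; apply: star_compatD => //; apply: star_compatZ.
- move=> u v Su Sv k; rewrite [u]deg_sum [v]deg_sum mulr_suml linear_sum.
  elim/big_ind: _ => [||i _]; [exact: star_compat0|exact: star_compatD|].
  rewrite mulr_sumr linear_sum.
  elim/big_ind: _ => [||j _]; [exact: star_compat0|exact: star_compatD|].
  have di : deg i (deg i u) = deg i u by rewrite deg_proj eqxx.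
  have dj : deg j (deg j v) = deg j v by rewrite deg_proj eqxx.
  rewrite /= -(deg_mul di dj) deg_proj; case: eqP => _; last exact: star_compat0.
  by rewrite (deg_mul di dj); exact: star_compatM di dj (Su _) (Sv _).
- move=> b k; have d1 := d_deg (Omab_deg (Omab_inB b)).
  rewrite -d1 deg_proj; case: eqP => _; last exact: star_compat0.
  rewrite d1.
  have Sb : star_compat (inB b) by have := SB b 0%N; rewrite (Omab_deg (Omab_inB b)).
  have Es := dL_inB_rep (tensCE (coB b)).
  apply: (@star_compatP _ [seq (p.1, d (inB p.2 : Y)) | p <- repr (coB b)]); rewrite big_map.
    have := dL_d_rep (w := inB b) (s := [seq (p.1, inB p.2 : Y) | p <- repr (coB b)]).
    by rewrite !big_map Es => ->.
  rewrite ostar_d.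
  have E2 : dL (ostar (inB b : Y)) = \sum_(p <- repr (coB b)) star p.1 ⊗ ostar (inB p.2).
    have := star_compatE (s := [seq (p.1, inB p.2 : Y) | p <- repr (coB b)]) Sb.
    by rewrite !big_map Es => ->.
  have := dL_d_rep (w := ostar (inB b)) (s := [seq (star p.1, ostar (inB p.2) : Y) | p <- repr (coB b)]).
  rewrite !big_map E2 => -> //.
  by apply: eq_bigr => p _; rewrite /= ostar_d.
Qed.

Lemma dL_ostar_rep w s : dL w = \sum_(p <- s) p.1 ⊗ p.2 ->
  dL (ostar w) = \sum_(p <- s) star p.1 ⊗ ostar p.2.
Proof. exact/star_compatE/dL_ostar. Qed.

End Calculus.

(** * Chern connections *)

Section TensorOverB.
Variables (C : numClosedFieldType) (K : CQHHermitian C).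
Local Notation X := (cqh_space K).
Local Notation A := (hsA X).
Local Notation B := (coinv X).
Local Notation Y := (cqh_calc K).
Local Notation bd := (cqh_bd K).
Variables (F : lmodType C) (l : B -> F -> F).

Local Notation T := (tensB Y l).
Local Notation pure := (@pureB C X Y F l).

Definition balB (G : lmodType C) (u : Y -> F -> G) : Prop :=
  bilin u /\ forall w b f, u (w * inB b) f = u w (l b f).

Lemma balB_balanced (G : lmodType C) (u : Y -> F -> G) :
  balB u -> balanced (@Om_rlin C X Y) l u.
Proof.
case=> /bilin_balanced[uD uD' uZ] ub; split=> // b w f; exact: ub.
Qed.

Lemma liftB_pure (G : lmodType C) (u : Y -> F -> G) w f :
  balB u -> liftB u (pure w f) = u w f.
Proof. by move/balB_balanced => ub; rewrite /liftB tlift_pure. Qed.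

Lemma pureB_bal : balB pure.
Proof.
have [pD pD' pZ pS] := tpure_balanced (@Om_rlin C X Y) l.
split; last by move=> w b f; exact: pS.
split=> [f c x y|w c f g]; rewrite /pureB ?pD ?pD' -?pZ ?tpureZ //.
Qed.

Lemma liftB_lin (G : lmodType C) (u : Y -> F -> G) : balB u -> linear (liftB u : T -> G).
Proof.
move=> uB; have ub := balB_balanced uB; have [[ul _] _] := uB.
pose U : T -> G := liftB u.
have UD : {morph U : x y / x + y} by exact: (tliftD ub).
have U0 : U 0 = 0 by apply: (addrI (U 0)); rewrite -UD !addr0.
move=> c x y; rewrite -/U UD; congr (_ + _).
have [s ->] := tens_gen x; rewrite scaler_sumr !(big_morph U UD U0) scaler_sumr.
by apply: eq_bigr => p _; rewrite -tpureZ /U !liftB_pure // (linZ (ul _)).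
Qed.

Lemma tensB_ind (P : T -> Prop) : P 0 -> (forall x y, P x -> P y -> P (x + y)) ->
  (forall w f, P (pure w f)) -> forall x, P x.
Proof.
move=> P0 PD Pp x; have [s ->] := tens_gen x.
by elim/big_ind: _ => // p _; exact: Pp.
Qed.

Definition rightB (p : Y -> Y) : Prop :=
  linear p /\ forall w b, p (w * inB b) = p w * inB b.

Lemma mapB_bal (p : Y -> Y) : rightB p -> balB (fun w f => pure (p w) f).
Proof.
case=> pl pb; have [[b1 b2] b3] := pureB_bal.
by split=> [|w b f]; [split=> [f c x y|w]; [rewrite pl b1|exact: b2]|rewrite pb b3].
Qed.

Lemma mapB_pure (p : Y -> Y) w f : rightB p -> mapB p (pure w f) = pure (p w) f.
Proof. by move/mapB_bal => pb; rewrite /mapB liftB_pure. Qed.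

Lemma mapB_lin (p : Y -> Y) : rightB p -> linear (mapB p : T -> T).
Proof. by move/mapB_bal => pb; exact: liftB_lin. Qed.

Lemma bd_rightB a b : rightB (bd a b).
Proof. by split=> [|w c]; [exact: linear_fun|rewrite bd_inBr]. Qed.

Lemma deg_rightB k : rightB (@deg _ _ Y k).
Proof. by split=> [|w c]; [exact: linear_fun|rewrite deg_inBr]. Qed.

Lemma mull_rightB v : rightB (fun w : Y => v * w).
Proof. by split=> [c x y|w b]; rewrite ?mulrA // mulrDr -scalerAr. Qed.

Lemma gsign_rightB : rightB (@gsign _ _ Y).
Proof.
split=> [|w b]; first exact: gsign_lin.
rewrite /gsign mulr_suml; apply: eq_bigr => k _.
by rewrite deg_inBr mulrA.
Qed.

End TensorOverB.

(** * The Chern connection and its curvature, read through h *)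

Section Chern.
Variables (C : numClosedFieldType) (K : CQHHermitian C) (E : lineModule K).
Local Notation X := (cqh_space K).
Local Notation A := (hsA X).
Local Notation B := (coinv X).
Local Notation Y := (cqh_calc K).
Local Notation bd := (cqh_bd K).
Local Notation l := (@lm_l C K E).
Local Notation h := (@lm_form C K E).
Local Notation delta := (@lm_coact C K E).
Local Notation db := (@lm_delbar C K E).
Local Notation T := (tensB Y l).
Local Notation pure := (@pureB C X Y E l).

Let Eh : hermitian_relmod l (@lm_r C K E) delta h := lm_hermitian E.
Let Erel : is_relmod l (@lm_r C K E) delta. Proof. by case: Eh. Qed.

Let hl y : linear (h^~ y) := form_linl Eh y.
Let hb b x y : h (l b x) y = b * h x y := form_l Eh b x y.
Let hr b x y : h x (l b y) = h x y * bstar b := form_r Eh b x y.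
Let hs x y : h x y = bstar (h y x) := form_sym Eh x y.
Let inBl : linear (inB : B -> Y) := linear_fun inB.

(** The form h extended to E-valued forms in its first argument. With a frame these pairings
    separate points, which moves every identity from Om ⊗_B E into Om. *)
Definition pairing (x : T) (g : E) : Y := liftB (fun w f => w * inB (h f g)) x.

Lemma pairing_bal g : balB l (fun (w : Y) (f : E) => w * inB (h f g)).
Proof.
split; last by move=> w b f; rewrite hb rmorphM mulrA.
split=> [f c x y|w c x y]; first by rewrite mulrDl -scalerAl.
by rewrite hl inBl mulrDr -scalerAr.
Qed.

Lemma pairing_lin g : linear (pairing^~ g).
Proof. exact: (liftB_lin (pairing_bal g)). Qed.

Lemma pairing_pure w f g : pairing (pure w f) g = w * inB (h f g).
Proof. exact: (liftB_pure _ _ (pairing_bal g)). Qed.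

Lemma pairing_conj x (c : C) f g : pairing x (c *: f + g) = c^* *: pairing x f + pairing x g.
Proof.
elim/tensB_ind: x => [|x y Ex Ey|w e].
- by rewrite !(lin0 (pairing_lin _)) scaler0 addr0.
- by rewrite !(linD (pairing_lin _)) Ex Ey scalerDr addrACA.
- by rewrite !pairing_pure (form_conj Eh) inBl mulrDr -scalerAr.
Qed.

Lemma pairing_r x b g : pairing x (l b g) = pairing x g * inB (bstar b).
Proof.
elim/tensB_ind: x => [|x y Ex Ey|w e].
- by rewrite !(lin0 (pairing_lin _)) mul0r.
- by rewrite !(linD (pairing_lin _)) Ex Ey mulrDl.
- by rewrite !pairing_pure hr rmorphM mulrA.
Qed.

Lemma pairing_mapB (p : Y -> Y) x g : rightB p -> pairing (mapB p x) g = p (pairing x g).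
Proof.
move=> pR; have ml := mapB_lin (l := l) pR; have [pl pb] := pR.
elim/tensB_ind: x => [|x y Ex Ey|w e].
- by rewrite (lin0 ml) !(lin0 (pairing_lin _)) (lin0 pl).
- by rewrite (linD ml) !(linD (pairing_lin _)) Ex Ey (linD pl).
- by rewrite mapB_pure // !pairing_pure pb.
Qed.

Lemma form_ext_r x g : form_ext h x (pure 1 g) = pairing x g.
Proof.
rewrite /form_ext /pairing /liftB /tlift /psum; apply: eq_bigr => p _.
have ub : balanced (@Om_rlin C X Y) l (fun v g => p.1 * inB (h p.2 g) * ostar v).
  split=> [v v' w|v w w'|c v w|b v w].
  - by rewrite ostarD mulrDr.
  - have := form_conj Eh p.2 1 w w'; rewrite conjC1 !scale1r => ->.
    by rewrite (linD inBl) mulrDr mulrDl.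
  - have := form_conj Eh p.2 c w 0; rewrite addr0 => ->.
    have -> : h p.2 0 = 0.
      by rewrite hs (lin0 (hl _)); apply: (can_inj (@expectK _ X)); rewrite /= star0.
    by rewrite addr0 (linZ inBl) ostarZ -scalerAr -scalerAr scalerAl.
  - by rewrite /= ostar_inBr hr rmorphM !mulrA.
rewrite -/(psum (fun v g => p.1 * inB (h p.2 g) * ostar v) _) -/(tlift _ _) /pureB.
rewrite tlift_pure //.
have -> : ostar (1 : Y) = 1.
  have b1 : bstar 1 = 1 :> B by apply: (can_inj (@expectK _ X)); rewrite /= star1.
  have : ostar (inB 1 : Y) = inB (bstar 1) by exact: ostar_inB.
  by rewrite b1 !rmorph1.
by rewrite mulr1.
Qed.

Lemma form_ext_l f y : form_ext h (pure 1 f) y = ostar (pairing y f).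
Proof.
rewrite /form_ext liftB_pure.
  rewrite /pairing /liftB /tlift /psum ostar_sum; apply: eq_bigr => q _.
  by rewrite mul1r ostar_inBr -hs.
split.
  split=> [g c v w|w]; last first.
    have := sum_linear (repr y) (F := fun q g => w * inB (h g q.2) * ostar q.1).
    apply=> q c g g'; by rewrite hl inBl mulrDr mulrDl -scalerAr -scalerAl.
  rewrite /liftB /tlift /psum scaler_sumr -big_split; apply: eq_bigr => q _.
  by rewrite !mulrDl -!scalerAl.
move=> w b g; rewrite /liftB /tlift /psum; apply: eq_bigr => q _.
by rewrite hb rmorphM !mulrA.
Qed.

Definition gamma01 e g : Y := pairing (db e) g.
(** The value that h(nabla e, g) is forced to have: its (0,1)-part comes from the holomorphic
    structure, and the (1,0)-part of d h(e, g) = h(nabla e, g) + h(nabla g, e)^* then fixes the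
    rest. *)
Definition gamma e g : Y :=
  gamma01 e g + bd 1 0 (d (inB (h e g))) - ostar (gamma01 g e).

Let dbC : is_connection (bd 0 1) (delbar bd) db.
Proof. by case: (lm_holomorphic E) => _ [_ []]. Qed.

Lemma delbar_inB b : delbar bd (inB b : Y) = bd 0 1 (d (inB b)).
Proof. by rewrite (delbarE (Omab_inB b)). Qed.

Lemma gamma01_lin g : linear (gamma01^~ g).
Proof. by move=> c x y; have [dl _ _] := dbC; rewrite /gamma01 dl pairing_lin. Qed.

Lemma gamma01_conj e c f g : gamma01 e (c *: f + g) = c^* *: gamma01 e f + gamma01 e g.
Proof. exact: pairing_conj. Qed.

Lemma gamma01_l b e g :
  gamma01 (l b e) g = bd 0 1 (d (inB b)) * inB (h e g) + inB b * gamma01 e g.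
Proof.
have [_ _ dbM] := dbC; rewrite /gamma01 dbM (linD (pairing_lin _)) pairing_pure delbar_inB.
by rewrite (pairing_mapB _ _ (mull_rightB _)).
Qed.

Lemma gamma01_r b e g : gamma01 e (l b g) = gamma01 e g * inB (bstar b).
Proof. exact: pairing_r. Qed.

Lemma bd01_gamma01 e g : bd 0 1 (gamma01 e g) = gamma01 e g.
Proof.
have [_ dbP _] := dbC; rewrite /gamma01 -[in RHS]dbP.
by rewrite (pairing_mapB _ _ (bd_rightB K _ _)).
Qed.

Lemma d_inBM (a b : B) : d (inB (a * b) : Y) = d (inB a) * inB b + inB a * d (inB b).
Proof.
rewrite rmorphM d_mul (gsignE (Omab_deg (Omab_inB a))) expr0 mul1r //.
Qed.

Lemma gamma_lin g : linear (gamma^~ g).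
Proof.
move=> c x y; rewrite /gamma gamma01_lin hl inBl !linearP gamma01_conj ostar_lin conjCK.
by rewrite !scalerDr scalerN addrACA opprD [LHS]addrACA.
Qed.

Lemma gamma_conj e c f g : gamma e (c *: f + g) = c^* *: gamma e f + gamma e g.
Proof.
rewrite /gamma gamma01_lin (form_conj Eh) inBl !linearP gamma01_conj ostar_lin.
by rewrite !scalerDr scalerN addrACA opprD [LHS]addrACA.
Qed.

Lemma gamma_l b e g : gamma (l b e) g = d (inB b) * inB (h e g) + inB b * gamma e g.
Proof.
rewrite /gamma gamma01_l gamma01_r ostar_inBr bstarK hb d_inBM linearD /=.
rewrite bd_inBl bd_inBr [X in _ = X * _ + _]d_inB !mulrDl !mulrDr mulrN.
by rewrite addrACA [bd 0 1 _ * _ + _]addrC -addrA.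
Qed.

Lemma ostar_bd01 b : ostar (bd 0 1 (d (inB b : Y))) = bd 1 0 (d (inB (bstar b))).
Proof. by rewrite -bd_ostar ostar_d ostar_inB. Qed.

Lemma gamma_r b e g : gamma e (l b g) = gamma e g * inB (bstar b).
Proof.
rewrite /gamma gamma01_l gamma01_r hr d_inBM linearD /= bd_inBl bd_inBr.
rewrite ostarD ostar_inBr ostar_inBl -hs ostar_bd01 !mulrDl mulNr.
by rewrite addrA opprD [LHS]addrA addrK.
Qed.

Lemma bd01_gamma e g : bd 0 1 (gamma e g) = gamma01 e g.
Proof.
rewrite /gamma linearB linearD /= bd01_gamma01 (bd_proj (cqh_cplx K)) /= addr0.
by rewrite bd_ostar -(bd01_gamma01 g e) (bd_proj (cqh_cplx K)) /= ostar0 subr0.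
Qed.

Lemma gamma_bd e g : gamma e g = bd 1 0 (gamma e g) + bd 0 1 (gamma e g).
Proof.
rewrite bd01_gamma /gamma linearB linearD /= bdK.
rewrite -[in X in _ = _ + X](bd01_gamma01 e g) bd_ostar bd01_gamma01.
rewrite -{2}(bd01_gamma01 e g) (bd_proj (cqh_cplx K)) /= add0r.
by rewrite bd01_gamma01 -addrA addrC.
Qed.

Lemma deg1_gamma e g : deg 1 (gamma e g) = gamma e g.
Proof.
rewrite [gamma e g]gamma_bd linearD /= !deg_bd //=.
Qed.

Lemma d_form e g : d (inB (h e g)) = gamma e g + ostar (gamma g e).
Proof.
have E1 : ostar (bd 1 0 (d (inB (h g e) : Y))) = bd 0 1 (d (inB (h e g))).
  by rewrite -bd_ostar ostar_d ostar_inB -hs.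
rewrite /gamma !(ostarD, ostarN) E1 ostarK [LHS]d_inB.
by rewrite -[ostar _ + _ - _]addrA subrKA [RHS]addrC subrKA addrC.
Qed.

Section Frame.
Variables (N : nat) (u : 'I_N -> E) (t : 'I_N -> 'I_N -> A).
Hypothesis ut : forall i, delta (u i) = \sum_k t i k ⊗ u k.
Hypothesis tu : forall k m, \sum_i star (t i k) * t i m = (k == m)%:R.
Hypothesis uE : forall e, \sum_i l (h e (u i)) (u i) = e.

Let lb := lmod_bilin Erel.

Lemma frame_sum x : x = \sum_i pure (pairing x (u i)) (u i).
Proof.
have [[p1 p2] p3] := @pureB_bal C K E l.
elim/tensB_ind: x => [|x y Ex Ey|w f].
- by rewrite big1 // => i _; rewrite (lin0 (pairing_lin _)) (lin0 (p1 _)).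
- rewrite {1}Ex {1}Ey -big_split; apply: eq_bigr => i _ /=.
  by rewrite (linD (pairing_lin _)) (linD (p1 _)).
- rewrite -{1}(uE f) (lin_sum (p2 _)); apply: eq_bigr => i _.
  by rewrite pairing_pure p3.
Qed.

Lemma pairing_inj x y : (forall g, pairing x g = pairing y g) -> x = y.
Proof.
by move=> xy; rewrite [x]frame_sum [y]frame_sum; apply: eq_bigr => i _; rewrite xy.
Qed.

Lemma liftB_frame (G : lmodType C) (v : Y -> E -> G) x :
  balB l v -> liftB v x = \sum_i v (pairing x (u i)) (u i).
Proof.
move=> vb; rewrite {1}[x]frame_sum (lin_sum (liftB_lin vb)).
by apply: eq_bigr => i _; rewrite liftB_pure.
Qed.

Lemma sum_gamma_form e g : \sum_i gamma e (u i) * inB (h (u i) g) = gamma e g.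
Proof.
have gs (I : Type) (s : seq I) (a : I -> E) : gamma e (\sum_(i <- s) a i) = \sum_(i <- s) gamma e (a i).
  have gD x y : gamma e (x + y) = gamma e x + gamma e y.
    by have := gamma_conj e 1 x y; rewrite conjC1 !scale1r.
  have g0 : gamma e 0 = 0 by apply: (addrI (gamma e 0)); rewrite -gD !addr0.
  exact: (big_morph _ gD g0).
rewrite -{2}(uE g) gs; apply: eq_bigr => i _; by rewrite gamma_r -hs.
Qed.

(** The connection is reassembled from [gamma] along the frame, as sum_i gamma(e, u_i) ⊗ u_i; the
    axioms are checked after pairing with g. *)
Lemma chern_exists : exists nab, is_chern bd h db nab.
Proof.
have [[p1 p2] p3] := @pureB_bal C K E l.
pose nab e := \sum_i pure (gamma e (u i)) (u i).
have pn e g : pairing (nab e) g = gamma e g.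
  rewrite (lin_sum (pairing_lin _)) -sum_gamma_form.
  by apply: eq_bigr => i _; rewrite pairing_pure.
exists nab; split; [split|..].
- by apply: sum_linear => i c x y; rewrite gamma_lin p1.
- move=> e; apply: pairing_inj => g.
  by rewrite (pairing_mapB _ _ (deg_rightB K 1)) pn deg1_gamma.
- move=> b e; apply: pairing_inj => g.
  rewrite (linD (pairing_lin _)) pairing_pure (pairing_mapB _ _ (mull_rightB _)) !pn.
  exact: gamma_l.
- by move=> e g; rewrite form_ext_r form_ext_l !pn d_form.
- move=> e; apply: pairing_inj => g.
  by rewrite (pairing_mapB _ _ (bd_rightB K _ _)) pn bd01_gamma.
Qed.

Let nab : E -> T := @lm_chern C K E.

Lemma lm_chernP : is_chern bd h db nab.
Proof.
have [nab' nP] := chern_exists; rewrite /nab /lm_chern /chern.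
set Q := [set nabla | _].
by apply: (xgetPex (fun=> 0) (P := Q)); exists nab'.
Qed.

Lemma pairing_chern e g : pairing (nab e) g = gamma e g.
Proof.
have [[nl nd nM] nh n01] := lm_chernP.
have E01 f g' : bd 0 1 (pairing (nab f) g') = gamma01 f g'.
  by rewrite -(pairing_mapB _ _ (bd_rightB K _ _)) -n01.
have Ed : deg 1 (pairing (nab e) g) = pairing (nab e) g.
  by rewrite -(pairing_mapB _ _ (deg_rightB K 1)) nd.
rewrite -Ed (bd_sum (cqh_cplx K)) big_ord_recl big_ord1 /= E01.
rewrite [gamma e g]gamma_bd bd01_gamma addrC; congr (_ + _).
have := congr1 (bd 1 0) (nh e g); rewrite form_ext_r form_ext_l linearD /= bd_ostar E01.
rewrite d_form linearD /= bd_ostar bd01_gamma.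
by move/addIr => ->.
Qed.

Definition curv_form e g : Y := pairing (@lm_curvature C K E e) g.

Lemma gsign_star_bal g : balB l (fun (w : Y) (f : E) => gsign w * ostar (gamma g f)).
Proof.
have [gl gb] := gsign_rightB K.
split; last by move=> w b f; rewrite gb gamma_r ostar_inBr bstarK mulrA.
split=> [f c x y|w c x y]; first by rewrite gl mulrDl -scalerAl.
by rewrite gamma_conj ostar_lin conjCK mulrDr -scalerAr.
Qed.

Lemma gsign_gamma e g : gsign (gamma e g) = - gamma e g.
Proof. by rewrite (gsignE (deg1_gamma e g)) expr1 mulN1r. Qed.

(** Apply d to h(nabla e, g), written as a sum of terms w h(f, g). Metric compatibility splits d
    h(f, g): one half completes h(nabla^2 e, g), and the other, gamma(g, f)^*, is expanded along the
    frame. *)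
Lemma curv_formE e g :
  curv_form e g = d (gamma e g) + \sum_i gamma e (u i) * ostar (gamma g (u i)).
Proof.
rewrite /curv_form /lm_curvature /curvature -/nab.
rewrite -(pairing_chern e g).
have -> : \sum_i gamma e (u i) * ostar (gamma g (u i)) =
    - liftB (fun w f => gsign w * ostar (gamma g f)) (nab e).
  rewrite (liftB_frame _ (gsign_star_bal g)) -sumrN; apply: eq_bigr => i _.
  by rewrite pairing_chern gsign_gamma mulNr opprK.
rewrite {2}/pairing /liftB /tlift /psum (lin_sum (pairing_lin _)) linear_sum -sumrN -big_split.
apply: eq_bigr => p _ /=.
rewrite (linD (pairing_lin _)) pairing_pure (pairing_mapB _ _ (mull_rightB _)) pairing_chern.
by rewrite d_mul d_form [in RHS]mulrDr addrA addrK.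
Qed.

(** The star of a product of one-forms carries a sign, so the quadratic terms cancel; what remains
    is d d h(e, g) = 0. *)
Lemma curv_skew e g : curv_form e g + ostar (curv_form g e) = 0.
Proof.
rewrite !curv_formE ostarD ostar_sum.
have -> : \sum_i ostar (gamma g (u i) * ostar (gamma e (u i))) =
    - \sum_i gamma e (u i) * ostar (gamma g (u i)).
  rewrite -sumrN; apply: eq_bigr => i _.
  have d1 : deg 1 (ostar (gamma e (u i))) = ostar (gamma e (u i)).
    by rewrite deg_ostar deg1_gamma.
  by rewrite (ostar_mul (deg1_gamma g (u i)) d1) expr1 mulN1r ostarK.
rewrite addrACA subrr addr0 ostar_d -linearD /= -d_form; exact: d_d.
Qed.

Lemma curv_l b e g : curv_form (l b e) g = inB b * curv_form e g.
Proof.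
have d0 := gsignE (Omab_deg (Omab_inB b)).
have d1 : gsign (d (inB b : Y)) = - d (inB b).
  by rewrite (gsignE (d_deg (Omab_deg (Omab_inB b)))) expr1 mulN1r.
rewrite !curv_formE gamma_l linearD /= !d_mul d_d mul0r add0r d1 d0 expr0 mul1r.
under eq_bigr do rewrite gamma_l mulrDl.
rewrite big_split /= d_form.
have -> : \sum_i d (inB b) * inB (h e (u i)) * ostar (gamma g (u i)) =
    d (inB b) * ostar (gamma g e).
  rewrite -(sum_gamma_form g e) ostar_sum mulr_sumr; apply: eq_bigr => i _.
  by rewrite ostar_inBr -hs mulrA.
rewrite (eq_bigr (fun i => inB b * (gamma e (u i) * ostar (gamma g (u i))))); last first.
  by move=> i _; rewrite mulrA.
rewrite -mulr_sumr [RHS]mulrDr mulNr [d _ * (_ + _)](mulrDr (d (inB b))).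
by rewrite -[LHS]addrA [X in _ + X]addrACA addKr.
Qed.

Lemma curv_r b e g : curv_form e (l b g) = curv_form e g * inB (bstar b).
Proof.
have sk x y : curv_form x y = - ostar (curv_form y x).
  by apply/eqP; rewrite -addr_eq0 curv_skew.
by rewrite (sk e (l b g)) curv_l ostar_inBl (sk e g) mulNr.
Qed.

Lemma curv_lin g : linear (curv_form^~ g).
Proof.
move=> c x y; rewrite !curv_formE gamma_lin linearP.
under eq_bigr do rewrite gamma_lin mulrDl -scalerAl.
by rewrite big_split /= -scaler_sumr scalerDr addrACA.
Qed.

Lemma curv_conj e c f g : curv_form e (c *: f + g) = c^* *: curv_form e f + curv_form e g.
Proof.
have sk x y : curv_form x y = - ostar (curv_form y x).
  by apply/eqP; rewrite -addr_eq0 curv_skew.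
by rewrite (sk e (c *: f + g)) curv_lin ostar_lin (sk e f) (sk e g) scalerN opprD.
Qed.

(* The (0,2)-part of the curvature is the curvature of lm_delbar, which is flat. *)
Lemma curv_02 e g : bd 0 2 (curv_form e g) = 0.
Proof.
have delbar_lin : linear (delbar bd : Y -> Y).
  by apply: sum_linear => a; apply: sum_linear => b c x y; rewrite !linearP.
have delbarM w (b : B) : delbar bd (w * inB b) = delbar bd w * inB b + gsign w * bd 0 1 (d (inB b)).
  have gl := @gsign_lin C K.
  elim/bd_ind: w => [|x y Ex Ey|p q w wpq].
  - by rewrite mul0r !(lin0 delbar_lin) (lin0 gl) !mul0r addr0.
  - by rewrite mulrDl !(linD delbar_lin) Ex Ey (linD gl) !mulrDl addrACA.
  have wb : Omab bd p q (w * inB b) by rewrite /Omab /= bd_inBr wpq.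
  rewrite (delbarE wb) (delbarE wpq) d_mul linearD /= bd_inBr; congr (_ + _).
  have gw : Omab bd p q (gsign w).
    by rewrite (gsignE (Omab_deg wpq)) signZ; apply: OmabZ.
  by rewrite (bd_mull _ _ _ gw) leqnn leqnSn /= subnn subSnn.
(* Flatness of the holomorphic structure paired with g, computed as in [curv_formE] with d h(f, g)
   replaced by its (0,1)-part. *)
have flat : delbar bd (gamma01 e g) + \sum_i gamma01 e (u i) * ostar (bd 1 0 (gamma g (u i))) = 0.
  have gb : balB l (fun (w : Y) (f : E) => gsign w * ostar (bd 1 0 (gamma g f))).
    have [gl gb] := gsign_rightB K.
    split; last by move=> w b f; rewrite gb gamma_r bd_inBr ostar_inBr bstarK mulrA.
    split=> [f c x y|w c x y]; first by rewrite gl mulrDl -scalerAl.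
    by rewrite gamma_conj linearP ostar_lin conjCK mulrDr -scalerAr.
  have [_ [_ [_ dflat]] _] := lm_holomorphic E.
  have := congr1 (pairing^~ g) (dflat e); rewrite (lin0 (pairing_lin _)) => Eflat; rewrite -[RHS]Eflat.
  have -> : \sum_i gamma01 e (u i) * ostar (bd 1 0 (gamma g (u i))) =
      - liftB (fun w f => gsign w * ostar (bd 1 0 (gamma g f))) (db e).
    rewrite (liftB_frame _ gb) -sumrN; apply: eq_bigr => i _.
    rewrite -/(gamma01 e (u i)).
    have d1 : deg 1 (gamma01 e (u i)) = gamma01 e (u i).
      by rewrite -(bd01_gamma01 e (u i)) deg_bd.
    by rewrite (gsignE d1) expr1 mulN1r mulNr opprK.
  rewrite /curvature {1}/gamma01 {1}/pairing /liftB /tlift /psum.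
  rewrite (lin_sum (pairing_lin _)) (lin_sum delbar_lin) -sumrN -big_split.
  apply: eq_bigr => p _ /=.
  rewrite (linD (pairing_lin _)) pairing_pure (pairing_mapB _ _ (mull_rightB _)).
  rewrite delbarM d_form linearD /= bd01_gamma bd_ostar -/(gamma01 p.2 g).
  by rewrite [in LHS]mulrDr addrA addrK.
rewrite curv_formE linearD /= -[RHS]flat; congr (_ + _).
  have g01 := bd01_gamma01 e g.
  have -> : d (gamma e g) = d (bd 1 0 (gamma e g)) + d (gamma01 e g).
    by rewrite {1}[gamma e g]gamma_bd bd01_gamma linearD.
  rewrite [LHS]linearD /= (delbarE g01).
  by rewrite (d_bd _ _ (Omab_bd _ _ _)) /= addr0 add0r.
rewrite linear_sum; apply: eq_bigr => i _ /=.
rewrite [gamma e (u i)]gamma_bd bd01_gamma mulrDl linearD /=.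
rewrite (bd_mull _ _ _ (Omab_bd _ _ _)) /= add0r.
by rewrite (bd_mull _ _ _ (bd01_gamma01 _ _)) /= bd_ostar.
Qed.

Lemma deg_curv e g : deg 2 (curv_form e g) = curv_form e g.
Proof.
rewrite curv_formE linearD /= (d_deg (deg1_gamma e g)) linear_sum; congr (_ + _).
apply: eq_bigr => i _ /=; apply: (deg_mul (deg1_gamma e (u i))).
by rewrite deg_ostar deg1_gamma.
Qed.

(** Skewness exchanges the (2,0)-part with the vanishing (0,2)-part. *)
Lemma curv_11 e g : Omab bd 1 1 (curv_form e g).
Proof.
have sk x y : curv_form x y = - ostar (curv_form y x).
  by apply/eqP; rewrite -addr_eq0 curv_skew.
rewrite /Omab /= -[RHS]deg_curv (bd_sum (cqh_cplx K)) !big_ord_recl big_ord0 /= curv_02.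
by rewrite [in bd 2 0 _]sk linearN /= bd_ostar curv_02 ostar0 oppr0 !addr0 add0r.
Qed.

(** q is a comodule map on E tensored with its conjugate. All decompositions are allowed, so that
    the coaction of a frame vector can be expanded by the matrix t. *)
Definition equivariant (q : E -> E -> Y) : Prop := forall e g (s r : seq (A * E)),
  delta e = \sum_(p <- s) p.1 ⊗ p.2 -> delta g = \sum_(p <- r) p.1 ⊗ p.2 ->
  dL (q e g) = \sum_(x <- [seq (x, y) | x <- s, y <- r])
    (x.1.1 * star x.2.1) ⊗ q x.1.2 x.2.2.

Lemma equiv_form : equivariant (fun e g => inB (h e g)).
Proof.
move=> e g s r Es Er; set z := [seq _ | x <- s, y <- r].
have := dL_inB_rep (K := K) (b := h e g)
  (s := [seq (x.1.1 * star x.2.1, h x.1.2 x.2.2) | x <- z]).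
rewrite !big_map => -> //; rewrite (form_coact Eh Es Er).
by rewrite big_allpairs_dep.
Qed.

Lemma equiv_comp (q : E -> E -> Y) (f : Y -> Y) :
  (forall w (s : seq (A * Y)), dL w = \sum_(p <- s) p.1 ⊗ p.2 ->
    dL (f w) = \sum_(p <- s) p.1 ⊗ f p.2) ->
  equivariant q -> equivariant (fun e g => f (q e g)).
Proof.
move=> fP qe e g s r Es Er; set z := [seq _ | x <- s, y <- r].
have := fP (q e g) [seq (x.1.1 * star x.2.1, q x.1.2 x.2.2) | x <- z].
by rewrite !big_map => -> //; rewrite (qe _ _ _ _ Es Er).
Qed.

Lemma equiv_star (q : E -> E -> Y) : equivariant q -> equivariant (fun e g => ostar (q g e)).
Proof.
move=> qe e g s r Es Er.
have := dL_ostar_rep (K := K) (w := q g e)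
  (s := [seq (x.1.1 * star x.2.1, q x.1.2 x.2.2) | x <- [seq (x, y) | x <- r, y <- s]]).
rewrite !big_map => -> //; last exact: qe.
rewrite !big_allpairs_dep exchange_big; apply: eq_bigr => p _; apply: eq_bigr => p' _ /=.
by rewrite starM starK.
Qed.

Let pl : forall w : Y, linear (fun a : A => a ⊗ w) := (pureC_bilin A Y).1.
Let pr : forall a : A, linear (fun w : Y => a ⊗ w) := (pureC_bilin A Y).2.

Lemma equiv_add (q q' : E -> E -> Y) : equivariant q -> equivariant q' ->
  equivariant (fun e g => q e g + q' e g).
Proof.
move=> qe qe' e g s r Es Er; rewrite (linD (@dL_lin C K)) (qe _ _ _ _ Es Er) (qe' _ _ _ _ Es Er).
by rewrite -big_split; apply: eq_bigr => x _; rewrite /= -(linD (pr _)).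
Qed.

Lemma equiv_opp (q : E -> E -> Y) : equivariant q -> equivariant (fun e g => - q e g).
Proof.
move=> qe e g s r Es Er; rewrite (linN (@dL_lin C K)) (qe _ _ _ _ Es Er) -sumrN.
by apply: eq_bigr => x _; rewrite -(linN (pr _)).
Qed.

Lemma equiv_gamma01 : equivariant gamma01.
Proof.
move=> e g s r Es Er; have [_ _ dbE] := lm_holomorphic E.
(* Pairing with the coacted second argument reduces the claim to the holomorphic structure being a
   comodule map. *)
pose V (a : A) (y : T) : tensC A Y := \sum_(q <- r) (a * star q.1) ⊗ pairing y q.2.
have Vb : bilin V.
  split=> [y|a]; apply: sum_linear => q c x z.
    by rewrite mulrDl -scalerAl pl.
  by rewrite pairing_lin pr.
have [dbl _ _] := dbC.
have Vl := liftC_linear Vb.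
transitivity (liftC V (tensB_coact delta (db e))); last first.
  rewrite dbE Es mapC_eq // liftC_sum; last exact: bilin_balanced.
  rewrite big_allpairs_dep; apply: eq_bigr => p _.
  by rewrite liftC_pure //; exact: bilin_balanced.
rewrite /tensB_coact /gamma01 /pairing /liftB {1}/tlift {1}/psum [X in liftC V X]/tlift /psum.
rewrite (lin_sum (@dL_lin C K)) (lin_sum Vl); apply: eq_bigr => p _.
have [pb _] := @pureB_bal C K E l.
have := map2C_eq (repr (dL p.1)) (repr (delta p.2)) (@mul_bilin C A) pb.
rewrite -!tensCE => ->; rewrite (lin_sum Vl).
have hE : dL (inB (h p.2 g) : Y) = \sum_(z <- [seq (x.1.1 * star x.2.1, inB (h x.1.2 x.2.2) : Y) |
    x <- [seq (x, y) | x <- repr (delta p.2), y <- r]]) z.1 ⊗ z.2.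
  by rewrite big_map; exact: (equiv_form (tensCE (delta p.2)) Er).
rewrite (dL_mul_rep (tensCE (dL p.1)) hE); apply: eq_bigr => a _.
rewrite big_map big_allpairs_dep (lin_sum Vl); apply: eq_bigr => b _.
rewrite liftC_pure; last exact: bilin_balanced.
by apply: eq_bigr => q _ /=; rewrite pairing_pure !mulrA.
Qed.

Lemma equiv_gamma : equivariant gamma.
Proof.
apply: equiv_add; last by apply/equiv_opp/equiv_star/equiv_gamma01.
apply: equiv_add; first exact: equiv_gamma01.
apply: (equiv_comp (f := fun w => bd 1 0 (d w))) equiv_form => w s Ew.
have := dL_bd_rep 1 0 (w := d w) (s := [seq (p.1, d p.2) | p <- s]).
by rewrite !big_map (dL_d_rep Ew) => ->.
Qed.

(** The coactions of the two copies of u_i contribute star(t_ik) t_im between the outer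
    coefficients; summed over i these are Kronecker deltas. This is where the unitarity of the frame
    is used. *)
Lemma equiv_contract (q q' : E -> E -> Y) : equivariant q -> equivariant q' ->
  equivariant (fun e g => \sum_i q e (u i) * ostar (q' g (u i))).
Proof.
move=> qe qe' e g s r Es Er.
pose ur i := [seq (t i k, u k) | k <- index_enum 'I_N].
have Eu i : delta (u i) = \sum_(p <- ur i) p.1 ⊗ p.2 by rewrite big_map ut.
have qs := equiv_star qe'.
have Ei i : dL (q e (u i) * ostar (q' g (u i))) =
    \sum_(p <- s) \sum_k \sum_(p' <- r) \sum_m
      (p.1 * (star (t i k) * t i m) * star p'.1) ⊗ (q p.2 (u k) * ostar (q' p'.2 (u m))).
  pose z1 := [seq (x.1.1 * star x.2.1, q x.1.2 x.2.2) | x <- [seq (x, y) | x <- s, y <- ur i]].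
  pose z2 := [seq (x.1.1 * star x.2.1, ostar (q' x.2.2 x.1.2)) | x <- [seq (x, y) | x <- ur i, y <- r]].
  have E1 : dL (q e (u i)) = \sum_(p <- z1) p.1 ⊗ p.2.
    by rewrite big_map; exact: (qe _ _ _ _ Es (Eu i)).
  have E2 : dL (ostar (q' g (u i))) = \sum_(p <- z2) p.1 ⊗ p.2.
    by rewrite big_map; exact: (qs _ _ _ _ (Eu i) Er).
  rewrite (dL_mul_rep E1 E2) big_map big_allpairs_dep; apply: eq_bigr => p _.
  rewrite big_map; apply: eq_bigr => k _.
  rewrite big_map big_allpairs_dep big_map exchange_big; apply: eq_bigr => p' _.
  by apply: eq_bigr => m _ /=; rewrite !mulrA.
rewrite (lin_sum (@dL_lin C K)); under eq_bigr do rewrite Ei.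
rewrite exchange_big big_allpairs_dep; apply: eq_bigr => p _ /=.
rewrite exchange_big /=; under eq_bigr do rewrite exchange_big /=.
rewrite exchange_big; apply: eq_bigr => p' _ /=.
rewrite (lin_sum (pr _)); apply: eq_bigr => k _; rewrite exchange_big (bigD1 k) //=.
have Es' m : \sum_i (p.1 * (star (t i k) * t i m) * star p'.1) ⊗ (q p.2 (u k) * ostar (q' p'.2 (u m)))
    = (p.1 * (k == m)%:R * star p'.1) ⊗ (q p.2 (u k) * ostar (q' p'.2 (u m))).
  by rewrite -(lin_sum (pl _)) -mulr_suml -mulr_sumr tu.
rewrite Es' eqxx mulr1 big1 ?addr0 // => m mk.
by rewrite Es' eq_sym (negPf mk) mulr0 mul0r (lin0 (pl _)).
Qed.

Lemma equiv_curv : equivariant curv_form.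
Proof.
have E0 : curv_form = fun e g => d (gamma e g) + \sum_i gamma e (u i) * ostar (gamma g (u i)).
  by apply/funext => e; apply/funext => g; exact: curv_formE.
rewrite E0; apply: equiv_add; last by apply: equiv_contract; exact: equiv_gamma.
by apply: equiv_comp equiv_gamma => w s; exact: dL_d_rep.
Qed.

End Frame.

End Chern.

(** * Coinvariant forms *)

Section Coinvariant.
Variables (C : numClosedFieldType) (K : CQHHermitian C).
Local Notation X := (cqh_space K).
Local Notation A := (hsA X).
Local Notation B := (coinv X).
Local Notation Y := (cqh_calc K).
Local Notation bd := (cqh_bd K).
Implicit Types w v x y : Y.

Definition Om_fibre (U : lmodType C) (f : Y -> U) : Prop :=
  linear f /\ forall y, BplusL (@Om_l _ _ Y) setT y -> f y = 0.

Lemma Om_fibre_l (U : lmodType C) (f : Y -> U) b w :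
  Om_fibre f -> f (inB b * w) = epsB b *: f w.
Proof.
case=> fl f0; have il := linear_fun (@inB _ _ Y).
have bE : b = (b - epsB b *: 1) + epsB b *: 1 by rewrite subrK.
rewrite {1}bE (linD il) (linZ il) rmorph1 mulrDl -scalerAl mul1r (linD fl) (linZ fl).
rewrite [X in X + _]f0 ?add0r //; exists [:: (b - epsB b *: 1, w)]; split; last by rewrite big_seq1.
move=> _ /[1!inE] /eqP ->; split=> //=; rewrite /Bplus -/(epsB _).
have el := @eps_lin C X; rewrite (linB el) (linZ el).
have -> : epsB (1 : B) = 1 by exact: (rmorph1 counit).
by rewrite [_ *: _]mulr1 subrr.
Qed.

(** The condition B^+ Om = Om B^+ makes the right action on the fibre factor through the counit as
    well. *)
Lemma Om_fibre_r (U : lmodType C) (f : Y -> U) b w :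
  Om_fibre f -> f (w * inB b) = epsB b *: f w.
Proof.
case=> fl f0; have il := linear_fun (@inB _ _ Y).
have bE : b = (b - epsB b *: 1) + epsB b *: 1 by rewrite subrK.
rewrite {1}bE (linD il) (linZ il) rmorph1 mulrDr -scalerAr mulr1 (linD fl) (linZ fl).
have [_ _ _ _ LR] := cqh_relmod K.
rewrite [X in X + _]f0 ?add0r // LR; exists [:: (w, b - epsB b *: 1)]; split; last by rewrite big_seq1.
move=> _ /[1!inE] /eqP ->; split=> //=; rewrite /Bplus -/(epsB _).
have el := @eps_lin C X; rewrite (linB el) (linZ el).
have -> : epsB (1 : B) = 1 by exact: (rmorph1 counit).
by rewrite [_ *: _]mulr1 subrr.
Qed.

Lemma Om_takeuchi w (s : seq (A * Y)) : dL w = \sum_(p <- s) p.1 ⊗ p.2 ->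
  (forall p, p \in s -> forall (U : lmodType C) (f : Y -> U), Om_fibre f -> f p.2 = 0) -> w = 0.
Proof.
move=> Es sP; apply: (takeuchi_faithful (cqh_relmod K) Es) => p ps U f fl f0.
exact: sP ps _ _ (conj fl f0).
Qed.

Definition coinvar x := dL x = 1 ⊗ x.

(** The coaction of the commutator is b_(1) ⊗ (x b_(2) - b_(2) x), and on the fibre b_(2) acts by
    the same scalar from either side. *)
Lemma coinvar_comm_inB x b : coinvar x -> x * inB b = inB b * x.
Proof.
move=> cx; apply/eqP; rewrite -subr_eq0; apply/eqP.
have [pl pr] := pureC_bilin A Y.
have Eb : dL (inB b : Y) = \sum_(p <- [seq (p.1, inB p.2 : Y) | p <- repr (coB b)]) p.1 ⊗ p.2.
  by rewrite big_map; exact: (dL_inB_rep (tensCE (coB b))).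
have Ex : dL x = \sum_(p <- [:: (1, x)]) p.1 ⊗ p.2 by rewrite big_seq1.
apply: (@Om_takeuchi _ [seq (p.1, x * inB p.2 - inB p.2 * x) | p <- repr (coB b)]).
  rewrite (linB (@dL_lin C K)) (dL_mul_rep Ex Eb) (dL_mul_rep Eb Ex) big_seq1 !big_map -sumrB.
  by apply: eq_bigr => p _ /=; rewrite big_seq1 mul1r mulr1 (linB (pr _)).
move=> _ /mapP[p _ ->] U f ff /=; have [fl _] := ff.
by rewrite (linB fl) Om_fibre_l // Om_fibre_r // subrr.
Qed.

Lemma coinvar_d x : coinvar x -> coinvar (d x).
Proof.
move=> cx; have Ex : dL x = \sum_(p <- [:: (1, x)]) p.1 ⊗ p.2 by rewrite big_seq1.
by rewrite /coinvar (dL_d_rep Ex) big_seq1.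
Qed.

(* Both x and d x commute with B, and d [x, b] = [d x, b] + [x, d b]. *)
Lemma coinvar_central x : coinvar x -> deg 2 x = x -> forall w, x * w = w * x.
Proof.
move=> cx x2 w; pose S : set Y := [set w | x * w = w * x].
suff ST : S = setT by have : S w by rewrite ST.
apply: calc_gen => [|v y|b|b]; rewrite /S /=.
- split=> [|c v y] /=; first by rewrite mulr0 mul0r.
  by move=> Sv Sy; rewrite mulrDr mulrDl Sy -scalerAl -scalerAr Sv.
- by move=> Sv Sy; rewrite mulrA Sv -mulrA Sy mulrA.
- exact: coinvar_comm_inB.
have := congr1 d (coinvar_comm_inB b cx).
rewrite !d_mul (gsignE x2) (gsignE (Omab_deg (Omab_inB b))) expr0 mul1r.
rewrite -(coinvar_comm_inB b (coinvar_d cx)) addrC sqrrN expr1n mul1r.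
by move/addIr.
Qed.

(** * Equivariant sesquilinear maps on a line module *)

Section LineCurvature.
Variable E : lineModule K.
Local Notation l := (@lm_l C K E).
Local Notation h := (@lm_form C K E).
Local Notation delta := (@lm_coact C K E).
Variable R : E -> E -> Y.
Hypothesis R_lin : forall g, linear (R^~ g).
Hypothesis R_conj : forall e c f g, R e (c *: f + g) = c^* *: R e f + R e g.
Hypothesis R_l : forall b e g, R (l b e) g = inB b * R e g.
Hypothesis R_r : forall b e g, R e (l b g) = R e g * inB (bstar b).
Hypothesis R_equiv : equivariant R.

Let Eh := lm_hermitian E.

(** The exchange rule R(e, g) h(x, y) = h(e, g) R(x, y) is summed over pairs (x, y) with sum h(x, y)
    = 1, which exist by [form_full]; rho is the matching sum of R(x, y). *)
Lemma line_twist : exists rho, [/\ coinvar rho, forall e g, R e g = inB (h e g) * rho &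
  exists s : seq (E * E), rho = \sum_(p <- s) R p.1 p.2].
Proof.
have [phi [e0 [phil phi1 phi0 phiU]]] := quotm_dim1 (lm_line E).
have Rf (U : lmodType C) (f : Y -> U) e g : Om_fibre f ->
    f (R e g) = (phi e * (phi g)^*) *: f (R e0 e0).
  move=> ff; have [fl f0] := ff.
  have -> : f (R e g) = phi e *: f (R e0 g).
    apply: (phiU _ (fun e => f (R e g))) => [c a a'|_ [s [sB ->]]].
      by rewrite R_lin fl.
    rewrite (lin_sum (R_lin g)) (lin_sum fl) big_seq big1 // => p ps.
    by rewrite R_l Om_fibre_l // /epsB (sB p ps).1 scale0r.
  rewrite -scalerA; congr (_ *: _).
  (* The second argument is conjugate-linear, so the universal property of phi is applied with
     values in the conjugate space. *)
  apply: (phiU (conjmod U) (fun g => f (R e0 g))) => [c a a'|_ [s [sB ->]]].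
    by rewrite R_conj fl.
  have RD (x y : E) : R e0 (x + y) = R e0 x + R e0 y.
    by have := R_conj e0 1 x y; rewrite conjC1 !scale1r.
  have R0 : R e0 0 = 0 by apply: (addrI (R e0 0)); rewrite -RD !addr0.
  rewrite (big_morph _ RD R0) (lin_sum fl) big_seq big1 // => p ps.
  by rewrite R_r Om_fibre_r // /epsB counit_bstar (sB p ps).1 conjC0 scale0r.
(* Both terms are equivariant in all four arguments and become the same scalar multiple of the class
   of R(e0, e0) on the fibre. *)
pose K4 (e g x y : E) := inB (h e g) * R x y - R e g * inB (h x y).
have K40 (e g x y : E) : K4 e g x y = 0.
  pose S1 := [seq (p, q) | p <- repr (delta e), q <- repr (delta g)].
  pose S2 := [seq (p, q) | p <- repr (delta x), q <- repr (delta y)].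
  pose cf (z : (A * E) * (A * E)) := z.1.1 * star z.2.1.
  have Eq (q : E -> E -> Y) a b : equivariant q ->
      dL (q a b) = \sum_(z <- [seq (cf z, q z.1.2 z.2.2) |
        z <- [seq (p, q) | p <- repr (delta a), q <- repr (delta b)]]) z.1 ⊗ z.2.
    by move=> qe; rewrite big_map; exact: (qe _ _ _ _ (tensCE (delta a)) (tensCE (delta b))).
  have Efm := @equiv_form _ _ E.
  have [pl pr] := pureC_bilin A Y.
  apply: (@Om_takeuchi _ [seq (cf z.1 * cf z.2, K4 z.1.1.2 z.1.2.2 z.2.1.2 z.2.2.2) |
      z <- [seq (z1, z2) | z1 <- S1, z2 <- S2]]).
    rewrite (linB (@dL_lin C K)).
    rewrite (dL_mul_rep (Eq _ e g Efm) (Eq _ x y R_equiv)).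
    rewrite (dL_mul_rep (Eq _ e g R_equiv) (Eq _ x y Efm)).
    rewrite -/S1 -/S2 !big_map -sumrB [RHS]big_allpairs_dep; apply: eq_bigr => z1 _.
    rewrite !big_map -sumrB; apply: eq_bigr => z2 _ /=.
    by rewrite (linB (pr _)).
  move=> _ /mapP[z _ ->] U f ff /=; have [fl _] := ff.
  rewrite (linB fl) (Om_fibre_l _ _ ff) (Om_fibre_r _ _ ff).
  rewrite (Rf _ _ z.1.1.2 z.1.2.2 ff).
  rewrite (Rf _ _ z.2.1.2 z.2.2.2 ff).
  rewrite (eps_form Eh phiU z.1.1.2) (eps_form Eh phiU z.2.1.2).
  rewrite !scalerA -scalerBl.
  by rewrite [X in X *: _](_ : _ = 0) ?scale0r //; ring.
have [s sE] := form_full Eh phil phi1 phiU.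
have hR (e g x y : E) : R e g * inB (h x y) = inB (h e g) * R x y.
  by apply/eqP; rewrite eq_sym -subr_eq0; apply/eqP; exact: K40.
pose rho := \sum_(p <- s) R p.1 p.2.
have Rrho e g : R e g = inB (h e g) * rho.
  rewrite mulr_sumr; under eq_bigr do rewrite -hR.
  by rewrite -mulr_sumr -rmorph_sum sE rmorph1 mulr1.
exists rho; split=> //; last by exists s.
rewrite /coinvar.
have rl : linear (fun w => w * rho) by move=> c x y; rewrite mulrDl -scalerAl.
have ml := mapC_linear (@idfun_lin _ A) rl.
(* The coaction of rho is that of sum h = 1 with second legs multiplied by rho, because R = h rho on
   every leg. *)
transitivity (mapC idfun (fun w => w * rho) (dL (inB (\sum_(p <- s) h p.1 p.2) : Y))).
  rewrite rmorph_sum !(lin_sum (@dL_lin C K)) (lin_sum ml); apply: eq_bigr => p _.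
  have Efm := @equiv_form _ _ E.
  rewrite (R_equiv (tensCE _) (tensCE _)) (Efm _ _ _ _ (tensCE _) (tensCE _)).
  rewrite (lin_sum ml); apply: eq_bigr => z _.
  by rewrite mapC_pure // Rrho.
by rewrite sE rmorph1 dL1 mapC_pure // mul1r.
Qed.

End LineCurvature.
End Coinvariant.

(** * Lefschetz and Hodge maps *)

Section Lefschetz.
Variables (C : numClosedFieldType) (K : CQHHermitian C).
Local Notation X := (cqh_space K).
Local Notation A := (hsA X).
Local Notation B := (coinv X).
Local Notation Y := (cqh_calc K).
Local Notation bd := (cqh_bd K).
Local Notation n := (half_dim K).
Local Notation kap := (kappa K).
Implicit Types w v x y : Y.

Let HK := cqh_hermitian K.

Lemma iter_lef k w : iter k (lefschetz kap) w = kap ^+ k * w.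
Proof.
elim: k => [|k IH]; first by rewrite expr0 mul1r.
by rewrite iterS IH /lefschetz exprS mulrA.
Qed.

Lemma kap_central k w : kap ^+ k * w = w * kap ^+ k.
Proof.
elim: k => [|k IH]; first by rewrite expr0 mul1r mulr1.
by rewrite exprS -mulrA IH mulrA (hs_central HK) -mulrA -exprS.
Qed.

Lemma kap_Omab k : Omab bd k k (kap ^+ k).
Proof.
elim: k => [|k IH].
  by rewrite expr0 -(rmorph1 (@inB _ _ Y)); exact: Omab_inB.
rewrite exprS; exact: (bd_mul (cqh_cplx K) (hs_bidegree HK) IH).
Qed.

Lemma ostar_kap k w : ostar (kap ^+ k * w) = kap ^+ k * ostar w.
Proof.
elim: k w => [|k IH] w; first by rewrite !expr0 !mul1r.
rewrite exprS -mulrA.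
have E1 v : ostar (kap * v) = kap * ostar v.
  elim/bd_ind: v => [|x y Ex Ey|a b v vab]; first by rewrite mulr0 ostar0 mulr0.
    by rewrite mulrDr !ostarD Ex Ey mulrDr.
  rewrite (ostar_mul (Omab_deg (hs_bidegree HK)) (Omab_deg vab)) (hs_real HK).
  by rewrite exprM sqrrN expr1n expr1n mul1r (hs_central HK).
by rewrite E1 IH mulrA -exprS.
Qed.

Lemma bd_kap k p q w : bd (k + p) (k + q) (kap ^+ k * w) = kap ^+ k * bd p q w.
Proof. by rewrite (bd_mull _ _ _ (kap_Omab k)) !leq_addr !addKn. Qed.

Lemma lef_inj k w v : (k < n)%N -> deg k w = w -> deg k v = v ->
  kap ^+ (n - k) * w = kap ^+ (n - k) * v -> w = v.
Proof.
move=> kn wk vk; rewrite -!iter_lef; have [_ ij _] := hs_lefschetz HK kn.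
by apply: ij; rewrite inE.
Qed.

Lemma lef_surj k w : (k < n)%N -> deg (n.*2 - k) w = w ->
  exists2 v, deg k v = v & kap ^+ (n - k) * v = w.
Proof.
move=> kn wk; have [_ _ sj] := hs_lefschetz HK kn.
by have [v vk <-] := sj w wk; exists v => //; rewrite iter_lef.
Qed.

Lemma top_form w : deg n.*2 w = w -> exists b, w = kap ^+ n * inB b.
Proof.
move=> w2; have := lef_surj (half_dim_gt0 K); rewrite !subn0 => /(_ w w2)[v v0 <-].
by have /inB_deg0[b ->] := v0; exists b.
Qed.

Lemma toBK b : toB (inB b : Y) = b.
Proof.
rewrite /toB; set Q := [set _ | _].
have : Q (xget 0 Q) by apply: (xgetPex 0 (P := Q)); exists b.
exact: inB_inj.
Qed.

Lemma toB0 : toB (0 : Y) = 0.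
Proof. by rewrite -[X in toB X](lin0 (linear_fun (@inB _ _ Y))) toBK. Qed.

Local Notation hstar := (hodge bd n kap).

(** If no Hodge map existed, [hodge] would be its default 0 and the metric would vanish,
    contradicting positivity at the form 1. *)
Lemma hodgeP : is_hodge bd n kap hstar.
Proof.
have [[s sP]|no] := pselect (exists s, is_hodge bd n kap s).
  by rewrite /hodge; set Q := [set _ | _]; apply: (xgetPex (fun=> 0) (P := Q)); exists s.
have h0 : hstar = fun=> 0.
  by apply: xgetPN => s sP; apply: no; exists s.
have [_] := hm_pos (cqh_metric K) (oner_neq0 Y); case.
by rewrite /metric big1 ?toB0 // => k _; rewrite h0.
Qed.

Lemma hodgeD w v : hstar (w + v) = hstar w + hstar v. Proof. by case: hodgeP. Qed.

Lemma hodge0 : hstar 0 = 0.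
Proof. by apply: (addrI (hstar 0)); rewrite -hodgeD !addr0. Qed.

Lemma hodgeZ (c : C) w : hstar (c *: w) = c *: hstar w.
Proof.
have [_ hB _ _] := hodgeP.
have := hB (c *: 1) w; rewrite (linZ (linear_fun (@inB _ _ Y))) rmorph1.
by rewrite -!scalerAl !mul1r.
Qed.

Lemma metricE k w v : (k <= cdim Y)%N -> deg k w = w -> deg k v = v ->
  metric bd n kap w v = toB (hstar (w * hstar (ostar v))).
Proof.
move=> lk wk vk; rewrite /metric; have lk' : (k < (cdim Y).+1)%N by [].
rewrite (bigD1 (Ordinal lk')) //= wk vk big1 ?addr0 // => i ik.
have -> : deg i w = 0.
  by rewrite -wk deg_proj ifF //; apply/negbTE; rewrite -(inj_eq val_inj) in ik.
by rewrite mul0r hodge0.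
Qed.

Lemma coinvar_kap : coinvar kap. Proof. exact: cqh_coinvariant. Qed.

Lemma coinvarM x y : coinvar x -> coinvar y -> coinvar (x * y).
Proof.
move=> cx cy; rewrite /coinvar.
have Ex : dL x = \sum_(p <- [:: (1, x)]) p.1 ⊗ p.2 by rewrite big_seq1.
have Ey : dL y = \sum_(p <- [:: (1, y)]) p.1 ⊗ p.2 by rewrite big_seq1.
by rewrite (dL_mul_rep Ex Ey) !big_seq1 mul1r.
Qed.

Lemma coinvar_kapX k : coinvar (kap ^+ k).
Proof.
elim: k => [|k IH]; first by rewrite expr0 /coinvar dL1.
by rewrite exprS; apply: coinvarM => //; exact: coinvar_kap.
Qed.

Lemma coinvar_ml x w s : coinvar x -> dL w = \sum_(p <- s) p.1 ⊗ p.2 ->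
  dL (x * w) = \sum_(p <- s) p.1 ⊗ (x * p.2).
Proof.
move=> cx Es; have Ex : dL x = \sum_(p <- [:: (1, x)]) p.1 ⊗ p.2 by rewrite big_seq1.
rewrite (dL_mul_rep Ex Es) big_seq1; apply: eq_bigr => p _; by rewrite mul1r.
Qed.

Lemma coinvar_mr x w s : coinvar x -> dL w = \sum_(p <- s) p.1 ⊗ p.2 ->
  dL (w * x) = \sum_(p <- s) p.1 ⊗ (p.2 * x).
Proof.
move=> cx Es; have Ex : dL x = \sum_(p <- [:: (1, x)]) p.1 ⊗ p.2 by rewrite big_seq1.
rewrite (dL_mul_rep Es Ex); apply: eq_bigr => p _; by rewrite big_seq1 mulr1.
Qed.

(* A form which annihilates Om^(1,0) and is central annihilates Om^(1,1), since
   the calculus is generated by B, Om^(1,0) and Om^(0,1). *)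
Lemma annihilator_11 a b x : Omab bd a b x -> (forall w, x * w = w * x) ->
  (forall w, Omab bd 1 0 w -> x * w = 0) -> forall w, Omab bd 1 1 w -> x * w = 0.
Proof.
move=> xab xc x0 w w11.
pose Z w0 := forall p q, (0 < p)%N -> bd p q w0 = 0.
(* S consists of the forms congruent to one of type (0,q) modulo the annihilator of x; centrality of
   x makes it closed under products. *)
pose S : set Y := [set w | exists2 w0, Z w0 & x * w = x * w0].
have ZE w0 : Z w0 -> w0 = \sum_(k < (cdim Y).+1) bd 0 k w0.
  move=> w00; rewrite {1}[w0]bd_total; apply: eq_bigr => k _.
  by rewrite big_ord_recl subn0 big1 ?addr0 // => i _; rewrite w00.
have ZM w0 v0 : Z w0 -> Z v0 -> Z (w0 * v0).
  move=> Zw Zv p q p0; rewrite (ZE w0 Zw) mulr_suml linear_sum big1 // => k _ /=.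
  by rewrite (bd_mull _ _ _ (Omab_bd _ _ _)) /= subn0 (Zv _ _ p0) mulr0 if_same.
have ST : S = setT.
  apply: calc_gen => [|u v [u0 Zu Eu] [v0 Zv Ev]|c|c].
  - split; first by exists 0 => // p q _; rewrite linear0.
    move=> c u v [u0 Zu Eu] [v0 Zv Ev]; exists (c *: u0 + v0).
      by move=> p q p0; rewrite linearP Zu // Zv // scaler0 addr0.
    by rewrite !mulrDr -!scalerAr Eu Ev.
  - exists (u0 * v0); first exact: ZM.
    by rewrite mulrA Eu xc -mulrA Ev mulrA -xc mulrA.
  - by exists (inB c) => // p q p0; rewrite (bd_Omab _ _ (Omab_inB c)); case: p p0.
  - exists (bd 0 1 (d (inB c))).
      by move=> p q p0; rewrite (bd_Omab _ _ (Omab_bd _ _ _)); case: p p0.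
    by rewrite {1}d_inB mulrDr x0 ?add0r //; exact: Omab_bd.
have [w0 Zw0 E] : S w by rewrite ST.
rewrite -(bd_mul (cqh_cplx K) xab w11) E (bd_mull _ _ _ xab).
by rewrite !leq_addr !addKn Zw0 // mulr0.
Qed.

End Lefschetz.

(** * Irreducibility *)

Section Irreducible.
Variables (C : numClosedFieldType) (K : CQHHermitian C).
Hypothesis K_irr : is_irreducible K.
Local Notation X := (cqh_space K).
Local Notation A := (hsA X).
Local Notation B := (coinv X).
Local Notation Y := (cqh_calc K).
Local Notation bd := (cqh_bd K).
Local Notation n := (half_dim K).
Local Notation kap := (kappa K).
Local Notation M := (Omab bd 1 0).
Implicit Types w v x y : Y.

(** * Schur's lemma for Om^(1,0) *)

Section Endomorphism.
Variable T : Y -> Y.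
Hypothesis T_lin : linear T.
Hypothesis T_l : forall b w, T (inB b * w) = inB b * T w.
Hypothesis T_r : forall b w, T (w * inB b) = T w * inB b.
Hypothesis T_M : forall w, M w -> M (T w).
Hypothesis T_co : forall w s, M w -> dL w = \sum_(p <- s) p.1 ⊗ p.2 ->
  (forall p, p \in s -> M p.2) -> dL (T w) = \sum_(p <- s) p.1 ⊗ T p.2.

Let op c w := T w - c *: w.

Let op_lin c : linear (op c).
Proof. by move=> a x y; rewrite /op T_lin; rewrite scalerDr scalerBr opprD addrACA !scalerA [c * a]GRing.mulrC. Qed.

Let op_l c b w : op c (inB b * w) = inB b * op c w.
Proof. by rewrite /op T_l mulrBr scalerAr. Qed.

Let op_r c b w : op c (w * inB b) = op c w * inB b.
Proof. by rewrite /op T_r mulrBl scalerAl. Qed.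

Let op_M c w : M w -> M (op c w).
Proof.
by move=> Mw; rewrite /op addrC -scaleNr; apply: OmabP => //; exact: T_M.
Qed.

Definition op_img c : set Y := [set y | exists2 w, M w & y = op c w].

Let M_sub : is_subobject (@Om_l _ _ Y) (@Om_r _ _ Y) (@dL _ _ Y) M.
Proof. by case: K_irr. Qed.

(** To exchange B^+ N and N B^+ for the image N, an element is lifted to M, rewritten there by the
    same property of M, and mapped back. *)
Lemma op_img_sub c : is_subobject (@Om_l _ _ Y) (@Om_r _ _ Y) (@dL _ _ Y) (op_img c).
Proof.
have [_ _ [m [g [gM gE]]] LR] := M_sub.
have ol := op_lin c.
split.
- split.
    split; first by exists 0; [exact: Omab0|rewrite (lin0 ol)].
    move=> a _ _ [w Mw ->] [v Mv ->]; exists (a *: w + v); first exact: OmabP.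
    by rewrite ol.
  move=> _ [w Mw ->]; have [s Es sM] := dL_rep_Omab Mw.
  exists [seq (p.1, op c p.2) | p <- s]; split.
    by move=> _ /mapP[p ps ->]; exists p.2 => //; exact: sM.
  have [pl pr] := pureC_bilin A Y.
  rewrite big_map /op (linB (@dL_lin C K)) (linZ (@dL_lin C K)) (T_co Mw Es sM) Es.
  rewrite scaler_sumr -sumrB; apply: eq_bigr => p _ /=.
  by rewrite (linB (pr _)) (linZ (pr _)).
- move=> b _ [w Mw ->]; split.
    by exists (inB b * w); rewrite ?op_l // /Omab /= bd_inBl Mw.
  by exists (w * inB b); rewrite ?op_r // /Omab /= bd_inBr Mw.
- exists m, (fun i => op c (g i)); split; first by move=> i; exists (g i).
  move=> _ [w Mw ->]; have [b ->] := gE w Mw; exists b.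
  rewrite (lin_sum ol); apply: eq_bigr => i _; exact: op_l.
- rewrite predeqE => y; split=> [[s [sP ->]]|[s [sP ->]]].
    have /choice[w wP] : forall p : B * Y, exists w, p \in s -> M w /\ p.2 = op c w.
      move=> p; case: (boolP (p \in s)) => [ps|]; last by exists 0.
      by have [_ [w Mw E]] := sP p ps; exists w.
    have : BplusL (@Om_l _ _ Y) M (\sum_(p <- s) inB p.1 * w p).
      exists [seq (p.1, w p) | p <- s]; rewrite big_map; split=> // _ /mapP[p ps ->].
      by split; [exact: (sP p ps).1|exact: (wP p ps).1].
    rewrite LR => -[s' [sP' E]].
    exists [seq (op c p.1, p.2) | p <- s']; split.
      move=> _ /mapP[p ps ->]; have [Mp bp] := sP' p ps; split=> //; by exists p.1.
    transitivity (op c (\sum_(p <- s) inB p.1 * w p)).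
      rewrite (lin_sum ol) !big_seq; apply: eq_bigr => p ps.
      by rewrite op_l /Om_l (wP p ps).2.
    rewrite E (lin_sum ol) big_map; apply: eq_bigr => p _; exact: op_r.
  have /choice[w wP] : forall p : Y * B, exists w, p \in s -> M w /\ p.1 = op c w.
    move=> p; case: (boolP (p \in s)) => [ps|]; last by exists 0.
    by have [[w Mw E] _] := sP p ps; exists w.
  have : BplusR (@Om_r _ _ Y) M (\sum_(p <- s) w p * inB p.2).
    exists [seq (w p, p.2) | p <- s]; rewrite big_map; split=> // _ /mapP[p ps ->].
    by split; [exact: (wP p ps).1|exact: (sP p ps).2].
  rewrite -LR => -[s' [sP' E]].
  exists [seq (p.1, op c p.2) | p <- s']; split.
    move=> _ /mapP[p ps ->]; have [bp Mp] := sP' p ps; split=> //; by exists p.2.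
  transitivity (op c (\sum_(p <- s) w p * inB p.2)).
    rewrite (lin_sum ol) !big_seq; apply: eq_bigr => p ps.
    by rewrite op_r /Om_r (wP p ps).2.
  rewrite E (lin_sum ol) big_map; apply: eq_bigr => p _; exact: op_l.
Qed.

Let Om_fibre_op (U : lmodType C) (f : Y -> U) c : Om_fibre f -> Om_fibre (f \o op c).
Proof.
move=> ff; have [fl f0] := ff; split=> [a x y|_ [s [sP ->]]] /=.
  by rewrite op_lin fl.
rewrite (lin_sum (op_lin c)) (lin_sum fl) big_seq big1 // => p ps.
by rewrite /Om_l op_l (Om_fibre_l _ _ ff) /epsB (sP p ps).1 scale0r.
Qed.

(* If all T - c were onto, then so would be chi(T), chi the characteristic
   polynomial of the matrix of T on the fibre; but chi(T) kills the fibre. *)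
Lemma op_not_onto : exists c, op_img c <> M.
Proof.
apply: contrapT => no.
have onto c w : M w -> exists2 v, M v & w = op c v.
  have : op_img c = M by apply: contrapT => ne; apply: no; exists c.
  by move=> E; rewrite -{1}E.
have [_ _ [m [g [gM gE]]] _] := M_sub; have [_ Mn0 _] := K_irr.
apply: Mn0; apply/predeqP => w; split=> [Mw|->]; last exact: Omab0.
case: m => [|m] in g gM gE *.
  by have [b ->] := gE w Mw; rewrite big_ord0.
have /choice[tt ttE] : forall i, exists b : 'I_m.+1 -> B, T (g i) = \sum_j inB (b j) * g j.
  by move=> i; have [b E] := gE _ (T_M (gM i)); exists b; exact: E.
(* The generators may be dependent on the fibre, so Tm is only a lift of the induced map;
   Cayley-Hamilton for the lift suffices. *)
pose Tm : 'M[C]_m.+1 := \matrix_(i, j) epsB (tt i j).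
pose G (a : 'rV[C]_m.+1) : Y := \sum_i a 0 i *: g i.
have Gl : linear G.
  move=> c a b; rewrite /G scaler_sumr -big_split; apply: eq_bigr => i _ /=.
  by rewrite !mxE scalerDl scalerA.
have fT (U : lmodType C) (f : Y -> U) c a : Om_fibre f -> f (op c (G a)) = f (G (a *m (Tm - c%:M))).
  move=> ff; have [fl f0] := ff.
  rewrite mulmxBr mul_mx_scalar (linB Gl) (linZ Gl) /op !(linB fl).
  congr (_ - _); rewrite /G (lin_sum T_lin) !(lin_sum fl).
  transitivity (\sum_i \sum_j (a 0 i * epsB (tt i j)) *: f (g j)).
    apply: eq_bigr => i _; rewrite (linZ T_lin) ttE (linZ fl) (lin_sum fl) scaler_sumr.
    by apply: eq_bigr => j _; rewrite (Om_fibre_l _ _ ff) scalerA.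
  rewrite exchange_big; apply: eq_bigr => j _ /=.
  rewrite (linZ fl) mxE scaler_suml; apply: eq_bigr => i _.
  by rewrite mxE.
pose ops cs w := foldr op w cs.
have fops cs (U : lmodType C) (f : Y -> U) a : Om_fibre f ->
    f (ops cs (G a)) = f (G (a *m horner_mx Tm (\prod_(c <- rev cs) ('X - c%:P)))).
  elim: cs U f a => [|c cs IH] U f a ff; first by rewrite big_nil rmorph1 mulmx1.
  have fc := Om_fibre_op c ff; rewrite /= -/((f \o op c) _) IH //= fT //.
  rewrite rev_cons big_rcons /= rmorphM rmorphB /= horner_mx_X horner_mx_C.
  by rewrite -mulmxA.
have opsF cs (U : lmodType C) (f : Y -> U) : Om_fibre f -> Om_fibre (f \o ops cs).
  by elim: cs U f => [|c cs IH] U f ff //; exact: (IH _ _ (Om_fibre_op c ff)).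
have opsM cs v : M v -> exists2 v', M v' & v = ops cs v'.
  elim: cs v => [|c cs IH] v Mv; first by exists v.
  have [v1 Mv1 ->] := onto c v Mv; have [v2 Mv2 ->] := IH v1 Mv1.
  by exists v2.
have [rs rsE] := closed_field_poly_normal (char_poly Tm).
rewrite (monicP (char_poly_monic Tm)) scale1r in rsE.
have f0 (U : lmodType C) (f : Y -> U) v : Om_fibre f -> M v -> f v = 0.
  move=> ff Mv; have [v' Mv' ->] := opsM (rev rs) v Mv.
  have ff' := opsF (rev rs) _ _ ff.
  have [b ->] := gE v' Mv'; rewrite -/((f \o ops (rev rs)) _) (lin_sum ff'.1).
  have gz i : (f \o ops (rev rs)) (g i) = 0.
    have -> : g i = G (delta_mx 0 i).
      rewrite /G (bigD1 i) //= mxE !eqxx scale1r big1 ?addr0 // => j ji.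
      by rewrite mxE (negPf ji) andbF scale0r.
    rewrite /= fops // revK -rsE Cayley_Hamilton mulmx0 (lin0 Gl).
    by rewrite (lin0 ff.1).
  by rewrite big1 // => i _; rewrite (Om_fibre_l _ _ ff') gz scaler0.
have [s Es sM] := dL_rep_Omab Mw.
by apply: (Om_takeuchi Es) => p ps U f ff; apply: f0 => //; exact: sM.
Qed.

(** Irreducibility is applied to the image of T - c, not to its kernel: subobjects have to be
    finitely generated, which images inherit directly. The price is that some T - c must be shown
    not to be onto. *)
Lemma endo_scalar : exists c, forall w, M w -> T w = c *: w.
Proof.
have [c cM] := op_not_onto; have [_ _ irr] := K_irr.
exists c => w Mw.
have sub : op_img c `<=` M by move=> _ [v Mv ->]; exact: op_M.
have [E|//] := irr _ (op_img_sub c) sub.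
have : op_img c (op c w) by exists w.
by rewrite E /= /op => /eqP; rewrite subr_eq0 => /eqP.
Qed.

End Endomorphism.

(** A two-form is here a top form kap b. On the fibre b acts as eps(b), so the coinvariant form rho
    - eps(b) kap has zero class and vanishes. *)
Lemma coinvar_11_scalar1 rho : n = 1 -> coinvar rho -> Omab bd 1 1 rho ->
  exists c, rho = c *: kap.
Proof.
move=> n1 cr r11.
have [b rb] : exists b, rho = kap * inB b.
  by have := @top_form _ K rho; rewrite n1 expr1; apply; exact: (Omab_deg r11).
exists (epsB b); apply/eqP; rewrite -subr_eq0; apply/eqP.
have [pl pr] := pureC_bilin A Y.
apply: (@Om_takeuchi _ K _ [:: (1, rho - epsB b *: kap)]).
  rewrite big_seq1 (linB (@dL_lin C K)) (linZ (@dL_lin C K)) cr (coinvar_kap K).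
  by rewrite (linB (pr _)) (linZ (pr _)).
move=> _ /[1!inE] /eqP -> U f ff /=; have [fl _] := ff.
by rewrite (linB fl) (linZ fl) rb (Om_fibre_r _ _ ff) subrr.
Qed.

(** * Coinvariant (1,1)-forms when n >= 2 *)

Section DimAtLeast2.
Hypothesis n2 : (1 < n)%N.

Let kap_inj1 w v : deg 1 w = w -> deg 1 v = v ->
  kap ^+ n.-1 * w = kap ^+ n.-1 * v -> w = v.
Proof. by move=> w1 v1; rewrite -subn1; exact: lef_inj. Qed.

Let sz : (n.-1 + n.-1 + 1 = n.*2 - 1)%N. Proof. by rewrite -addnn; lia. Qed.

(** The inverse Lefschetz isomorphism from degree 2n - 1 to degree 1; projecting z first makes it
    linear on all of Om. *)
Definition lef_inv z : Y :=
  xget 0 [set y : Y | deg 1 y = y /\ kap ^+ n.-1 * y = deg (n.*2 - 1) z].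

Lemma lef_invP z : deg 1 (lef_inv z) = lef_inv z /\
  kap ^+ n.-1 * lef_inv z = deg (n.*2 - 1) z.
Proof.
rewrite /lef_inv; set Q := [set _ | _].
apply: (xgetPex 0 (P := Q)); rewrite /Q /=.
have z1 : deg (n.*2 - 1) (deg (n.*2 - 1) z) = deg (n.*2 - 1) z by rewrite deg_proj eqxx.
by have [v v1 vE] := lef_surj n2 z1; exists v; rewrite -subn1.
Qed.

Lemma lef_invE z y : deg 1 y = y -> kap ^+ n.-1 * y = deg (n.*2 - 1) z -> lef_inv z = y.
Proof.
by move=> y1 yz; have [i1 iz] := lef_invP z; apply: kap_inj1 => //; rewrite iz yz.
Qed.

Lemma lef_inv_lin : linear lef_inv.
Proof.
move=> c x y; have [x1 xE] := lef_invP x; have [y1 yE] := lef_invP y.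
apply: lef_invE; first by rewrite linearP x1 y1.
by rewrite mulrDr -scalerAr xE yE linearP.
Qed.

Lemma deg_kap1 w : deg 1 w = w -> deg (n.*2 - 1) (kap ^+ n.-1 * w) = kap ^+ n.-1 * w.
Proof.
by move=> w1; rewrite -sz; apply: deg_mul => //; exact: Omab_deg (kap_Omab K n.-1).
Qed.

Lemma lef_invK w : deg 1 w = w -> lef_inv (kap ^+ n.-1 * w) = w.
Proof. by move=> w1; apply: lef_invE => //; rewrite deg_kap1. Qed.

Lemma coinvar_11_scalar2 rho : coinvar rho -> Omab bd 1 1 rho ->
  exists c, rho = c *: kap.
Proof.
move=> cr r11; have rc := coinvar_central cr (Omab_deg r11).
(* For a one-form w the argument has degree 2(n - 2) + 1 + 2 = 2n - 1. The projection [deg 1]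
   extends T linearly to all forms. *)
pose T w := lef_inv (kap ^+ n.-2 * (deg 1 w * rho)).
have n21 : n.-1 = n.-2.+1 by lia.
have degT w : deg (n.*2 - 1) (kap ^+ n.-2 * (deg 1 w * rho)) = kap ^+ n.-2 * (deg 1 w * rho).
  have -> : (n.*2 - 1 = (n.-2 + n.-2) + (1 + 2))%N by rewrite -addnn; lia.
  apply: deg_mul; first exact: Omab_deg (kap_Omab K n.-2).
  by apply: deg_mul; [rewrite deg_proj eqxx|exact: Omab_deg r11].
have T1 w : deg 1 (T w) = T w by have [] := lef_invP (kap ^+ n.-2 * (deg 1 w * rho)).
have TE w : kap ^+ n.-1 * T w = kap ^+ n.-2 * (deg 1 w * rho).
  by have [_ ->] := lef_invP (kap ^+ n.-2 * (deg 1 w * rho)).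
have T_lin : linear T.
  by move=> c x y; rewrite /T linearP mulrDl mulrDr -scalerAl -scalerAr lef_inv_lin.
have kapA k y w : kap ^+ k * (y * w) = y * (kap ^+ k * w) by rewrite mulrA kap_central -mulrA.
have T_l b w : T (inB b * w) = inB b * T w.
  apply: kap_inj1; rewrite ?T1 // ?deg_inBl ?T1 //.
  by rewrite TE deg_inBl -(mulrA (inB b)) (kapA _ (inB b) (T w)) TE (kapA _ (inB b)).
have T_r b w : T (w * inB b) = T w * inB b.
  apply: kap_inj1; rewrite ?T1 // ?deg_inBr ?T1 //.
  by rewrite [RHS]mulrA !TE deg_inBr -!mulrA rc.
have deg10 w : Omab bd 1 0 w -> deg 1 w = w by exact: Omab_deg.
have T_M w : M w -> M (T w).
  move=> Mw.
  have TD : T w = bd 1 0 (T w) + bd 0 1 (T w).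
    by rewrite -{1}T1 (bd_sum (cqh_cplx K)) big_ord_recl big_ord1 /= addrC.
  (* A (0,1)-part would contribute in bidegree (n-1, n), whereas kap^(n-2) w rho lies in (n,
     n-1). *)
  have E0 : bd 0 1 (T w) = 0.
    apply: kap_inj1; rewrite ?linear0 ?deg_bd // mulr0 -bd_kap TE (deg10 _ Mw).
    have := bd_mul (cqh_cplx K) (kap_Omab K n.-2) (bd_mul (cqh_cplx K) Mw r11).
    move=> wab; rewrite (bd_Omab _ _ wab) ifF //; apply/negbTE; rewrite negb_and.
    by apply/orP; left; apply/eqP; lia.
  by rewrite /Omab /= [RHS]TD E0 addr0.
have T_co w s : M w -> dL w = \sum_(p <- s) p.1 ⊗ p.2 ->
    (forall p, p \in s -> M p.2) -> dL (T w) = \sum_(p <- s) p.1 ⊗ T p.2.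
  move=> Mw Es sM; have [pl pr] := pureC_bilin A Y.
  have [r Er rM] := dL_rep_Omab (T_M w Mw).
  have il := lef_inv_lin.
  have E1 := coinvar_ml (coinvar_kapX K n.-1) Er.
  have E2 := coinvar_mr cr Es.
  have := coinvar_ml (coinvar_kapX K n.-2) (w := w * rho) (s := [seq (p.1, p.2 * rho) | p <- s]).
  rewrite !big_map => /(_ E2) E3.
  (* Both sides of kap^(n-1) T(w) = kap^(n-2) w rho have explicit coactions since kap and rho are
     coinvariant; applying id ⊗ [lef_inv] removes kap^(n-1). *)
  have := congr1 (mapC (@idfun A) lef_inv) (etrans (esym E1) (etrans (congr1 (@dL _ _ Y) _) E3)).
  rewrite TE (deg10 _ Mw) => /(_ erefl).
  have := mapC_eq [seq (p.1, kap ^+ n.-1 * p.2) | p <- r] (@idfun_lin _ A) il.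
  rewrite !big_map => ->.
  have := mapC_eq [seq (p.1, kap ^+ n.-2 * (p.2 * rho)) | p <- s] (@idfun_lin _ A) il.
  rewrite !big_map => -> E4.
  rewrite Er; transitivity (\sum_(p <- r) idfun p.1 ⊗ lef_inv (kap ^+ n.-1 * p.2)).
    by rewrite !big_seq; apply: eq_bigr => p pr'; rewrite lef_invK //; exact/deg10/rM.
  rewrite E4 !big_seq; apply: eq_bigr => p ps.
  by rewrite /T (deg10 _ (sM p ps)).
have [c cE] := endo_scalar T_lin T_l T_r T_M T_co.
pose be := rho - c *: kap.
have b11 : Omab bd 1 1 be.
  rewrite /be addrC -scaleNr; apply: OmabP => //; exact: (hs_bidegree (cqh_hermitian K)).
have cb : coinvar be.
  have [pl pr] := pureC_bilin A Y.
  by rewrite /coinvar /be (linB (@dL_lin C K)) (linZ (@dL_lin C K)) cr (coinvar_kap K) (linB (pr _)) (linZ (pr _)).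
have bc := coinvar_central cb (Omab_deg b11).
pose x := kap ^+ n.-2 * be.
have xab : Omab bd (n.-2 + 1) (n.-2 + 1) x := bd_mul (cqh_cplx K) (kap_Omab K n.-2) b11.
have xc w : x * w = w * x by rewrite /x -mulrA bc mulrA kap_central mulrA.
have kc w : kap * w = w * kap := hs_central (cqh_hermitian K) w.
have x10 w : M w -> x * w = 0.
  move=> Mw; rewrite /x -mulrA bc /be mulrBr mulrBr -{1}(deg10 _ Mw) -TE (cE _ Mw).
  by rewrite -!scalerAr -kc mulrA -exprSr -n21 subrr.
have x11 := annihilator_11 xab xc x10.
exists c; apply/eqP; rewrite -subr_eq0 -/be; apply/eqP.
apply: contrapT => /eqP be0.
have [_] := hm_pos (cqh_metric K) be0; case.
have d2 : (2 <= cdim Y)%N by rewrite cqh_dim -addnn; lia.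
rewrite (metricE d2 (Omab_deg b11) (Omab_deg b11)).
have sb11 : Omab bd 1 1 (ostar be) := bd_star (cqh_cplx K) b11.
(* Since x kap = 0, the adjoint of be is primitive and its Hodge image is a multiple of kap^(n-2)
   be^*. Its product with be is then a multiple of x be^* = 0, so be has zero norm. *)
have pz : kap ^+ (n - 2).+1 * ostar be = 0.
  rewrite -ostar_kap; have -> : kap ^+ (n - 2).+1 * be = x * kap.
    by rewrite exprSr -mulrA kc mulrA /x; congr (kap ^+ _ * _ * _); lia.
  by rewrite x11 ?ostar0 //; exact: (hs_bidegree (cqh_hermitian K)).
have prim : primitive bd n kap 1 1 (ostar be).
  by rewrite /primitive /= addn1 n2; split=> //; rewrite -iter_lef in pz; exact: pz.
have [_ _ _ hP] := hodgeP K.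
have := hP 1 1 0%N (ostar be) n2 prim; rewrite [iter 0 _ _]/= => ->.
rewrite iter_lef -scalerAr.
have -> : (n - 0 - (1 + 1) = n.-2)%N by lia.
by rewrite [be * _]mulrA bc -/x (x11 _ sb11) scaler0 hodge0 toB0.
Qed.

End DimAtLeast2.

Lemma coinvar_11_scalar rho : coinvar rho -> Omab bd 1 1 rho ->
  exists c, rho = c *: kap.
Proof.
case: (ltnP 1 n) => [n2|n1]; first exact: coinvar_11_scalar2.
by apply: coinvar_11_scalar1; apply/eqP; rewrite eqn_leq n1 half_dim_gt0.
Qed.

End Irreducible.

(** * Positivity *)

Section Positivity.
Variables (C : numClosedFieldType) (K : CQHHermitian C).
Local Notation X := (cqh_space K).
Local Notation A := (hsA X).
Local Notation B := (coinv X).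
Local Notation Y := (cqh_calc K).
Local Notation bd := (cqh_bd K).
Local Notation n := (half_dim K).
Local Notation kap := (kappa K).
Local Notation hstar := (hodge bd n kap).
Local Notation met := (metric bd n kap).
Implicit Types w v x y : Y.

Lemma above_top k w : (n.*2 < k)%N -> deg k w = w -> w = 0.
Proof. by move=> nk <-; apply: deg_gt; rewrite cqh_dim. Qed.

Lemma deg_kap k j w : deg j w = w -> deg (k.*2 + j) (kap ^+ k * w) = kap ^+ k * w.
Proof.
by move=> wj; rewrite -addnn; apply: deg_mul => //; exact: Omab_deg (kap_Omab K k).
Qed.

(** The Hodge formula at j = n and k = 0, with factor n!/0!; this evaluates top forms in the
    integration argument. *)
Lemma hodge_top b : hstar (kap ^+ n * inB b) = n`!%:R *: inB b.
Proof.
have [_ _ _ hP] := hodgeP K.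
have prim : primitive bd n kap 0 0 (inB b).
  rewrite /primitive /=; split; first exact: Omab_inB.
  have := iter_lef n.+1 (inB b : Y); rewrite -[iter n.+1 _ _]/(lefschetz _ _) subn0 => ->.
  apply: (@above_top (n.+1.*2 + 0)%N); first by rewrite addn0 ltn_double.
  by apply: deg_kap; exact: Omab_deg (Omab_inB b).
have := hP 0%N 0%N n (inB b); rewrite !addn0 leqnn => /(_ isT prim) /=.
rewrite !iter_lef => ->; rewrite subnn sub0n !expr0 !mul1r; congr (_ *: _).
by rewrite fact0 divr1.
Qed.

Section OneForms.
Variables (a b : nat) (ep : C).
Hypothesis ab1 : (a + b = 1)%N.
Hypothesis epE : ep = - 'i ^ (b%:Z - a%:Z).

(** The constant - i^(b-a) is the Hodge coefficient of nu^*, a primitive one-form of bidegree (b,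
    a). The factor n is n!/(n-1)!, from [hodge_top] and the Hodge formula in degree one. *)
Lemma metric_one_form nu (f : B) : Omab bd a b nu ->
  nu * ostar nu * kap ^+ n.-1 = kap ^+ n * inB f -> met nu nu = (ep * n%:R) *: f.
Proof.
move=> nuab nuE; have n0 := half_dim_gt0 K.
have d1 : deg 1 nu = nu by rewrite -ab1; exact: Omab_deg.
have l1 : (1 <= cdim Y)%N by rewrite cqh_dim -addnn; lia.
rewrite (metricE l1 d1 d1).
have sab := bd_star (cqh_cplx K) nuab.
have ba1 : (b + a = 1)%N by rewrite addnC.
have pz : kap ^+ (n - 1).+1 * ostar nu = 0.
  apply: (@above_top ((n - 1).+1.*2 + 1)%N); first by rewrite -addnn; lia.
  by apply: deg_kap; rewrite -ba1; exact: Omab_deg.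
have prim : primitive bd n kap b a (ostar nu).
  by rewrite /primitive /= ba1 n0; split=> //; rewrite -iter_lef in pz; exact: pz.
have [_ _ _ hP] := hodgeP K.
have := hP b a 0%N (ostar nu); rewrite add0n ba1 => /(_ n0 prim) /=.
rewrite iter_lef subn0 => ->.
rewrite -scalerAr hodgeZ.
have -> : nu * (kap ^+ (n - 1) * ostar nu) = kap ^+ n * inB f.
  by rewrite subn1 -nuE kap_central mulrA.
rewrite hodge_top scalerA -(linZ (linear_fun (@inB _ _ Y))) toBK; congr (_ *: _).
rewrite epE fact0 subn1 expr1 mulN1r !mulNr; congr (- _).
rewrite -!mulrA; congr (_ * _).
case: n n0 => // m _; rewrite /= factS natrM mul1r mulrCA mulVf ?mulr1 //.
by rewrite pnatr_eq0 -lt0n fact_gt0.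
Qed.

End OneForms.

Hypothesis kahler : is_kahler K.

Lemma d_kapX k : d (kap ^+ k) = 0.
Proof.
elim: k => [|k IH].
  have d1 : deg 0 (1 : Y) = 1.
    by rewrite -(rmorph1 (@inB _ _ Y)); exact: Omab_deg (Omab_inB _).
  have := d_mul (1 : Y) 1; rewrite (gsignE d1) expr0 !mulr1 mul1r => e1.
  by apply: (addrI (d (1 : Y))); rewrite -e1 addr0.
by rewrite exprS d_mul kahler IH mul0r mulr0 addr0.
Qed.

Section Line.
Variable E : lineModule K.
Local Notation l := (@lm_l C K E).
Local Notation h := (@lm_form C K E).
Local Notation delta := (@lm_coact C K E).
Variables (N : nat) (u : 'I_N -> E).
Hypothesis uE : forall e, \sum_i l (h e (u i)) (u i) = e.
Variable c : C.
Hypothesis curvE : forall e g, curv_form e g = c *: (inB (h e g) * kap).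

Let Eh := lm_hermitian E.
Let hnorm (e : E) : C := haar (coinv_val (h e e)).
Let Mnorm (w : Y) : C := haar (coinv_val (met w w)).

Lemma hnorm_gt0 e : e != 0 -> 0 < hnorm e.
Proof. by move=> e0; have [_ hm _] := Eh; exact: Bgt0_haar (hm_pos hm e0). Qed.

Lemma Mnorm_gt0 w : w != 0 -> 0 < Mnorm w.
Proof. by move=> w0; apply: Bgt0_haar; exact: (hm_pos (cqh_metric K) w0). Qed.

Lemma Mnorm_ge0 w : 0 <= Mnorm w.
Proof.
have [->|/Mnorm_gt0/ltW //] := eqVneq w 0.
rewrite /Mnorm /metric big1 => [|k _]; last by rewrite linear0 mul0r hodge0.
by rewrite toB0 (lin0 (@val_lin _ X)) linear0.
Qed.

(* Stokes for the form h(nabla e, e) kappa^(n-1). *)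
Lemma bochner a b ep e : (a + b = 1)%N -> ep = - 'i ^ (b%:Z - a%:Z) ->
  (forall g, Omab bd a b (gamma e g)) ->
  ep * n%:R * c * hnorm e = \sum_i Mnorm (gamma e (u i)).
Proof.
move=> ab1 epE gab; have n0 := half_dim_gt0 K.
have nE : (n.*2 = n.-1.*2 + (1 + 1))%N by rewrite -!addnn; lia.
(* f_i is the density of the top form gamma gamma^* kap^(n-1) relative to kap^n, and
   [metric_one_form] relates it to the squared norm of gamma(e, u_i). *)
have /choice[f fE] : forall i, exists f : B, gamma e (u i) * ostar (gamma e (u i)) * kap ^+ n.-1 =
    kap ^+ n * inB f.
  move=> i; apply: top_form; rewrite -kap_central nE; apply: deg_kap.
  by apply: deg_mul; rewrite ?deg_ostar deg1_gamma.
have ME i : Mnorm (gamma e (u i)) = ep * n%:R * haar (coinv_val (f i)).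
  rewrite /Mnorm (metric_one_form ab1 epE (gab _) (fE i)).
  by rewrite (linZ (@val_lin _ X)) linearZ.
under eq_bigr do rewrite ME; rewrite -mulr_sumr -!mulrA; do 2!congr (_ * _).
pose w := gamma e e * kap ^+ n.-1.
have w1 : Omk (n.*2.-1) w.
  have -> : n.*2.-1 = (n.-1.*2 + 1)%N by rewrite -!addnn; lia.
  by rewrite /Omk /= /w -kap_central; apply: deg_kap; exact: deg1_gamma.
have kS : kap ^+ n = kap * kap ^+ n.-1 by rewrite -exprS prednK.
have dw : d w = kap ^+ n * inB (c *: h e e - \sum_i f i).
  have il := linear_fun (@inB _ _ Y).
  rewrite /w d_mul d_kapX mulr0 addr0.
  have -> : d (gamma e e) = curv_form e e - \sum_i gamma e (u i) * ostar (gamma e (u i)).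
    by rewrite (curv_formE uE) addrK.
  rewrite mulrBl curvE -scalerAl -mulrA -kS mulr_suml (linB il) (linZ il) (lin_sum il).
  rewrite mulrBr -scalerAr kap_central; congr (_ - _).
  by rewrite mulr_sumr; apply: eq_bigr => i _; exact: fE.
have := cqh_closed w1; rewrite dw hodge_top -(linZ (linear_fun (@inB _ _ Y))) toBK.
have vl := @val_lin _ X.
rewrite -[X in haar X]/(coinv_val _) (linZ vl) (linB vl) (linZ vl) (lin_sum vl) linearZ linearB linearZ linear_sum /=.
move=> /eqP; rewrite mulf_eq0 pnatr_eq0 -[_ == 0%N]negbK -lt0n fact_gt0 /=.
by rewrite subr_eq0 => /eqP.
Qed.

End Line.
End Positivity.

(** * Signs of the curvature constant and the three cases *)

Section Trichotomy.
Variables (C : numClosedFieldType) (K : CQHHermitian C).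
Hypotheses (K_kahler : is_kahler K) (K_irr : is_irreducible K).
Variable E : lineModule K.
Local Notation X := (cqh_space K).
Local Notation Y := (cqh_calc K).
Local Notation bd := (cqh_bd K).
Local Notation n := (half_dim K).
Local Notation kap := (kappa K).
Local Notation l := (@lm_l C K E).
Local Notation h := (@lm_form C K E).

Lemma line_frame_exists : exists N (u : 'I_N -> E) (t : 'I_N -> 'I_N -> hsA X),
  [/\ forall i, lm_coact (u i) = \sum_k t i k ⊗ u k,
      forall k m, \sum_i star (t i k) * t i m = (k == m)%:R &
      forall e, \sum_i l (h e (u i)) (u i) = e].
Proof.
have [phi [e0 [phil phi1 _ phiU]]] := quotm_dim1 (lm_line E).
exact: (line_frame (lm_hermitian E) phil phi1 phiU).
Qed.

Lemma curvature_scalar : exists c, forall e g : E,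
  curv_form e g = c *: (inB (h e g) * kap).
Proof.
have [N [u [t [ut tu uE]]]] := line_frame_exists.
have [rho [cr rE [s rs]]] := line_twist (curv_lin uE) (curv_conj uE)
  (curv_l uE) (curv_r uE) (equiv_curv ut tu uE).
have r11 : Omab bd 1 1 rho.
  by rewrite rs /Omab /= linear_sum; apply: eq_bigr => p _; exact: (curv_11 uE).
have [c cE] := coinvar_11_scalar K_irr cr r11.
by exists c => e g; rewrite rE cE scalerAr.
Qed.

Lemma H0_delbarP (e : E) : H0_delbar E e <-> forall g, bd 0 1 (gamma e g) = 0.
Proof.
have [N [u [t [_ _ uE]]]] := line_frame_exists.
rewrite /H0_delbar /=; split=> [e0 g|e0].
  by rewrite bd01_gamma /gamma01 e0 (lin0 (pairing_lin _)).
apply: (pairing_inj uE) => g.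
by rewrite (lin0 (pairing_lin _)) -[LHS]/(gamma01 e g) -bd01_gamma.
Qed.

Lemma H0_delP (e : E) : H0_del E e <-> forall g, bd 1 0 (gamma e g) = 0.
Proof.
have [N [u [t [_ _ uE]]]] := line_frame_exists.
have dE g : pairing (lm_del e) g = bd 1 0 (gamma e g).
  by rewrite (pairing_mapB _ _ (bd_rightB K _ _)) (pairing_chern uE).
rewrite /H0_del /=; split=> [e0 g|e0].
  by rewrite -dE e0 (lin0 (pairing_lin _)).
by apply: (pairing_inj uE) => g; rewrite dE (lin0 (pairing_lin _)) e0.
Qed.

Lemma gamma0 (g : E) : gamma 0 g = 0.
Proof. exact: (lin0 (gamma_lin g)). Qed.

Lemma H0_neq0 (H : set E) : H 0 -> H <> [set 0] -> exists2 e, e != 0 & H e.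
Proof.
move=> H0 ne; apply: contrapT => no; apply: ne; apply/predeqP => e; split=> [He|->//].
by apply: contrapT => /eqP e0; apply: no; exists e.
Qed.

Variable c : C.
Hypothesis curvE : forall e g : E, curv_form e g = c *: (inB (h e g) * kap).

Lemma lm_curvatureE (e : E) : lm_curvature e = c *: pureB l kap e.
Proof.
have [N [u [t [_ _ uE]]]] := line_frame_exists.
apply: (pairing_inj uE) => g; rewrite -[LHS]/(curv_form e g) curvE.
rewrite (linZ (pairing_lin _)) pairing_pure.
by rewrite (hs_central (cqh_hermitian K)).
Qed.

(** When gamma(e, g) has a single type for every g, [bochner] equates a positive multiple of ep c
    with a sum of squared norms. For c = 0 every gamma(e, u_i) vanishes, and the frame expansion
    extends this to all g. *)
Lemma type_sign a b ep (e : E) : (a + b = 1)%N -> ep = - 'i ^ (b%:Z - a%:Z) ->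
  (forall g, Omab bd a b (gamma e g)) -> e != 0 ->
  0 <= ep * c /\ (c = 0 -> forall g, gamma e g = 0).
Proof.
move=> ab1 epE gab e0; have [N [u [t [_ _ uE]]]] := line_frame_exists.
have bo := bochner K_kahler uE curvE ab1 epE gab.
have he := hnorm_gt0 e0; have n0 : (0 : C) < n%:R by rewrite ltr0n half_dim_gt0.
have M0 i : true -> 0 <= haar (coinv_val (metric bd n kap (gamma e (u i)) (gamma e (u i)))).
  by move=> _; exact: Mnorm_ge0.
split.
  have : 0 <= (n%:R * haar (coinv_val (h e e))) * (ep * c).
    have -> : n%:R * haar (coinv_val (h e e)) * (ep * c) = ep * n%:R * c * haar (coinv_val (h e e)).
      by rewrite [LHS]GRing.mulrC; ring.
    by rewrite bo sumr_ge0.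
  by rewrite pmulr_rge0 // mulr_gt0.
move=> c0 g; move: bo; rewrite c0 mulr0 mul0r => /esym /(psumr_eq0P M0) u0.
rewrite -(sum_gamma_form uE) big1 // => i _.
have [->|g0] := eqVneq (gamma e (u i)) 0; first by rewrite mul0r.
by have := Mnorm_gt0 g0; rewrite (u0 i isT) ltxx.
Qed.

Lemma delbar_sign (e : E) : H0_delbar E e -> e != 0 ->
  0 <= 'i * c /\ (c = 0 -> forall g, gamma e g = 0).
Proof.
move=> /H0_delbarP e1; apply: (@type_sign 1 0) => //.
  (* For type (1,0) the constant is - i^(-1) = i; for type (0,1) it is - i. *)
  by rewrite sub0r -invr_expz expr1z invCi opprK.
by move=> g; rewrite /Omab /= [RHS]gamma_bd e1 addr0.
Qed.

Lemma del_sign (e : E) : H0_del E e -> e != 0 ->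
  0 <= - 'i * c /\ (c = 0 -> forall g, gamma e g = 0).
Proof.
move=> /H0_delP e1; apply: (@type_sign 0 1) => //.
by move=> g; rewrite /Omab /= [RHS]gamma_bd e1 add0r.
Qed.

(** A non-zero vector killed by delbar forces i c >= 0, one killed by del forces i c <= 0, and
    distinct kernels exclude c = 0. *)
Lemma curvature_trichotomy :
  [/\ H0_del E <> [set 0] -> H0_delbar E <> [set 0] ->
        lm_flat E /\ H0_del E = H0_delbar E,
      H0_delbar E <> [set 0] -> H0_delbar E <> H0_del E ->
        lm_positive E /\ H0_del E = [set 0] &
      H0_del E <> [set 0] -> H0_delbar E <> H0_del E ->
        lm_negative E /\ H0_delbar E = [set 0]].
Proof.
have D0 : H0_del E 0 by apply/H0_delP => g; rewrite gamma0 linear0.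
have Db0 : H0_delbar E 0 by apply/H0_delbarP => g; rewrite gamma0 linear0.
have ci : 'i * ('i * c) = - c by rewrite mulrA -expr2 sqrCi mulN1r.
(* For c = 0 every vector of either kernel is parallel, so it lies in the other kernel. *)
have eqc : c = 0 -> H0_del E = H0_delbar E.
  move=> c0; apply/predeqP => e; have [->//|e0] := eqVneq e 0; split=> He.
    by have [_ /(_ c0) g0] := del_sign He e0; apply/H0_delbarP => g; rewrite g0 linear0.
  by have [_ /(_ c0) g0] := delbar_sign He e0; apply/H0_delP => g; rewrite g0 linear0.
have ic0 : 'i * c = 0 -> c = 0.
  by move/eqP; rewrite mulf_eq0 (negPf (neq0Ci C)) => /eqP.
split.
- move=> /(H0_neq0 D0)[e e0 He] /(H0_neq0 Db0)[f f0 Hf].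
  have [p1 _] := del_sign He e0; have [p2 _] := delbar_sign Hf f0.
  have c0 : c = 0.
    by apply: ic0; apply/le_anti; rewrite p2 andbT -oppr_ge0 -mulNr.
  split; last exact: eqc.
  by move=> x; rewrite lm_curvatureE c0 scale0r.
- move=> /(H0_neq0 Db0)[f f0 Hf] ne; have [p2 _] := delbar_sign Hf f0.
  have pos : 0 < 'i * c.
    rewrite lt_def p2 andbT; apply/eqP => /ic0/eqc E1; exact: ne.
  split.
    (* The witness theta = i c satisfies - theta i = c. *)
    exists ('i * c) => // x; rewrite lm_curvatureE; congr (_ *: _).
    by rewrite GRing.mulrC ci opprK.
  apply/predeqP => e; split=> [He|->//]; apply: contrapT => /eqP e0.
  have [p1 _] := del_sign He e0.
  by have := lt_le_trans pos (_ : 'i * c <= 0); rewrite ltxx -oppr_ge0 -mulNr => /(_ p1).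
- move=> /(H0_neq0 D0)[f f0 Hf] ne; have [p2 _] := del_sign Hf f0.
  have pos : 0 < - 'i * c.
    rewrite lt_def p2 andbT mulNr oppr_eq0; apply/eqP => /ic0/eqc E1; exact: ne.
  split.
    exists (- 'i * c) => // x; rewrite lm_curvatureE; congr (_ *: _).
    by rewrite GRing.mulrC mulNr mulrN ci opprK.
  apply/predeqP => e; split=> [He|->//]; apply: contrapT => /eqP e0.
  have [p1 _] := delbar_sign He e0.
  by have := lt_le_trans pos (_ : - 'i * c <= 0); rewrite ltxx mulNr oppr_le0 => /(_ p1).
Qed.

End Trichotomy.

Theorem corollary3p6 (R : realType) (K : CQHHermitian R[i])
    (K_kahler : is_kahler K) (K_irreducible : is_irreducible K)
    (E : lineModule K) :
  [/\ H0_del E <> [set 0] -> H0_delbar E <> [set 0] ->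
        lm_flat E /\ H0_del E = H0_delbar E,
      H0_delbar E <> [set 0] -> H0_delbar E <> H0_del E ->
        lm_positive E /\ H0_del E = [set 0] &
      H0_del E <> [set 0] -> H0_delbar E <> H0_del E ->
        lm_negative E /\ H0_delbar E = [set 0]].
Proof.
have [c cE] := curvature_scalar K_irreducible E.
exact: (curvature_trichotomy K_kahler cE).
Qed.
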